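(* Let $E\in\mathscr K$ with endpoints $l=\inf E$, $r=\sup E$, $\mu$ a fully supported Radon measure on $E$, and $({\mathscr E},{\mathscr F})$ the Dirichlet form on $L^2(E,\mu)$ associated with a quasidiffusion on $E$: \[ {\mathscr F}=\{f\in L^2(E,\mu)\cap H^1_e(E): f(j)=0 \text{ whenever } j\notin E \text{ and } |j|<\infty \text{ for } j=l \text{ or } r\}, \] \[ {\mathscr E}(f,g)=\frac12\int_E f'(x)g'(x)\,dx+\frac12\sum_{k\ge1}\frac{(f(b_k)-f(a_k))(g(b_k)-g(a_k))}{b_k-a_k}. \] Let $\mathfrak S$ be the set of all ${\mathscr F}'$ such that $({\mathscr E}',{\mathscr F}')$ is a Fukushima subspace of $({\mathscr E},{\mathscr F})$, partially ordered by inclusion. Then $\mathfrak S$ admits a minimal element if and only if $E$ is nowhere dense (i.e. has empty interior). In that case the minimal element ${\mathscr F}'$ is unique, its characteristic set is the empty set, and its strongly local part vanishes, i.e. for all $f,g\in{\mathscr F}'$, \[ {\mathscr E}'(f,g)=\frac12\sum_{k\ge1}\frac{(f(b_k)-f(a_k))(g(b_k)-g(a_k))}{b_k-a_k}. \]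
   Context: $\mathscr K$ is the family of $E\subset\mathbb R$ such that $E\cup\{l,r\}$ is closed in $[-\infty,\infty]$, where $l=\inf E<r=\sup E$. $I$ is the interval with endpoints $l,r$ containing $l$ (resp. $r$) iff it belongs to $E$; $I\setminus E=\bigcup_{k\ge1}(a_k,b_k)$ disjoint open intervals. $H^1_e(E)$ is the set of restrictions to $E$ of absolutely continuous $f$ on $(l,r)$ with $f'\in L^2((l,r))$. A Fukushima subspace of $({\mathscr E},{\mathscr F})$ is a regular Dirichlet form $({\mathscr E}',{\mathscr F}')$ on $L^2(E,\mu)$ with ${\mathscr F}'\subset{\mathscr F}$ and ${\mathscr E}'={\mathscr E}$ on ${\mathscr F}'$. A minimal element is ${\mathscr F}'\in\mathfrak S$ such that ${\mathscr F}''\in\mathfrak S$, ${\mathscr F}''\subset{\mathscr F}'$ implies ${\mathscr F}''={\mathscr F}'$. Every Fukushima subspace has the form ${\mathscr F}'=\{f\in L^2(E,\mu)\cap H^1_{e,\mathbf s}(E): f(j)=0$ whenever $j\notin E$, $|\mathbf s(j)|<\infty\}$, ${\mathscr E}'(f,g)=\frac12\int_E\frac{df}{d\mathbf s}\frac{dg}{d\mathbf s}d\mathbf s+\frac12\sum_k\frac{(f(b_k)-f(a_k))(g(b_k)-g(a_k))}{\mathbf s(b_k)-\mathbf s(a_k)}$ for a scale function $\mathbf s=\bar{\mathbf s}|_E$ with $\bar{\mathbf s}$ strictly increasing, absolutely continuous on $I$, $\bar{\mathbf s}'\in\{0,1\}$ a.e., $\bar{\mathbf s}'=1$ on $I\setminus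 E$ (here $H^1_{e,\mathbf s}(E)$ is the set of restrictions to $E$ of $f=g\circ\bar{\mathbf s}$ with $g$ absolutely continuous and $\int_I(g'\circ\bar{\mathbf s})^2d\bar{\mathbf s}<\infty$, $df/d\mathbf s=(g'\circ\bar{\mathbf s})|_E$); its characteristic set is $\{x\in E:\bar{\mathbf s}'(x)=1\}$, a Lebesgue-a.e. equivalence class. *)

(* Defs.v *)
From mathcomp Require Import all_boot all_order all_algebra.
From mathcomp Require Import all_classical all_reals all_analysis.
Import Order.TTheory GRing.Theory Num.Theory.
Import numFieldNormedType.Exports.
Set Implicit Arguments.
Unset Strict Implicit.
Unset Printing Implicit Defensive.
Local Open Scope classical_set_scope.
Local Open Scope ring_scope.

Definition leb (R : realType) : {measure set (measurableTypeR R) -> \bar R} :=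
  @lebesgue_measure R.

Definition lend (R : realType) (E : set R) : \bar R :=
  ereal_inf [set x%:E | x in E].
Definition rend (R : realType) (E : set R) : \bar R :=
  ereal_sup [set x%:E | x in E].

Definition openI (R : realType) (E : set R) : set R :=
  [set x | (lend E < x%:E)%E /\ (x%:E < rend E)%E].

(* I : the interval with endpoints l, r containing l (resp. r) iff it
   belongs to E (E is contained in [l, r]). *)
Definition Iset (R : realType) (E : set R) : set R := openI E `|` E.

(* E \in \mathscr K : l < r and E \cup {l, r} is closed in [-oo, +oo]
   (equivalently: E together with its finite endpoints is closed in R). *)
Definition inK (R : realType) (E : set R) : Prop :=
  (lend E < rend E)%E /\
  closed (E `|` [set x | x%:E = lend E] `|` [set x | x%:E = rend E]).

(* the gaps (a_k, b_k): the connected components of I \ E, listed as the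
   pairs (a_k, b_k) *)
Definition gaps (R : realType) (E : set R) : set (R * R) :=
  [set p | p.1 < p.2 /\ E p.1 /\ E p.2 /\
           (forall x, p.1 < x < p.2 -> ~ E x)].

Definition gsum (T : choiceType) (R : realType) (S : set T) (u : T -> R) : R :=
  fine (\esum_(i in S) (Num.max (u i) 0)%:E)%E
  - fine (\esum_(i in S) (Num.max (- u i) 0)%:E)%E.

(* mu : fully supported Radon measure on E, seen as a Borel measure on R
   carried by E. *)
Definition radon_full (R : realType) (E : set R)
  (mu : {measure set (measurableTypeR R) -> \bar R}) : Prop :=
  mu (~` E) = 0%E /\
  (forall K : set R, compact K -> K `<=` E -> (mu K < +oo)%E) /\
  (forall U : set R, open U -> U `&` E !=set0 -> (0 < mu U)%E).

Section Defs.
Variables (R : realType) (E : set R)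
  (mu : {measure set (measurableTypeR R) -> \bar R}).

Definition aeeq (f g : R -> R) : Prop := {ae mu, forall x, f x = g x}.

Definition L2 (f : R -> R) : Prop :=
  measurable_fun setT f /\ (\int[mu]_x ((f x) ^+ 2)%:E < +oo)%E.

Definition ip (f g : R -> R) : R := Rintegral mu setT (fun x => f x * g x).

(* g is absolutely continuous on (every compact subinterval of) the interval
   J, with derivative h :  g y - g x = int_[x,y] h. *)
Definition acd (J : set R) (g h : R -> R) : Prop :=
  measurable_fun setT h /\
  forall x y, J x -> J y -> x <= y ->
    (leb R).-integrable `[x, y] (fun t => (h t)%:E) /\
    g y - g x = Rintegral (leb R) `[x, y] h.

(* (g, h) : g absolutely continuous on (l,r) with g' = h in L^2((l,r)),
   plus the boundary condition g(j) = 0 when j \notin E, |j| < oo. *)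
Definition adm (g h : R -> R) : Prop :=
  acd (Iset E) g h /\
  (\int[leb R]_(x in openI E) ((h x) ^+ 2)%:E < +oo)%E /\
  (forall c : R, c%:E = lend E -> ~ E c -> g x @[x --> c^'+] --> 0) /\
  (forall c : R, c%:E = rend E -> ~ E c -> g x @[x --> c^'-] --> 0).

Definition Fdom (f : R -> R) : Prop :=
  L2 f /\ exists g h, adm g h /\ aeeq f g.

Definition rep (f : R -> R) : (R -> R) * (R -> R) :=
  xget (cst 0, cst 0) [set gh | adm gh.1 gh.2 /\ aeeq f gh.1].

Definition Eform (f g : R -> R) : R :=
  2^-1 * Rintegral (leb R) (E `&` openI E) (fun x => (rep f).2 x * (rep g).2 x)
  + 2^-1 * gsum (gaps E) (fun p =>
      ((rep f).1 p.2 - (rep f).1 p.1) * ((rep g).1 p.2 - (rep g).1 p.1)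
      / (p.2 - p.1)).

Definition jump (f g : R -> R) : R :=
  2^-1 * gsum (gaps E) (fun p =>
      ((rep f).1 p.2 - (rep f).1 p.1) * ((rep g).1 p.2 - (rep g).1 p.1)
      / (p.2 - p.1)).

Definition E1 (f g : R -> R) : R := Eform f g + ip f g.

Definition Cc (f : R -> R) : Prop :=
  {within E, continuous f} /\
  exists K : set R, compact K /\ K `<=` E /\
    (forall x, E x -> ~ K x -> f x = 0).

(* (Eform restricted to F', F') is a regular Dirichlet form on L^2(E, mu);
   F' is a set of (measurable representatives of) classes, hence closed
   under mu-a.e. equality among measurable functions. *)
Definition regular_dirichlet (F' : set (R -> R)) : Prop :=
  F' `<=` L2 /\
  (forall f g, F' f -> measurable_fun setT g -> aeeq f g -> F' g) /\
  F' (cst 0) /\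
  (forall f g, F' f -> F' g -> F' (fun x => f x + g x)) /\
  (forall (a : R) f, F' f -> F' (fun x => a * f x)) /\
  (forall f, L2 f -> forall e : R, 0 < e ->
     exists g, F' g /\ ip (fun x => f x - g x) (fun x => f x - g x) < e) /\
  (forall f g, F' f -> F' g -> Eform f g = Eform g f) /\
  (forall f, F' f -> 0 <= Eform f f) /\
  (forall (a : R) f g h, F' f -> F' g -> F' h ->
     Eform (fun x => a * f x + g x) h = a * Eform f h + Eform g h) /\
  (forall u : nat -> R -> R, (forall n, F' (u n)) ->
     (forall e : R, 0 < e -> exists N, forall m n, (N <= m)%N -> (N <= n)%N ->
        E1 (fun x => u n x - u m x) (fun x => u n x - u m x) < e) ->
     exists f, F' f /\ forall e : R, 0 < e -> exists N, forall n, (N <= n)%N ->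
        E1 (fun x => u n x - f x) (fun x => u n x - f x) < e) /\
  (forall f, F' f ->
     let g := fun x => Num.min (Num.max (f x) 0) 1 in
     F' g /\ Eform g g <= Eform f f) /\
  (forall f, F' f -> forall e : R, 0 < e ->
     exists g, F' g /\ (exists g0, Cc g0 /\ aeeq g g0) /\
       E1 (fun x => f x - g x) (fun x => f x - g x) < e) /\
  (forall f, Cc f -> forall e : R, 0 < e ->
     exists g g0, F' g /\ Cc g0 /\ aeeq g g0 /\
       forall x, E x -> `|f x - g0 x| < e).

Definition fukushima (F' : set (R -> R)) : Prop :=
  F' `<=` Fdom /\ regular_dirichlet F'.

Definition minimal_fuk (F' : set (R -> R)) : Prop :=
  fukushima F' /\
  forall F'', fukushima F'' -> F'' `<=` F' -> F'' = F'.

Definition scale (s d : R -> R) : Prop :=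
  (forall x y, Iset E x -> Iset E y -> x < y -> s x < s y) /\
  acd (Iset E) s d /\
  (forall x, d x = 0 \/ d x = 1) /\
  {ae leb R, forall x, Iset E x -> ~ E x -> d x = 1}.

(* (G, G') : G absolutely continuous on sbar(I), int_I (G' o sbar)^2 dsbar
   < oo, and f(j) = G(sbar(j)) = 0 whenever j \notin E, |sbar(j)| < oo. *)
Definition adm_s (s d G Gd : R -> R) : Prop :=
  acd (s @` Iset E) G Gd /\
  (\int[leb R]_(x in openI E) ((Gd (s x)) ^+ 2 * d x)%:E < +oo)%E /\
  (forall c : R, (forall x, Iset E x -> c < s x) ->
     (forall e : R, 0 < e -> exists x, Iset E x /\ s x < c + e) ->
     G y @[y --> c^'+] --> 0) /\
  (forall c : R, (forall x, Iset E x -> s x < c) ->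
     (forall e : R, 0 < e -> exists x, Iset E x /\ c - e < s x) ->
     G y @[y --> c^'-] --> 0).

Definition Fdom_s (s d : R -> R) (f : R -> R) : Prop :=
  L2 f /\ exists G Gd, adm_s s d G Gd /\ aeeq f (G \o s).

Definition rep_s (s d : R -> R) (f : R -> R) : (R -> R) * (R -> R) :=
  xget (cst 0, cst 0) [set p | adm_s s d p.1 p.2 /\ aeeq f (p.1 \o s)].

Definition Eform_s (s d : R -> R) (f g : R -> R) : R :=
  2^-1 * Rintegral (leb R) (E `&` openI E)
           (fun x => (rep_s s d f).2 (s x) * (rep_s s d g).2 (s x) * d x)
  + 2^-1 * gsum (gaps E) (fun p =>
      ((rep_s s d f).1 (s p.2) - (rep_s s d f).1 (s p.1))
      * ((rep_s s d g).1 (s p.2) - (rep_s s d g).1 (s p.1))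
      / (s p.2 - s p.1)).

(* The Fukushima subspace F' is represented by a scale function whose
   characteristic set {x \in E : sbar'(x) = 1} is Lebesgue-null, i.e. its
   characteristic set is (a.e.) the empty set. *)
Definition charset_empty (F' : set (R -> R)) : Prop :=
  exists s d, scale s d /\
    (forall f, F' f <-> Fdom_s s d f) /\
    (forall f g, F' f -> F' g -> Eform f g = Eform_s s d f g) /\
    leb R (E `&` [set x | d x = 1]) = 0%E.

End Defs.

(* Main.v *)
(* A set of compactly supported functions that is linear, stable under the unit
   contraction and separates points of E generates a Fukushima subspace: its
   closure in the form norm.

   If E contains an interval, any Fukushima subspace F' can be shrunk: choose a
   nowhere dense subset A of the interval of almost full measure and take the
   closure of the functions of F' that are locally constant near A. Their
   derivatives vanish on A, so a function of F' that varies by a fixed amount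
   over the interval is not in the closure.

   If E is nowhere dense, the compactly supported locally constant functions on
   E separate points. They have finite range, so they are functions of uniform
   approximations from any Fukushima subspace and hence belong to all of them.
   Their closure is therefore the least Fukushima subspace. It consists of the
   functions whose increments are the integrals of their slopes over the gaps,
   with boundary conditions relative to sc(x) = |[0, x] \ E|; these are exactly
   the functions represented by the scale sc, whose derivative vanishes on E. *)

Require Import Defs.
From mathcomp Require Import all_boot all_order all_algebra.
From mathcomp Require Import all_classical all_reals all_analysis.
From mathcomp Require Import measurable_realfun ring lra.
Import Order.TTheory GRing.Theory Num.Theory.
Import numFieldNormedType.Exports.
(* Defs.openI is shadowed by a lemma of the analysis library. *)
Import Defs.
Local Open Scope classical_set_scope.
Local Open Scope ring_scope.

Set Implicit Arguments.
Unset Strict Implicit.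
Unset Printing Implicit Defensive.

(** * Square-integrable functions *)

(** Three obstacles shape the proof. Elements of the form domain are classes modulo mu, and [rep]
    selects a pair whose density inside a gap is arbitrary apart from its integral. Energies are
    therefore computed through [der], which has the mean slope on the gaps and is unique up to
    Lebesgue null sets. Next, the unit contraction is not obviously continuous for the form norm. It
    reaches a closure by a weak compactness argument: L2 convergence with bounded energy already
    implies membership. The same device lets the density of the step core rest on a uniform energy
    bound alone. Finally, regularity yields only uniform approximations, whereas flatness needs
    exact values; composing the approximation of a plateau function with a ramp restores exact
    plateaus, and a ramp is a linear combination of unit contractions. Pointwise conclusions are
    legitimate because evaluation at a point of E is bounded in the form norm. *)

Section AlmostEverywhere.
Variables (R : realType) (m : {measure set (measurableTypeR R) -> \bar R}).
Implicit Types P Q S : R -> Prop.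

Lemma ae_imp P Q : (forall x, P x -> Q x) ->
  {ae m, forall x, P x} -> {ae m, forall x, Q x}.
Proof.
by move=> PQ; exact: (@filterS _ _ (ae_filter_ringOfSetsType m) P Q PQ).
Qed.

Lemma ae_imp2 P Q S : (forall x, P x -> Q x -> S x) ->
  {ae m, forall x, P x} -> {ae m, forall x, Q x} -> {ae m, forall x, S x}.
Proof.
by move=> PQ; exact: (@filterS2 _ _ (ae_filter_ringOfSetsType m) P Q S PQ).
Qed.

Lemma ae_all P : (forall x, P x) -> {ae m, forall x, P x}.
Proof. by move=> HP; apply: aeW. Qed.

Lemma ae_measure0 (U : set (measurableTypeR R)) : measurable U ->
  {ae m, forall x, ~ U x} -> m U = 0%E.
Proof.
move=> mU [A [mA A0 UA]]; apply: (@subset_measure0 _ _ _ m U A) => //.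
by move=> x Ux; apply: UA => /=; apply.
Qed.

Lemma measure0_notin (U : set (measurableTypeR R)) : measurable U -> m U = 0%E ->
  {ae m, forall x, ~ U x}.
Proof.
by move=> mU U0; exists U; split=> // x /= /contrapT.
Qed.

End AlmostEverywhere.

Section SquareIntegrable.
Variables (R : realType) (m : {measure set (measurableTypeR R) -> \bar R}).
Variable D : set (measurableTypeR R).
Hypothesis mD : measurable D.
Implicit Types f g h : measurableTypeR R -> R.

(** Measurability is demanded on the whole line, integrability only on D. For D = [setT] the two
    notions here unfold to [L2] and [ip], so one set of lemmas serves both mu and Lebesgue measure
    on [openI E]. *)
Definition sqi f :=
  measurable_fun setT f /\ (\int[m]_(x in D) ((f x) ^+ 2)%:E < +oo)%E.

Definition rip f g := Rintegral m D (fun x => f x * g x).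

Let msub f : measurable_fun setT f -> measurable_fun D f.
Proof. exact: measurable_funS. Qed.

Lemma le_integral_fin f g : measurable_fun setT f -> measurable_fun setT g ->
  (forall x, D x -> 0 <= f x <= g x) ->
  (\int[m]_(x in D) (f x)%:E <= \int[m]_(x in D) (g x)%:E)%E.
Proof.
move=> mf mg fg; apply: ge0_le_integral => //=.
- by move=> x /fg /andP[f0 _]; rewrite lee_fin.
- by apply/measurable_EFinP; exact: msub.
- by apply/measurable_EFinP; exact: msub.
- by move=> x /fg /andP[_ h]; rewrite lee_fin.
Qed.

Lemma integrable_ge0 f : measurable_fun setT f -> (forall x, D x -> 0 <= f x) ->
  (\int[m]_(x in D) (f x)%:E < +oo)%E -> m.-integrable D (EFin \o f).
Proof.
move=> mf f0 foo; apply/integrableP; split.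
  by apply/measurable_EFinP; exact: msub.
rewrite (le_lt_trans _ foo)// le_eqVlt; apply/orP; left; apply/eqP.
by apply: eq_integral => x /[!inE] Dx; rewrite /= ger0_norm// f0.
Qed.

Lemma le_sqi f g : measurable_fun setT f ->
  (forall x, D x -> `|f x| <= `|g x|) -> sqi g -> sqi f.
Proof.
move=> mf fg [mg goo]; split=> //; apply: le_lt_trans goo.
apply: (@le_integral_fin (fun x => f x ^+ 2) (fun x => g x ^+ 2)).
- exact: measurable_funX.
- exact: measurable_funX.
- move=> x Dx; rewrite sqr_ge0/= -[f x ^+ 2]real_normK ?num_real//.
  by rewrite -[g x ^+ 2]real_normK ?num_real// lerXn2r ?nnegrE// fg.
Qed.

Lemma sqi_integrable_sqr f : sqi f -> m.-integrable D (EFin \o (fun x => f x ^+ 2)).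
Proof.
move=> [mf foo]; apply: integrable_ge0 => //; first exact: measurable_funX.
by move=> x _; exact: sqr_ge0.
Qed.

Lemma sqi_integrableM f g : sqi f -> sqi g ->
  m.-integrable D (EFin \o (fun x => f x * g x)).
Proof.
move=> sf sg; have mfg : measurable_fun setT (fun x => f x * g x).
  by apply: measurable_funM; [case: sf | case: sg].
have := integrableD mD (sqi_integrable_sqr sf) (sqi_integrable_sqr sg).
apply: le_integrable => //.
  by apply/measurable_EFinP; exact: msub.
move=> x Dx /=; rewrite lee_fin normrM [leRHS]ger0_norm ?addr_ge0 ?sqr_ge0//.
rewrite -[f x ^+ 2]real_normK ?num_real// -[g x ^+ 2]real_normK ?num_real//.
have := sqr_ge0 (`|f x| - `|g x|).
by have := mulr_ge0 (normr_ge0 (f x)) (normr_ge0 (g x)); nra.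
Qed.

Lemma sqi_cst0 : sqi (cst 0).
Proof.
split=> //; rewrite integral0_eq ?ltry// => x _.
by rewrite /cst expr0n.
Qed.

Lemma sqiZ a f : sqi f -> sqi (fun x => a * f x).
Proof.
move=> sf; have [mf foo] := sf.
have maf : measurable_fun setT (fun x => a * f x) by exact: measurable_funM.
split=> //; under eq_integral do rewrite exprMn EFinM.
rewrite integralZl//; last exact: sqi_integrable_sqr.
have := integrable_fin_num mD (sqi_integrable_sqr sf).
by move=> /fineK <-; rewrite -EFinM ltry.
Qed.

Lemma sqiD f g : sqi f -> sqi g -> sqi (fun x => f x + g x).
Proof.
move=> sf sg; have mfg : measurable_fun setT (fun x => f x + g x).
  by apply: measurable_funD; [case: sf | case: sg].
split=> //.
have := integrableD mD (sqi_integrable_sqr (sqiZ 2 sf)) (sqi_integrable_sqr (sqiZ 2 sg)).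
move=> /integrableP[_]; apply: le_lt_trans.
apply: (@le_integral_fin (fun x => (f x + g x) ^+ 2)
  (fun x => `|(2 * f x) ^+ 2 + (2 * g x) ^+ 2|)).
- exact: measurable_funX.
- apply: measurableT_comp => //; apply: measurable_funD; apply: measurable_funX;
    apply: measurable_funM => //; [by case: sf | by case: sg].
- move=> x _; rewrite sqr_ge0/= ger0_norm; first by nra.
  by rewrite addr_ge0 ?sqr_ge0.
Qed.

Lemma sqiN f : sqi f -> sqi (fun x => - f x).
Proof.
by move=> sf; under eq_fun do rewrite -mulN1r; exact: sqiZ.
Qed.

Lemma sqiB f g : sqi f -> sqi g -> sqi (fun x => f x - g x).
Proof. by move=> sf sg; apply: sqiD => //; exact: sqiN. Qed.

Lemma ripC f g : rip f g = rip g f.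
Proof. by congr fine; apply: eq_integral => x _; rewrite mulrC. Qed.

Lemma ripZDl a f g h : sqi f -> sqi g -> sqi h ->
  rip (fun x => a * f x + g x) h = a * rip f h + rip g h.
Proof.
move=> sf sg sh.
have e : (fun x => (a * f x + g x) * h x) =
         (fun x => a * (f x * h x) + g x * h x) by apply/funext => x; rewrite mulrDl mulrA.
rewrite /rip e RintegralD//; last 2 first.
- have := sqi_integrableM (sqiZ a sf) sh.
  by apply: eq_integrable => // x _ /=; rewrite mulrA.
- exact: sqi_integrableM.
by rewrite RintegralZl//; exact: sqi_integrableM.
Qed.

Lemma rip_ge0 f : 0 <= rip f f.
Proof. by apply: Rintegral_ge0 => x _; rewrite -expr2 sqr_ge0. Qed.

Lemma ripZD a b f g : sqi f -> sqi g ->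
  rip (fun x => a * f x + b * g x) (fun x => a * f x + b * g x) =
  a ^+ 2 * rip f f + 2 * a * b * rip f g + b ^+ 2 * rip g g.
Proof.
move=> sf sg; have s1 := sqiZ b sg; have s2 := sqiD (sqiZ a sf) s1.
rewrite ripZDl// (ripC f) ripZDl// (ripC _ (fun x => a * f x + b * g x)).
rewrite ripZDl//.
have e h : sqi h -> rip (fun x => b * g x) h = b * rip g h.
  move=> sh; have := ripZDl b sg sqi_cst0 sh.
  rewrite (_ : (fun x => b * g x + cst 0 x) = (fun x => b * g x)); last first.
    by apply/funext => x; rewrite /cst addr0.
  move=> ->; rewrite (_ : rip (cst 0) h = 0) ?addr0//.
  by rewrite /rip; under eq_Rintegral do rewrite mul0r; rewrite Rintegral_cst// mul0r.
by rewrite (ripC f (fun x => b * g x)) !e// (ripC g (fun x => b * g x)) !e// (ripC f g); ring.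
Qed.

Lemma rip_cs f g : sqi f -> sqi g -> rip f g ^+ 2 <= rip f f * rip g g.
Proof.
move=> sf sg; have P a b : 0 <= a ^+ 2 * rip f f + 2 * a * b * rip f g + b ^+ 2 * rip g g.
  by rewrite -ripZD//; exact: rip_ge0.
have := rip_ge0 g; rewrite le_eqVlt => /predU1P[g0|g0].
  rewrite -g0 mulr0; have [->|n0] := eqVneq (rip f g) 0; first by rewrite expr0n.
  (* When [rip g g] is 0, this coefficient brings the quadratic form down to -1. *)
  have := P 1 (- (rip f f + 1) / (2 * rip f g)).
  rewrite -g0 (_ : _ + _ = -1); last by field.
  by rewrite lerNr oppr0 ler10.
have := P (rip g g) (- rip f g).
rewrite (_ : _ + _ = rip g g * (rip f f * rip g g - rip f g ^+ 2)); last by ring.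
by rewrite pmulr_rge0// subr_ge0.
Qed.

Lemma ripD_le f g : sqi f -> sqi g ->
  rip (fun x => f x + g x) (fun x => f x + g x) <= 2 * rip f f + 2 * rip g g.
Proof.
move=> sf sg; have := ripZD 1 1 sf sg; have := ripZD 1 (-1) sf sg.
have := rip_ge0 (fun x => 1 * f x + -1 * g x).

rewrite (_ : (fun x => 1 * f x + 1 * g x) = (fun x => f x + g x)); last first.
  by apply/funext => x; ring.
by move=> h e1 ->; rewrite e1 in h; lra.
Qed.

Lemma le_rip f g : measurable_fun setT f ->
  (forall x, D x -> `|f x| <= `|g x|) -> sqi g -> rip f f <= rip g g.
Proof.
move=> mf fg sg; have sf := le_sqi mf fg sg.
apply: le_Rintegral => //; [exact: sqi_integrableM|exact: sqi_integrableM|].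
move=> x Dx; rewrite -!expr2 -[f x ^+ 2]real_normK ?num_real//.
by rewrite -[g x ^+ 2]real_normK ?num_real// lerXn2r ?nnegrE// fg.
Qed.

Lemma eq_rip_ae f f' g g' :
  measurable_fun setT f -> measurable_fun setT g ->
  measurable_fun setT f' -> measurable_fun setT g' ->
  {ae m, forall x, D x -> f x = f' x} -> {ae m, forall x, D x -> g x = g' x} ->
  rip f g = rip f' g'.
Proof.
move=> mf mg mf' mg' ff' gg'; congr fine; apply: ae_eq_integral => //.
- by apply/measurable_EFinP; apply: msub; exact: measurable_funM.
- by apply/measurable_EFinP; apply: msub; exact: measurable_funM.
- by move: ff' gg'; apply: filterS2 => x e1 e2 Dx; rewrite e1// e2.
Qed.

Lemma eq_sqi_ae f f' : measurable_fun setT f' ->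
  {ae m, forall x, D x -> f x = f' x} -> sqi f -> sqi f'.
Proof.
move=> mf' ff' [mf foo]; split=> //; apply: le_lt_trans foo.
rewrite le_eqVlt; apply/orP; left; apply/eqP; apply: ae_eq_integral => //.
- by apply/measurable_EFinP; apply: msub; exact: measurable_funX.
- by apply/measurable_EFinP; apply: msub; exact: measurable_funX.
- by move: ff'; apply: filterS => x e1 Dx; rewrite e1.
Qed.

Lemma integral_sqr_rip f : sqi f -> (\int[m]_(x in D) ((f x) ^+ 2)%:E)%E = (rip f f)%:E.
Proof.
move=> sf; have := integrable_fin_num mD (sqi_integrable_sqr sf).
by move=> /fineK <-.
Qed.

Lemma rip_eq0 f : sqi f -> rip f f = 0 -> {ae m, forall x, D x -> f x = 0}.
Proof.
move=> sf /eqP; rewrite -eqe -integral_sqr_rip// => /eqP f0.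
have [mf _] := sf.
have mf2 : measurable_fun D (fun x => (f x ^+ 2)%:E).
  by apply/measurable_EFinP; apply: msub; exact: measurable_funX.
have : (\int[m]_(x in D) `|(f x ^+ 2)%:E| = 0)%E.
  apply: etrans (f0 : _ = 0%E); apply: eq_integral => x _ /=; rewrite ger0_norm ?sqr_ge0//.
move=> /(ae_eq_integral_abs m mD mf2); apply: filterS => x /[apply] -[].
by move=> /eqP; rewrite sqrf_eq0 => /eqP.
Qed.

End SquareIntegrable.

(** * Borel induction and local almost-everywhere arguments *)

Section BorelLebesgue.
Variable R : realType.
Notation lam := (leb R).
Implicit Types (f g h : R -> R) (x y z : R).

(** The rays form a pi-system generating the Borel sets; the other hypotheses are the closure
    properties of a Dynkin system. *)
Lemma borel_ind (P : set R -> Prop) : P setT ->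
  (forall t, P `]t, +oo[%classic) ->
  (forall S, @measurable _ (measurableTypeR R) S -> P S -> P (~` S)) ->
  (forall F : (set R)^nat, (forall n, @measurable _ (measurableTypeR R) (F n)) ->
    trivIset setT F -> (forall n, P (F n)) -> P (\bigcup_k F k)) ->
  forall A : set (measurableTypeR R), measurable A -> P A.
Proof.
move=> PT Pr PC PU A mA.
apply: (@dynkin_induction _ (measurableTypeR R) (@RGenOInfty.G R) P) => //.
- exact: RGenOInfty.measurableE.
- move=> _ _ [x ->] [y ->]; exists (Num.max x y).
  apply/seteqP; split=> t /=; rewrite !in_itv/= !andbT gt_max; first by case=> -> ->.
  by move=> /andP.
- by move=> _ [x ->].
- exact: (eq_ind _ (fun Z : set (set R) => Z A) mA _ (RGenOInfty.measurableE R)).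
Qed.

(** Rational intervals reduce uncountably many local statements to countably many: [P n x] says that
    Q holds at x if the n-th rational interval contains x and Q holds a.e. on that interval. *)
Lemma ae_local (Q U : set R) :
  (forall x, U x -> exists c d, c < x < d /\ {ae lam, forall t, c < t < d -> Q t}) ->
  {ae lam, forall x, U x -> Q x}.
Proof.
move=> H; pose P n x := if @unpickle (rat * rat)%type n is Some qq then
   {ae lam, forall t, ratr qq.1 < t < ratr qq.2 -> Q t} ->
   ratr qq.1 < x < ratr qq.2 -> Q x else True.
have : {ae lam, forall x, forall n, P n x}.
  apply/ae_foralln => n; rewrite /P; case: unpickle => [[q q']|]/=; last exact: ae_all.
  have [HH|nHH] := pselect {ae lam, forall t, ratr q < t < ratr q' -> Q t}.
    by apply: ae_imp HH => x Hx _.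
  exact: ae_all.
apply: ae_imp => x Px /H[c [d [/andP[cx xd] Hcd]]].
have [q] := rat_in_itvoo cx; have [q'] := rat_in_itvoo xd.
rewrite !in_itv/= => /andP[xq' q'd] /andP[cq qx].
have := Px (pickle (q, q')); rewrite /P pickleK /=; apply; last by rewrite qx.
apply: ae_imp Hcd => t Ht /andP[qt tq']; apply: Ht.
by rewrite (lt_trans cq)//= (lt_trans tq').
Qed.

Lemma Rintegral_itv_split h x y z : x <= y -> y <= z ->
  lam.-integrable `[x, z] (EFin \o h) ->
  Rintegral lam `[x, z] h = Rintegral lam `[x, y] h + Rintegral lam `[y, z] h.
Proof.
move=> xy yz ih.
have e1 : Rintegral lam `[x, z] h - Rintegral lam `[x, y] h = Rintegral lam `]y, z] h.
  by apply: (@Rintegral_itvB R h (BLeft x) (BRight z) y ih); rewrite bnd_simp.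
have e2 : Rintegral lam `]y, z] h = Rintegral lam `[y, z] h.
  apply: (@Rintegral_itv_obnd_cbnd R y (BRight z) h).
  apply: integrableS ih => // t /=; rewrite !in_itv/=.
  by move=> /andP[/ltW/(le_trans xy) -> ->].
by rewrite -e2 -e1 addrC subrK.
Qed.

Lemma integrable_itvS h x y x' y' : x <= x' -> y' <= y ->
  lam.-integrable `[x, y] (EFin \o h) -> lam.-integrable `[x', y'] (EFin \o h).
Proof.
move=> xx yy; apply: integrableS => // t /=.
by rewrite !in_itv/= => /andP[/(le_trans xx) -> /le_trans ->].
Qed.

(** The vanishing integrals over [x, b] extend by [borel_ind] to all Borel subsets of [a, b], and an
    integrable function whose integrals over all Borel sets vanish is a.e. zero. *)
Lemma ae_eq0_itv h a b : measurable_fun setT h -> a <= b ->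
  lam.-integrable `[a, b] (EFin \o h) ->
  (forall x, a <= x <= b -> Rintegral lam `[x, b] h = 0) ->
  {ae lam, forall x, a <= x <= b -> h x = 0}.
Proof.
move=> mh ab ih H.
have mI : @measurable _ (measurableTypeR R) `[a, b]%classic by exact: measurable_itv.
have fin A : @measurable _ (measurableTypeR R) A ->
    (\int[lam]_(x in A `&` `[a, b]) (h x)%:E)%E \is a fin_num.
  move=> mA; apply: integrable_fin_num; first exact: measurableI.
  by apply: integrableS ih => //; exact: measurableI.
have H0 x : a <= x <= b -> (\int[lam]_(t in `[x, b]) (h t)%:E = 0)%E.
  move=> /andP[ax xb]; have := H x; rewrite ax xb => /(_ isT) => H0.
  have := fin `[x, b]%classic; rewrite (_ : `[x, b]%classic `&` `[a, b] = `[x, b]%classic).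
    by move=> /(_ (measurable_itv _))/fineK <-; congr EFin.
  apply/seteqP; split=> t /=; rewrite !in_itv/=; first by case.
  by move=> /andP[xt tb]; rewrite xt tb (le_trans ax).
have key A : @measurable _ (measurableTypeR R) A ->
    (\int[lam]_(x in A `&` `[a, b]) (h x)%:E = 0)%E.
  move: A; apply: borel_ind => /=.
  - by rewrite setTI H0// lexx ab.
  - move=> t; have [tb|bt] := ltP t b; last first.
      rewrite (_ : _ `&` _ = set0) ?integral_set0//; apply/seteqP; split=> // x /=.
      rewrite !in_itv/= andbT => -[tx /andP[_ xb]].
      by have := lt_le_trans tx xb; rewrite ltNge bt.
    have [ta|at'] := ltP t a.
      rewrite (_ : _ `&` _ = `[a, b]%classic) ?H0 ?lexx ?ab//.
      apply/seteqP; split=> x /=; rewrite !in_itv/= ?andbT; first by case.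
      by move=> /andP[ax xb]; rewrite ax xb (lt_le_trans ta ax).
    rewrite (_ : _ `&` _ = `]t, b]%classic); last first.
      apply/seteqP; split=> x /=; rewrite !in_itv/= ?andbT; first by case=> -> /andP[].
      by move=> /andP[tx ->]; rewrite tx (le_trans at' (ltW tx)).
    rewrite integral_itv_obnd_cbnd ?H0 ?at' ?(ltW tb)//.
    apply/measurable_EFinP; exact: measurable_funS mh.
  - move=> S mS S0.
    have dSC : [disjoint S `&` `[a, b] & ~` S `&` `[a, b]].
      by apply/disj_setPS => x [[Sx _] [/(_ Sx)]].
    have eU : (S `&` `[a, b]) `|` (~` S `&` `[a, b]) = `[a, b]%classic.
      by rewrite -setIUl setUv setTI.
    have := @integral_setU _ _ _ lam (S `&` `[a, b]) (~` S `&` `[a, b]) (EFin \o h).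
    rewrite eU => /(_ (measurableI _ _ mS mI) (measurableI _ _ (measurableC mS) mI)).
    move=> /(_ (measurable_int _ ih) dSC); rewrite S0 add0e => <-.
    by rewrite H0// lexx ab.
  - move=> F mF tF F0; rewrite setI_bigcupl integral_bigcup.
    + by rewrite eseries0.
    + exact: (@trivIset_setIr R nat setT F (fun=> `[a, b]%classic) tF).
    + by move=> k; exact: (measurableI _ _ (mF k) mI).
    + rewrite -setI_bigcupl; apply: integrableS ih => //.
      by apply: measurableI => //; exact: bigcup_measurable.
have K := @integral_ae_eq _ _ _ lam `[a, b]%classic mI (cst 0%E) (EFin \o h) ih.
have : ae_eq lam `[a, b]%classic (EFin \o h) (cst 0%E).
  apply: K; first exact: measurable_cst.
  move=> A AI mA; rewrite integral0.
  by have := key A mA; rewrite (_ : A `&` `[a, b]%classic = A)//; exact/setIidPl.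
apply: ae_imp => x Hx xab; suff : (h x)%:E = 0%E by case.
by apply: Hx; rewrite /= in_itv.
Qed.

End BorelLebesgue.

(** * Gaps of a closed set *)

Lemma closed_approx (R : realType) (C : set R) (c : R) : closed C ->
  (forall e, 0 < e -> exists a, C a /\ `|c - a| < e) -> C c.
Proof.
move=> cC H; apply: cC => B /nbhs_ballP[e /= e0 eB].
have [a [Ca ca]] := H e e0; exists a; split=> //; apply: eB.
by rewrite /ball /=.
Qed.

Lemma measurable_subsingleton (R : realType) (S : set (measurableTypeR R)) :
  (forall x y, S x -> S y -> x = y) -> measurable S.
Proof.
move=> H; have [[x Sx]|S0] := pselect (exists x, S x).
  by rewrite (_ : S = [set x])//; apply/seteqP; split=> [y Sy|_ -> //]; exact: H.
rewrite (_ : S = set0)//; apply/seteqP; split=> // y Sy.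
by apply: S0; exists y.
Qed.

Section GapGeometry.
Variables (R : realType) (E : set R).
Hypothesis EK : inK E.
Implicit Types (x y z c : R) (p q : R * R).

Lemma lend_le x : E x -> (lend E <= x%:E)%E.
Proof. by move=> Ex; apply: ereal_inf_lbound; exists x. Qed.

Lemma rend_ge x : E x -> (x%:E <= rend E)%E.
Proof. by move=> Ex; apply: ereal_sup_ubound; exists x. Qed.

Lemma lend_ltP x : (lend E < x%:E)%E <-> exists2 y, E y & y < x.
Proof.
split=> [H|[y Ey yx]]; last by rewrite (le_lt_trans (lend_le Ey))// lte_fin.
apply: contrapT => /forall2NP nH; move: H; rewrite ltNge => /negP; apply.
apply: le_ereal_inf_tmp => _ [y Ey <-]; rewrite lee_fin leNgt; apply/negP => yx.
by case: (nH y).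
Qed.

Lemma rend_gtP x : (x%:E < rend E)%E <-> exists2 y, E y & x < y.
Proof.
split=> [H|[y Ey yx]]; last by rewrite (lt_le_trans _ (rend_ge Ey))// lte_fin.
apply: contrapT => /forall2NP nH; move: H; rewrite ltNge => /negP; apply.
apply: ge_ereal_sup => _ [y Ey <-]; rewrite lee_fin leNgt; apply/negP => yx.
by case: (nH y).
Qed.

Lemma openIP x : openI E x <-> exists y z, [/\ E y, E z, y < x & x < z].
Proof.
split=> [[/lend_ltP[y Ey yx] /rend_gtP[z Ez xz]]|[y [z [Ey Ez yx xz]]]].
  by exists y, z.
by split; [apply/lend_ltP; exists y|apply/rend_gtP; exists z].
Qed.

Lemma Iset_convex x y z : Iset E x -> Iset E y -> x <= z -> z <= y -> Iset E z.
Proof.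
have L t : Iset E t -> exists2 a, E a & a <= t.
  by case=> [/openIP[a [b [Ea _ /ltW aa _]]]|Et]; [exists a|exists t].
have U t : Iset E t -> exists2 a, E a & t <= a.
  by case=> [/openIP[a [b [_ Eb _ /ltW tb]]]|Et]; [exists b|exists t].
move=> /L[a Ea ax] /U[b Eb yb] xz zy.
have /predU1P[->|az] : (z == a) || (a < z) by rewrite eq_sym -le_eqVlt (le_trans ax).
  by right.
have /predU1P[->|zb] : (z == b) || (z < b) by rewrite -le_eqVlt (le_trans zy).
  by right.
by left; apply/openIP; exists a, b.
Qed.

Lemma E_Iset x : E x -> Iset E x. Proof. by right. Qed.

Lemma exists_lt : exists x y, [/\ E x, E y & x < y].
Proof.
have [x Ex] : exists x, E x.
  apply: contrapT => nE; have [+ _] := EK; rewrite /lend /rend.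
  rewrite (_ : [set x%:E | x in E] = set0) ?ereal_inf0 ?ereal_sup0//.
  by apply/seteqP; split=> // t [x Ex _]; exfalso; apply: nE; exists x.
have [H _] := EK; have [xr|rx] := ltP x%:E (rend E).
  by have /rend_gtP[y Ey xy] := xr; exists x, y.
have /lend_ltP[y Ey yx] := lt_le_trans H rx.
by exists y, x.
Qed.

Lemma E_closed_mid y z c : E y -> E z -> y <= c -> c <= z ->
  (forall e, 0 < e -> exists a, E a /\ `|c - a| < e) -> E c.
Proof.
move=> Ey Ez yc cz H; have [_ /closed_approx] := EK; move=> /(_ c) [|[//|]|].
- by move=> e /H[a [Ea ?]]; exists a; split=> //; do 2 left.
- move=> /= cl; suff -> : c = y by [].
  by apply/eqP; rewrite eq_le yc andbT -lee_fin cl lend_le.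
- move=> /= cr; suff -> : c = z by [].
  by apply/eqP; rewrite eq_le cz/= -lee_fin cr rend_ge.
Qed.

Lemma gap_exists x : openI E x -> ~ E x -> exists p, gaps E p /\ p.1 < x < p.2.
Proof.
move=> /openIP[y [z [Ey Ez yx xz]]] nEx.
pose A := [set t | E t /\ t < x]; pose B := [set t | E t /\ x < t].
have hA : has_sup A by split; [exists y|exists x => t [_ /ltW]].
have hB : has_inf B by split; [exists z|exists x => t [_ /ltW]].
have yA : y <= sup A by apply: ub_le_sup => //; exact: hA.2.
have Az : sup A <= x by apply: ge_sup; [exact: hA.1|move=> t [_ /ltW]].
have zB : inf B <= z by apply: ge_inf => //; exact: hB.2.
have Bx : x <= inf B by apply: lb_le_inf; [exact: hB.1|move=> t [_ /ltW]].
have EA : E (sup A).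
  apply: (E_closed_mid Ey Ez) => //; first by rewrite (le_trans Az) ?ltW.
  move=> e e0; have [t [Et tx] st] := sup_adherent e0 hA.
  exists t; split=> //; rewrite ger0_norm; first by rewrite ltrBlDr addrC -ltrBlDr.
  by rewrite subr_ge0; apply: ub_le_sup => //; exact: hA.2.
have EB : E (inf B).
  apply: (E_closed_mid Ey Ez) => //; first by rewrite (le_trans _ Bx) ?ltW.
  move=> e e0; have [t [Et tx] st] := inf_adherent e0 hB.
  exists t; split=> //; rewrite distrC ger0_norm; first by rewrite ltrBlDr addrC.
  by rewrite subr_ge0; apply: ge_inf => //; exact: hB.2.
have Ax : sup A < x by rewrite lt_neqAle Az andbT; apply/eqP => e; apply: nEx; rewrite -e.
have xB : x < inf B by rewrite lt_neqAle Bx andbT; apply/eqP => e; apply: nEx; rewrite e.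
exists (sup A, inf B); rewrite /= Ax xB; split=> //; split; first exact: lt_trans xB.
do 2!split=> //; move=> t /= /andP[At tB] Et; have [tx|xt|tx] := ltgtP t x.
- by have : t <= sup A by [apply: ub_le_sup => //; exact: hA.2]; rewrite leNgt At.
- by have : inf B <= t by [apply: ge_inf => //; exact: hB.2]; rewrite leNgt tB.
- by apply: nEx; rewrite -tx.
Qed.

Lemma gap_openI p x : gaps E p -> p.1 < x < p.2 -> openI E x /\ ~ E x.
Proof.
move=> [_ [E1 [E2 nE]]] /andP[px xp]; split; last by apply: nE; rewrite px.
by apply/openIP; exists p.1, p.2.
Qed.

Lemma gap_notin p y : gaps E p -> E y -> y <= p.1 \/ p.2 <= y.
Proof.
move=> [_ [_ [_ nE]]] Ey; have [|py] := leP y p.1; first by left.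
by right; rewrite leNgt; apply/negP => yp; apply: (nE y) => //; rewrite py.
Qed.

Lemma gap_uniq p q x : gaps E p -> gaps E q -> p.1 < x < p.2 -> q.1 < x < q.2 ->
  p = q.
Proof.
move=> gp gq /andP[px xp] /andP[qx xq].
have [_ [p1 [p2 _]]] := gp; have [_ [q1 [q2 _]]] := gq.
have [a|a] := gap_notin gp q1; last by have := lt_trans qx xp; rewrite ltNge a.
have [b|b] := gap_notin gp q2; first by have := lt_trans px xq; rewrite ltNge b.
have [c|c] := gap_notin gq p1; last by have := lt_trans px xq; rewrite ltNge c.
have [d|d] := gap_notin gq p2; first by have := lt_trans qx xp; rewrite ltNge d.
by apply: injective_projections; apply/eqP; rewrite eq_le ?a ?b ?c ?d.
Qed.

(** With the default (0, 0) every difference quotient formed from the pair is 0, so slopes vanish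
    off the gaps without a case distinction. *)
Definition gapof x : R * R := xget (0, 0) [set p | gaps E p /\ p.1 < x < p.2].

Lemma gapof_eq p x : gaps E p -> p.1 < x < p.2 -> gapof x = p.
Proof.
move=> gp xp; apply: xget_unique; first by split.
by move=> q [gq xq]; exact: (gap_uniq gq gp xq xp).
Qed.

Lemma gapofP x : openI E x -> ~ E x ->
  gaps E (gapof x) /\ (gapof x).1 < x < (gapof x).2.
Proof.
by move=> Ix nEx; have [p [gp xp]] := gap_exists Ix nEx; rewrite (gapof_eq gp xp).
Qed.

Lemma gapof_out x : ~ (openI E x /\ ~ E x) -> gapof x = (0, 0).
Proof.
move=> H; rewrite /gapof xgetPN// => p [gp xp]; apply: H.
exact: gap_openI gp xp.
Qed.

Lemma gapof_E x : E x -> gapof x = (0, 0).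
Proof. by move=> Ex; apply: gapof_out => -[]. Qed.

Lemma measurable_E : @measurable _ (measurableTypeR R) E.
Proof.
have [_ cC] := EK.
set C := _ `|` _ in cC.
rewrite (_ : E = C `\` (([set x | x%:E = lend E] `&` ~` E) `|`
   ([set x | x%:E = rend E] `&` ~` E))).
  apply: measurableD; first exact: closed_measurable.
  by apply: measurableU; apply: measurable_subsingleton => x y [/= ex _] [/= ey _];
    apply: EFin_inj; rewrite ex ey.
apply/seteqP; split=> x.
  by move=> Ex; split; [do 2 left|case=> -[_ ]].
move=> [[[//|l]|r] n]; apply: contrapT => nE; apply: n; [left|right]; split=> //.
Qed.

Lemma open_openI : open (openI E).
Proof.
rewrite openE => x /openIP[y [z [Ey Ez yx xz]]].
have := near_in_itvoo (_ : x \in `]y, z[); rewrite in_itv/= yx xz => /(_ isT).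
apply: filterS => t; rewrite in_itv/= => /andP[yt tz].
by apply/openIP; exists y, z.
Qed.

Lemma measurable_openI : @measurable _ (measurableTypeR R) (openI E).
Proof. by apply: open_measurable; exact: open_openI. Qed.

Lemma measurable_gapset : @measurable _ (measurableTypeR R) (openI E `\` E).
Proof. by apply: measurableD; [exact: measurable_openI|exact: measurable_E]. Qed.

(** [gapof] is constant on each gap and has its default value elsewhere. Hence a preimage avoiding
    [F (0, 0)] is open, and any other one is the complement of such a preimage. *)
Lemma measurable_gapof (F : R * R -> R) :
  measurable_fun setT (fun x : measurableTypeR R => F (gapof x)).
Proof.
have H (Y : set R) : ~ Y (F (0, 0)) ->
    @measurable _ (measurableTypeR R) [set x | Y (F (gapof x))].
  move=> nY; apply: open_measurable; rewrite openE => x /= Yx.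
  have [Ix nE] : openI E x /\ ~ E x.
    by apply: contrapT => n; apply: nY; rewrite (gapof_out n) in Yx.
  have [gp xp] := gapofP Ix nE; have := @near_in_itvoo _ (gapof x).1 (gapof x).2 x.
  rewrite in_itv/= => /(_ xp); apply: filterS => t.
  by rewrite in_itv/= => tp; rewrite (gapof_eq gp tp).
move=> _ Y mY; rewrite setTI; have [Y0|nY0] := pselect (Y (F (0, 0))); last exact: H.
rewrite -[X in measurable X]setCK; apply: measurableC.
exact: (H (~` Y)).
Qed.

(** Every gap contains a rational, so [F n] can be the gap around the n-th rational. Two of these
    sets are equal or disjoint, hence removing earlier ones by [seqDU] leaves a whole gap or
    nothing. *)
Lemma gap_enum : exists D : nat -> set R,
  [/\ trivIset setT D, \bigcup_n D n = openI E `\` E &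
      forall n, D n = set0 \/ exists2 p, gaps E p & D n = `]p.1, p.2[%classic].
Proof.
pose F n := if @unpickle rat n is Some q then
  [set x | gaps E (gapof (ratr q)) /\ (gapof (ratr q)).1 < x < (gapof (ratr q)).2]
  else set0.
have FE n x y : F n x -> gapof x = gapof y -> openI E y /\ ~ E y -> F n y.
  rewrite /F; case: unpickle => // q [gq xq]; rewrite (gapof_eq gq xq) => e [Iy nEy].
  by have := gapofP Iy nEy; rewrite -e.
have FI n x : F n x -> openI E x /\ ~ E x.
  by rewrite /F; case: unpickle => // q [gq xq]; exact: gap_openI gq xq.
have FS n x y : F n x -> F n y -> gapof x = gapof y.
  rewrite /F; case: unpickle => // q [gq xq] [_ yq].
  by rewrite (gapof_eq gq xq) (gapof_eq gq yq).
exists (seqDU F); split.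
- exact: trivIset_seqDU.
- rewrite -seqDU_bigcup_eq; apply/seteqP; split=> x; first by move=> [n _ /FI].
  move=> [Ix nE]; have [gp xp] := gapofP Ix nE.
  have [q] := rat_in_itvoo (gp.1 : (gapof x).1 < (gapof x).2); rewrite in_itv/= => qp.
  have Fq : F (pickle q) x by rewrite /F pickleK (gapof_eq gp qp).
  exact: (ex_intro2 _ _ (pickle q) I Fq).
- move=> n; have [[x Dx]|n0] := pselect (exists x, seqDU F n x); last first.
    by left; apply/seteqP; split=> // x Dx; case: n0; exists x.
  right; have [Fx nx] := Dx; have [Ix nE] := FI _ _ Fx; have [gp xp] := gapofP Ix nE.
  exists (gapof x) => //; apply/seteqP; split=> y.
    move=> [Fy _]; have [Iy nEy] := FI _ _ Fy.
    by have [_] := gapofP Iy nEy; rewrite -(FS n x y)//= in_itv.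
  rewrite /= in_itv/= => yp; have eg := gapof_eq gp yp.
  have Iy := gap_openI gp yp; split; first exact: FE Fx _ Iy.
  move=> nFy; apply: nx; move: nFy.
  rewrite -!bigcup_mkord => -[k kn Fk]; exists k => //.
  exact: FE Fk _ (conj Ix nE).
Qed.

End GapGeometry.

(** * Sums over gaps as Lebesgue integrals *)

Section GapSums.
Variables (R : realType) (E : set R).
Hypothesis EK : inK E.
Notation lam := (leb R).
Notation gapset := (openI E `\` E).
Implicit Types (f g h u v : R -> R) (x y z : R) (p : R * R) (phi : R * R -> R).

Definition slope u x :=
  (u (gapof E x).2 - u (gapof E x).1) / ((gapof E x).2 - (gapof E x).1).

Lemma measurable_slope u : measurable_fun setT (slope u).
Proof.
exact: (measurable_gapof EK (fun p => (u p.2 - u p.1) / (p.2 - p.1))).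
Qed.

Lemma slope_gap u p x : gaps E p -> p.1 < x < p.2 ->
  slope u x = (u p.2 - u p.1) / (p.2 - p.1).
Proof. by move=> gp xp; rewrite /slope (gapof_eq gp xp). Qed.

Lemma slope_E u x : E x -> slope u x = 0.
Proof. by move=> Ex; rewrite /slope (gapof_E Ex)/= subrr mul0r. Qed.

Lemma gap_measure p (a : R) : gaps E p ->
  (\int[lam]_(x in `]p.1, p.2[) a%:E = (a * (p.2 - p.1))%:E)%E.
Proof.
move=> [p12 _]; rewrite integral_cst//= [X in (_ * X)%E]lebesgue_measure_itv/=.
by rewrite lte_fin p12 -EFinB -EFinM.
Qed.

Let mitv a b : @measurable _ (measurableTypeR R) `]a, b[%classic.
Proof. exact: measurable_itv. Qed.

Let mitvc a b : @measurable _ (measurableTypeR R) `[a, b]%classic.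
Proof. exact: measurable_itv. Qed.

Lemma ge0_integral_gapset (f : R -> R) : measurable_fun setT f -> (forall x, 0 <= f x) ->
  forall D : nat -> set R, trivIset setT D -> \bigcup_n D n = gapset ->
  (forall n, D n = set0 \/ exists2 p, gaps E p & D n = `]p.1, p.2[%classic) ->
  (\int[lam]_(x in gapset) (f x)%:E = \sum_(n <oo) \int[lam]_(x in D n) (f x)%:E)%E.
Proof.
move=> mf f0 D tD UD HD; rewrite -UD ge0_integral_bigcup//.
- by move=> n; case: (HD n) => [->|[p _ ->]]; [exact: measurable0|exact: mitv].
- by apply/measurable_EFinP; apply: measurable_funS mf.
- by move=> x _; rewrite lee_fin.
Qed.

Lemma le_integral_gapset f g : measurable_fun setT f -> measurable_fun setT g ->
  (forall x, 0 <= f x) -> (forall x, 0 <= g x) ->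
  (forall p, gaps E p ->
    (\int[lam]_(x in `]p.1, p.2[) (f x)%:E <= \int[lam]_(x in `]p.1, p.2[) (g x)%:E)%E) ->
  (\int[lam]_(x in gapset) (f x)%:E <= \int[lam]_(x in gapset) (g x)%:E)%E.
Proof.
move=> mf mg f0 g0 H; have [D [tD UD HD]] := gap_enum EK.
rewrite (ge0_integral_gapset mf f0 tD UD HD) (ge0_integral_gapset mg g0 tD UD HD).
apply: lee_nneseries => [n _ _|n _].
  by apply: integral_ge0 => x _; rewrite lee_fin.
by case: (HD n) => [->|[p gp ->]]; [rewrite !integral_set0|exact: H].
Qed.

(** The nonempty members of the enumeration correspond bijectively to the gaps, and the integrand is
    constant on each gap, whose measure is p.2 - p.1. *)
Lemma esum_gaps phi : (forall p, 0 <= phi p) ->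
  (\esum_(p in gaps E) (phi p * (p.2 - p.1))%:E =
   \int[lam]_(x in gapset) (phi (gapof E x))%:E)%E.
Proof.
move=> phi0; have [D [tD UD HD]] := gap_enum EK.
have mphi := measurable_gapof EK phi.
rewrite (ge0_integral_gapset mphi (fun x => phi0 _) tD UD HD).
rewrite nneseries_esumT; last first.
  by move=> n; apply: integral_ge0 => x _; rewrite lee_fin.
pose e n := gapof E (xget 0 (D n)).
have De n : D n <> set0 -> gaps E (e n) /\ D n = `](e n).1, (e n).2[%classic.
  case: (HD n) => // -[p gp Dp] _; suff -> : e n = p by [].
  apply: gapof_eq => //; have := @xgetPex _ (0 : R) (D n).
  rewrite Dp /= !in_itv/=; apply; exists ((p.1 + p.2) / 2).
  by rewrite /= in_itv/= !(midf_lt gp.1).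
rewrite (esumID [set n | D n <> set0]) ?setTI; last first.
  by move=> n _; apply: integral_ge0 => x _; rewrite lee_fin.
rewrite [X in (_ = _ + X)%E]esum1 ?adde0; last first.
  by move=> n /= /contrapT ->; rewrite integral_set0.
rewrite (@reindex_esum R _ _ [set n | D n <> set0] (gaps E) e).
  apply: eq_esum => n /= /De[gp ->]; rewrite -(gap_measure (phi (e n)) gp).
  by apply: eq_integral => x; rewrite inE/= in_itv/= => xp; rewrite (gapof_eq gp xp).
split.
- by move=> n /= /De[].
- move=> n m /[!inE] /= Dn Dm enm; have [gn en] := De _ Dn; have [gm em] := De _ Dm.
  have [x Dx] : exists x, D n x.
    by apply: contrapT => nx; apply: Dn; apply/seteqP; split=> // x Dx; apply: nx; exists x.
  by apply: (tD n m I I); exists x; split=> //; rewrite em -enm -en.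
- move=> p gp; have := UD; move/seteqP => [_ /(_ ((p.1 + p.2) / 2))].
  have xp : p.1 < (p.1 + p.2) / 2 < p.2 by rewrite !(midf_lt gp.1).
  move=> /(_ (gap_openI gp xp))[n _ Dn]; exists n => /=.
    by move=> D0; rewrite D0 in Dn.
  have D0 : D n <> set0 by move=> D0; rewrite D0 in Dn.
  have [ge De'] := De _ D0; rewrite De' /= in_itv/= in Dn.
  by rewrite (gap_uniq ge gp Dn xp).
Qed.

(** [gsum] splits into positive and negative parts exactly as the integral does, and the positive
    factor p.2 - p.1 comes out of both parts. *)
Lemma gsum_gaps phi :
  lam.-integrable gapset (fun x => (phi (gapof E x))%:E) ->
  gsum (gaps E) (fun p => phi p * (p.2 - p.1)) =
  Rintegral lam gapset (fun x => phi (gapof E x)).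
Proof.
move=> ip; have mG := measurable_gapset EK.
rewrite /gsum /Rintegral integralE fineB; last 2 first.
- exact: integrable_pos_fin_num ip.
- exact: integrable_neg_fin_num ip.
congr (fine _ - fine _).
  rewrite (eq_esum (_ : forall p, gaps E p -> _ = (Num.max (phi p) 0 * (p.2 - p.1))%:E)).
    rewrite (esum_gaps (phi := fun p => Num.max (phi p) 0)).
      by apply: eq_integral => x _; rewrite funeposE /= EFin_max.
    by move=> p; rewrite le_max lexx orbT.
  move=> p [p12 _]; congr EFin; rewrite maxr_pMl ?mul0r//.
  by rewrite subr_ge0 ltW.
rewrite (eq_esum (_ : forall p, gaps E p -> _ = (Num.max (- phi p) 0 * (p.2 - p.1))%:E)).
  rewrite (esum_gaps (phi := fun p => Num.max (- phi p) 0)).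
    by apply: eq_integral => x _; rewrite funenegE /= EFin_max EFinN.
  by move=> p; rewrite le_max lexx orbT.
move=> p [p12 _]; congr EFin; rewrite maxr_pMl ?mul0r ?mulNr//.
by rewrite subr_ge0 ltW.
Qed.

Lemma integral_gaps_itv h x y : E x -> E y ->
  lam.-integrable (`[x, y] `\` E) (EFin \o h) ->
  forall D : nat -> set R, trivIset setT D -> \bigcup_n D n = gapset ->
  (forall n, D n = set0 \/ exists2 p, gaps E p & D n = `]p.1, p.2[%classic) ->
  (\int[lam]_(t in `[x, y] `\` E) (h t)%:E =
   \sum_(n <oo) \int[lam]_(t in `[x, y] `&` D n) (h t)%:E)%E.
Proof.
move=> Ex Ey ih D tD UD HD.
have eD : `[x, y] `\` E = \bigcup_n (`[x, y] `&` D n).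
  rewrite -setI_bigcupr UD; apply/seteqP; split=> t /=; last by case=> ? [].
  rewrite in_itv/= => -[/andP[xt ty] nE]; split; first by rewrite xt.
  split=> //; apply/(openIP E); exists x, y; split=> //.
    by rewrite lt_neqAle xt andbT; apply/eqP => e; apply: nE; rewrite -e.
  by rewrite lt_neqAle ty andbT; apply/eqP => e; apply: nE; rewrite e.
rewrite eD integral_bigcup//.
- exact: (@trivIset_setIl R nat setT D (fun=> `[x, y]%classic) tD).
- move=> n; apply: measurableI; first exact: measurable_itv.
  by case: (HD n) => [->|[p _ ->]]; [exact: measurable0|exact: mitv].
- by rewrite -eD.
Qed.

Lemma gap_sub_itv x y p t : E x -> E y -> gaps E p -> x <= t <= y -> p.1 < t < p.2 ->
  x <= p.1 /\ p.2 <= y.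
Proof.
move=> Ex Ey gp /andP[xt ty] /andP[pt tp]; split.
  by case: (gap_notin gp Ex) => // px; have := le_lt_trans xt tp; rewrite ltNge px.
by case: (gap_notin gp Ey) => // yp; have := lt_le_trans pt ty; rewrite ltNge yp.
Qed.

(** A gap meeting [x, y] is contained in it because x and y belong to E, so the integral off E is a
    sum over whole gaps. *)
Lemma Rintegral_gaps_eq h k x y : E x -> E y ->
  lam.-integrable `[x, y] (EFin \o h) -> lam.-integrable `[x, y] (EFin \o k) ->
  (forall p, gaps E p -> x <= p.1 -> p.2 <= y ->
     Rintegral lam `]p.1, p.2[ h = Rintegral lam `]p.1, p.2[ k) ->
  Rintegral lam (`[x, y] `\` E) h = Rintegral lam (`[x, y] `\` E) k.
Proof.
move=> Ex Ey ih ik H; have [D [tD UD HD]] := gap_enum EK.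
have S f : lam.-integrable `[x, y] (EFin \o f) ->
    lam.-integrable (`[x, y] `\` E) (EFin \o f).
  apply: integrableS => //.
  by apply: measurableD; [exact: mitvc|exact: (measurable_E EK)].
congr fine; rewrite (integral_gaps_itv Ex Ey (S _ ih) tD UD HD).
rewrite (integral_gaps_itv Ex Ey (S _ ik) tD UD HD).
apply: eq_eseriesr => n _; case: (HD n) => [->|[p gp ->]].
  by rewrite setI0 !integral_set0.
have [[xp py]|nxy] := pselect (x <= p.1 /\ p.2 <= y); last first.
  rewrite (_ : _ `&` _ = set0) ?integral_set0//; apply/seteqP; split=> // t /=.
  by rewrite !in_itv/= => -[txy tp]; apply: nxy; exact: (gap_sub_itv Ex Ey gp txy tp).
have sub : `]p.1, p.2[ `<=` `[x, y].
  move=> t /=; rewrite !in_itv/= => /andP[pt tp].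
  by rewrite (le_trans xp (ltW pt)) (le_trans (ltW tp) py).
rewrite (_ : _ `&` _ = `]p.1, p.2[%classic); last exact/setIidPr.
have fin f : lam.-integrable `[x, y] (EFin \o f) ->
    (\int[lam]_(t in `]p.1, p.2[) (f t)%:E)%E \is a fin_num.
  move=> jf; apply: integrable_fin_num => //.
  by apply: integrableS jf.
by rewrite -(fineK (fin _ ih)) -(fineK (fin _ ik)); congr EFin; exact: H.
Qed.

End GapSums.

(** * The form domain *)

Section Intervals.
Variable R : realType.
Notation lam := (leb R).
Implicit Types (h : R -> R) (x y : R).

Lemma mitvcc x y : @measurable _ (measurableTypeR R) `[x, y]%classic.
Proof. exact: measurable_itv. Qed.

Lemma leb_itvcc x y : x <= y -> lam `[x, y]%classic = (y - x)%:E.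
Proof.
move=> xy; rewrite [LHS]lebesgue_measure_itv/= lte_fin.
by have := xy; rewrite le_eqVlt => /predU1P[->|->]; rewrite ?ltxx ?subrr// EFinB.
Qed.

Lemma sqi_cst_itv x y (c : R) : sqi lam `[x, y] (cst c).
Proof.
split; first exact: measurable_cst.
rewrite /cst integral_cst; last exact: mitvcc.
have [xy|yx] := leP x y; first by rewrite leb_itvcc// -EFinM ltry.
by rewrite set_itv_ge ?measure0 ?mule0 ?ltry// bnd_simp -ltNge.
Qed.

Lemma sqi_integrable_itv h x y : sqi lam `[x, y] h -> lam.-integrable `[x, y] (EFin \o h).
Proof.
move=> sh; have := sqi_integrableM (mitvcc x y) sh (sqi_cst_itv x y 1).
by apply: eq_integrable; [exact: mitvcc|move=> t _ /=; rewrite mulr1].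
Qed.

Lemma sqi_itv_cs h x y : x <= y -> sqi lam `[x, y] h ->
  Rintegral lam `[x, y] h ^+ 2 <= (y - x) * rip lam `[x, y] h h.
Proof.
move=> xy sh; have := rip_cs (mitvcc x y) sh (sqi_cst_itv x y 1).
rewrite [X in _ <= _ * X](_ : _ = y - x).
  rewrite mulrC; apply: le_trans; rewrite /rip.
  by under [in leRHS]eq_Rintegral do rewrite mulr1.
rewrite /rip; under eq_Rintegral do rewrite /cst mulr1.
rewrite Rintegral_cst; last exact: mitvcc.
by rewrite mul1r leb_itvcc.
Qed.

End Intervals.

Section ContinuousOn.
Variables (R : realType) (E : set R).
Implicit Types f g : R -> R.

Definition cont_on f := forall x, E x -> forall e : R, 0 < e ->
  exists2 d : R, 0 < d & forall y, E y -> `|x - y| < d -> `|f x - f y| < e.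

Lemma cont_onP f : {within E, continuous f} <-> cont_on f.
Proof.
split=> [/subspace_continuousP cf x Ex e e0|cf].
  have /cvgr_dist_lt/(_ e e0) := cf x Ex.
  rewrite near_withinE => /nbhs_ballP[d /= d0 H]; exists d => // y Ey xy.
  by apply: H => //; rewrite /ball /=.
apply/subspace_continuousP => x Ex; apply/cvgrPdist_lt => e e0.
have [d d0 H] := cf x Ex e e0; rewrite near_withinE.
by apply/nbhs_ballP; exists d => // y xy Ey; apply: H.
Qed.

Variable mu : {measure set (measurableTypeR R) -> \bar R}.
Hypothesis EK : inK E.
Hypothesis muE : radon_full E mu.

(** If f and g differed at x they would differ on E near x, and full support gives every
    neighbourhood of x positive mass carried by E. *)
Lemma aeeq_eq_on f g : cont_on f -> cont_on g -> aeeq mu f g ->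
  forall x, E x -> f x = g x.
Proof.
move=> cf cg fgN x Ex; apply/eqP; apply: contrapT => /negP fg.
pose e := `|f x - g x| / 2; have e0 : 0 < e by rewrite divr_gt0// normr_gt0 subr_eq0.
have [d1 d10 H1] := cf x Ex e e0; have [d2 d20 H2] := cg x Ex e e0.
pose U := ball x (Num.min d1 d2); have [mE [_ pos]] := muE.
have mU : @measurable _ (measurableTypeR R) U by apply: open_measurable; exact: ball_open.
have : (0 < mu U)%E.
  apply: pos; first exact: ball_open.
  by exists x; split=> //; apply: ballxx; rewrite lt_min d10.
suff -> : mu U = 0%E by rewrite ltxx.
apply: ae_measure0 => //.
have nE := measure0_notin (measurableC (measurable_E EK)) mE.
apply: ae_imp2 fgN nE => y fgy nEy; rewrite /U /ball /= lt_min => /andP[y1 y2].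
have Ey : E y by exact: contrapT.
have := H1 y Ey y1; have := H2 y Ey y2.
rewrite fgy => a b; have : `|f x - g x| < e + e.
  rewrite (_ : f x - g x = (f x - g y) - (g x - g y)); last by ring.
  by rewrite (le_lt_trans (ler_normB _ _))// ltrD.
by rewrite /e -splitr ltxx.
Qed.

End ContinuousOn.

Section Admissible.
Variables (R : realType) (E : set R)
  (mu : {measure set (measurableTypeR R) -> \bar R}).
Hypothesis EK : inK E.
Hypothesis muE : radon_full E mu.
Notation lam := (leb R).
Notation OI := (openI E).
Implicit Types (f g h u v : R -> R) (x y z : R) (p : R * R).

Let mOI := measurable_openI E.

Lemma measurable_indic_E : measurable_fun setT (\1_E : R -> R).
Proof. exact: (@measurable_indic _ (measurableTypeR R) R setT E (measurable_E EK)). Qed.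

Lemma Iset_itv_sub x y : Iset E x -> Iset E y -> `]x, y[ `<=` OI.
Proof.
move=> Ix Iy t /=; rewrite in_itv/= => /andP[xt ty]; apply/(openIP E).
have [a Ea ax] : exists2 a, E a & a <= x.
  by case: Ix => [/(openIP E)[a [b [Ea _ /ltW aa _]]]|Et]; [exists a|exists x].
have [b Eb yb] : exists2 a, E a & y <= a.
  by case: Iy => [/(openIP E)[a' [b [_ Eb _ /ltW aa]]]|Et]; [exists b|exists y].
by exists a, b; split=> //; [exact: le_lt_trans xt|exact: lt_le_trans yb].
Qed.

Lemma integral_sqr_itv_le h x y : Iset E x -> Iset E y -> measurable_fun setT h ->
  (\int[lam]_(t in `[x, y]) (h t ^+ 2)%:E <= \int[lam]_(t in OI) (h t ^+ 2)%:E)%E.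
Proof.
move=> Ix Iy mh; have m2 : measurable_fun setT (fun t => (h t ^+ 2)%:E).
  by apply/measurable_EFinP; exact: measurable_funX.
rewrite [leLHS](@integral_itv_bndoo R x y _ true false); last exact: measurable_funS m2.
apply: ge0_subset_integral => //.
- exact: measurable_funS m2.
- by move=> t _; rewrite lee_fin sqr_ge0.
- exact: Iset_itv_sub.
Qed.

Lemma sqi_OI_itv h x y : Iset E x -> Iset E y -> sqi lam OI h -> sqi lam `[x, y] h.
Proof.
by move=> Ix Iy [mh hoo]; split=> //; exact: le_lt_trans (integral_sqr_itv_le Ix Iy mh) hoo.
Qed.

Lemma rip_itv_le h x y : Iset E x -> Iset E y -> sqi lam OI h ->
  rip lam `[x, y] h h <= rip lam OI h h.
Proof.
move=> Ix Iy sh; rewrite -lee_fin -!integral_sqr_rip//; last exact: sqi_OI_itv.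
by apply: integral_sqr_itv_le => //; case: sh.
Qed.

Lemma holder_OI h x y : Iset E x -> Iset E y -> x <= y -> sqi lam OI h ->
  Rintegral lam `[x, y] h ^+ 2 <= (y - x) * rip lam OI h h.
Proof.
move=> Ix Iy xy sh; apply: le_trans (sqi_itv_cs xy (sqi_OI_itv Ix Iy sh)) _.
by rewrite ler_wpM2l ?subr_ge0// rip_itv_le.
Qed.

Lemma adm_sqi g h : adm E g h -> sqi lam OI h.
Proof. by case=> -[mh _] [hoo _]. Qed.

Lemma adm_itv g h x y : adm E g h -> Iset E x -> Iset E y -> x <= y ->
  g y - g x = Rintegral lam `[x, y] h.
Proof. by case=> -[_ H] _ Ix Iy xy; have [] := H x y Ix Iy xy. Qed.

Lemma adm_gap_le g h p : adm E g h -> gaps E p ->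
  ((g p.2 - g p.1) ^+ 2 / (p.2 - p.1) <= rip lam `[p.1, p.2] h h).
Proof.
move=> a [p12 [E1 [E2 _]]]; have [I1 I2] := (E_Iset E1, E_Iset E2).
rewrite ler_pdivrMr ?subr_gt0// (adm_itv a I1 I2 (ltW p12)) mulrC.
by apply: sqi_itv_cs; [exact: ltW|apply: sqi_OI_itv => //; exact: adm_sqi a].
Qed.

(** By Cauchy-Schwarz the constant slope has the least energy on a gap among all densities with the
    same increment, and on E the slope is 0. *)
Lemma sqi_slope g h : adm E g h -> sqi lam OI (slope E g).
Proof.
move=> a; have [mh hoo] := adm_sqi a; have ms := measurable_slope EK g.
split=> //; apply: le_lt_trans hoo.
have := @le_integral_gapset R E EK (fun x => slope E g x ^+ 2) (fun x => h x ^+ 2).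
move=> /(_ (measurable_funX 2 ms) (measurable_funX 2 mh)).
move=> /(_ (fun=> sqr_ge0 _) (fun=> sqr_ge0 _)) H.
have m2 (k : R -> R) : measurable_fun setT k -> measurable_fun OI (fun x => (k x ^+ 2)%:E).
  by move=> mk; apply/measurable_EFinP; apply: measurable_funS (measurable_funX 2 mk).
have e : (\int[lam]_(x in OI) (slope E g x ^+ 2)%:E =
          \int[lam]_(x in OI `\` E) (slope E g x ^+ 2)%:E)%E.
  rewrite [LHS]integral_mkcond [RHS]integral_mkcond; apply: eq_integral => x _.
  rewrite !patchE in_setD; case: ifP => //= xI.
  case: (boolP (x \in E)) => //= /set_mem Ex.
  by rewrite slope_E// expr0n.
rewrite e; apply: (@le_trans _ _ (\int[lam]_(x in OI `\` E) (h x ^+ 2)%:E)%E).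
  apply: H => p gp; have [p12 [E1 [E2 _]]] := gp.
  have [I1 I2] := (E_Iset E1, E_Iset E2).
  rewrite (eq_integral (fun=> (((g p.2 - g p.1) / (p.2 - p.1)) ^+ 2)%:E)); last first.
    by move=> x; rewrite inE/= in_itv/= => xp; rewrite (slope_gap _ gp xp).
  rewrite (gap_measure _ gp) expr2 mulrA -mulrA mulVf ?mulr1 ?subr_eq0 ?gt_eqF//.
  rewrite mulrAC -expr2.
  rewrite -(@integral_itv_bndoo R p.1 p.2 (fun x => (h x ^+ 2)%:E) true false); last first.
    by apply: measurable_funS (m2 _ mh) => //; exact: Iset_itv_sub.
  rewrite [leRHS]integral_sqr_rip ?lee_fin; [exact: (adm_gap_le a gp)|exact: mitvcc|].
  by apply: sqi_OI_itv => //; exact: adm_sqi a.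
apply: ge0_subset_integral => //; first exact: (measurable_gapset EK).
- exact: m2.
- by move=> t _; rewrite lee_fin sqr_ge0.
Qed.

(* The derivative of a member of the form domain: the density on E and the
   difference quotient on each gap, so that the form is half of its square integral. *)
Definition der (gh : (R -> R) * (R -> R)) x := \1_E x * gh.2 x + slope E gh.1 x.

Lemma der_E gh x : E x -> der gh x = gh.2 x.
Proof. by move=> Ex; rewrite /der indicE mem_set// mul1r slope_E// addr0. Qed.

Lemma der_notE gh x : ~ E x -> der gh x = slope E gh.1 x.
Proof. by move=> nE; rewrite /der indicE memNset// mul0r add0r. Qed.

Lemma sqi_der g h : adm E g h -> sqi lam OI (der (g, h)).
Proof.
move=> a; apply: sqiD => //; last exact: sqi_slope a.
have sh := adm_sqi a; apply: le_sqi sh => //.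
  by apply: measurable_funM; [exact: measurable_indic_E|case: (adm_sqi a)].
move=> x _; rewrite /= normrM indicE; case: (_ \in _); last by rewrite normr0 mul0r.
by rewrite normr1 mul1r.
Qed.

Lemma adm_holder g h x y : adm E g h -> Iset E x -> Iset E y ->
  (g x - g y) ^+ 2 <= `|x - y| * rip lam OI h h.
Proof.
move=> a Ix Iy; wlog xy : x y Ix Iy / x <= y => [H|].
  have [xy|/ltW yx] := leP x y; first exact: H.
  by rewrite distrC -sqrrN opprB; exact: H.
rewrite -sqrrN opprB (adm_itv a Ix Iy xy) distrC ger0_norm ?subr_ge0//.
by apply: holder_OI => //; exact: adm_sqi a.
Qed.

Lemma sqr_lt_norm (a e : R) : 0 <= e -> a ^+ 2 < e ^+ 2 -> `|a| < e.
Proof.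
by move=> e0; rewrite -[a ^+ 2]real_normK ?num_real// ltr_pXn2r// nnegrE.
Qed.

Lemma adm_cont_on g h : adm E g h -> cont_on E g.
Proof.
move=> a x Ex e e0; pose C := rip lam OI h h + 1.
have C0 : 0 < C by rewrite ltr_wpDl// rip_ge0.
exists (e ^+ 2 / C); first by rewrite divr_gt0// exprn_gt0.
move=> y Ey; rewrite ltr_pdivlMr// => xy; apply: sqr_lt_norm; first exact: ltW.
apply: le_lt_trans (adm_holder a (E_Iset Ex) (E_Iset Ey)) _; apply: le_lt_trans xy.
by rewrite ler_wpM2l// lerDl.
Qed.

Lemma adm_eq_on g h g' h' : adm E g h -> adm E g' h' -> aeeq mu g g' ->
  forall x, E x -> g x = g' x.
Proof.
by move=> a a' e; exact: (aeeq_eq_on EK muE (adm_cont_on a) (adm_cont_on a') e).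
Qed.

Lemma slope_eq_on g g' : (forall x, E x -> g x = g' x) -> slope E g = slope E g'.
Proof.
move=> gg; apply/funext => x.
have [[Ix nE]|n] := pselect (OI x /\ ~ E x); last by rewrite /slope (gapof_out n) !subrr !mul0r.
by have [[_ [E1 [E2 _]]] _] := gapofP EK Ix nE; rewrite /slope !gg.
Qed.

(* On a gap both densities integrate to the increment of g, so subtracting
   the gaps shows that h - h' integrates to 0 over the trace of E on [x, y]. *)
Lemma adm_der_ae g h g' h' : adm E g h -> adm E g' h' ->
  (forall x, E x -> g x = g' x) ->
  {ae lam, forall x, OI x -> der (g, h) x = der (g', h') x}.
Proof.
move=> a a' gg; pose k x := \1_E x * (h x - h' x).
have [sh sh'] := (adm_sqi a, adm_sqi a').
have mE := measurable_E EK.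
have mk : measurable_fun setT k.
  apply: measurable_funM; first exact: measurable_indic_E.
  by apply: measurable_funB; [case: sh|case: sh'].
have sk : sqi lam OI k.
  apply: le_sqi (sqiB mOI sh sh') => // x _; rewrite /k normrM indicE.
  by case: (_ \in _); rewrite ?normr1 ?mul1r// normr0 mul0r.
have split_itv y z : E y -> E z -> y <= z -> Rintegral lam `[y, z] k = 0.
  move=> Ey Ez yz; have [Iy Iz] := (E_Iset Ey, E_Iset Ez).
  have i1 := sqi_integrable_itv (sqi_OI_itv Iy Iz sh).
  have i2 := sqi_integrable_itv (sqi_OI_itv Iy Iz sh').
  have ik := sqi_integrable_itv (sqi_OI_itv Iy Iz sk).
  have ib := integrableB (mitvcc y z) i1 i2.
  have e0 : Rintegral lam `[y, z] (fun x => h x - h' x) = 0.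
    rewrite RintegralB//.
    by rewrite -(adm_itv a)// -(adm_itv a')// !gg// subrr.
  have G : Rintegral lam (`[y, z] `\` E) h = Rintegral lam (`[y, z] `\` E) h'.
    apply: Rintegral_gaps_eq => // p [p12 [E1 [E2 _]]] _ _.
    have [I1 I2] := (E_Iset E1, E_Iset E2).
    have q f : sqi lam OI f -> Rintegral lam `]p.1, p.2[ f = Rintegral lam `[p.1, p.2] f.
      move=> sf; congr fine; rewrite (@integral_itv_bndoo R p.1 p.2 _ true false)//.
      by apply/measurable_EFinP; case: sf => mf _; exact: measurable_funS mf.
    by rewrite !q// -(adm_itv a I1 I2 (ltW p12)) -(adm_itv a' I1 I2 (ltW p12)) !gg.
  have mD : @measurable _ (measurableTypeR R) (`[y, z]%classic `\` E).
    by apply: measurableD => //; exact: mitvcc.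
  have mI : @measurable _ (measurableTypeR R) (`[y, z]%classic `&` E).
    by apply: measurableI => //; exact: mitvcc.
  have S (D : set R) (f : R -> R) : @measurable _ (measurableTypeR R) D -> D `<=` `[y, z] ->
      lam.-integrable `[y, z] (EFin \o f) -> lam.-integrable D (EFin \o f).
    by move=> mD' DI; apply: integrableS => //; exact: mitvcc.
  have U (f : R -> R) : lam.-integrable `[y, z] (EFin \o f) ->
     Rintegral lam `[y, z] f = Rintegral lam (`[y, z] `&` E) f + Rintegral lam (`[y, z] `\` E) f.
    move=> jf; rewrite -Rintegral_setU ?setUIDK//.
    by apply/disj_setPS => x [[_ Ex] [_ /(_ Ex)]].
  rewrite U//; have := U _ ib; rewrite e0 [X in _ = _ + X](_ : _ = 0); last first.
    rewrite RintegralB ?G ?subrr//; by apply: S => //; exact: subDsetl.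
  rewrite addr0 => e1; rewrite [X in _ + X](_ : _ = 0) ?addr0; last first.
    rewrite (@eq_Rintegral _ _ _ lam _ (fun=> 0)).
      by rewrite Rintegral_cst// mul0r.
    by move=> x; rewrite inE => -[_ nE]; rewrite /k indicE memNset// mul0r.
  rewrite e1; apply: eq_Rintegral => x; rewrite inE => -[_ Ex].
  by rewrite /k indicE mem_set// mul1r.
have K : {ae lam, forall x, OI x -> k x = 0}.
  apply: ae_local => x /(openIP E)[y [z [Ey Ez yx xz]]].
  exists y, z; split; first by rewrite yx.
  have ik := sqi_integrable_itv (sqi_OI_itv (E_Iset Ey) (E_Iset Ez) sk).
  have yz := ltW (lt_trans yx xz).
  (* When t lies in a gap, k vanishes from t up to the right end of the gap, which belongs to E;
     [split_itv] covers the rest. *)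
  have H : forall t, y <= t <= z -> Rintegral lam `[t, z] k = 0.
    move=> t /andP[yt tz]; have [Et|nE] := pselect (E t); first exact: split_itv.
    have Ot : OI t.
      apply/(openIP E); exists y, z; split=> //; rewrite lt_neqAle.
        by rewrite yt andbT; apply/eqP => e; apply: nE; rewrite -e.
      by rewrite tz andbT; apply/eqP => e; apply: nE; rewrite e.
    have [gp tp] := gapofP EK Ot nE; have [p12 [E1 [E2 nE']]] := gp.
    set p := gapof E t in gp tp p12 E1 E2 nE'; case/andP: tp => t1 t2.
    have p2z : p.2 <= z.
      by case: (gap_notin gp Ez) => // zp; have := lt_le_trans t1 tz; rewrite ltNge zp.
    rewrite (Rintegral_itv_split (ltW t2) p2z) ?(split_itv _ _ E2 Ez p2z) ?addr0; last first.
      by apply: integrable_itvS ik.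
    have -> : Rintegral lam `[t, p.2] k = Rintegral lam `]t, p.2[ k.
      congr fine; rewrite (@integral_itv_bndoo R t p.2 _ true false)//.
      by apply/measurable_EFinP; exact: measurable_funS mk.
    rewrite (@eq_Rintegral _ _ _ lam _ (fun=> 0)) ?Rintegral_cst ?mul0r//.
    move=> s; rewrite inE/= in_itv/= => /andP[ts sp].
    rewrite /k indicE memNset ?mul0r// => Es; apply: (nE' s) => //.
    by rewrite (lt_trans t1 ts) sp.
  by apply: ae_imp (ae_eq0_itv mk yz ik H) => t Ht /andP[/ltW yt /ltW tz]; rewrite Ht// yt.
apply: ae_imp K => x Hx /Hx; rewrite /k /der /= (slope_eq_on gg) mulrBr => /eqP.
by rewrite subr_eq0 => /eqP ->.
Qed.

Lemma rep_adm f : Fdom E mu f -> adm E (rep E mu f).1 (rep E mu f).2 /\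
  aeeq mu f (rep E mu f).1.
Proof.
move=> [_ [g [h [a fg]]]]; apply: (@xgetPex _ (cst 0, cst 0)
  [set gh | adm E gh.1 gh.2 /\ aeeq mu f gh.1]).
by exists (g, h).
Qed.

Lemma rep_Eform f f' : adm E (rep E mu f).1 (rep E mu f).2 ->
  adm E (rep E mu f').1 (rep E mu f').2 ->
  Eform E mu f f' = 2^-1 * rip lam OI (der (rep E mu f)) (der (rep E mu f')).
Proof.
set gh := rep E mu f; set gh' := rep E mu f' => a a'.
have sd : sqi lam OI (der gh) by have := sqi_der a; case: (gh).
have sd' : sqi lam OI (der gh') by have := sqi_der a'; case: (gh').
have mE := measurable_E EK.
have im := sqi_integrableM mOI sd sd'.
rewrite /Eform -mulrDr; congr (_ * _).
rewrite /rip -[X in _ = Rintegral _ X _](setUIDK OI E) Rintegral_setU; last 4 first.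
- exact: measurableI.
- exact: measurableD.
- by rewrite setUIDK.
- by apply/disj_setPS => x [[_ Ex] [_ /(_ Ex)]].
congr (_ + _).
  by rewrite setIC; apply: eq_Rintegral => x; rewrite inE => -[_ Ex]; rewrite !der_E.
pose phi p := (gh.1 p.2 - gh.1 p.1) / (p.2 - p.1) * ((gh'.1 p.2 - gh'.1 p.1) / (p.2 - p.1)).
have -> : Rintegral lam (OI `\` E) (fun x => der gh x * der gh' x) =
    Rintegral lam (OI `\` E) (fun x => phi (gapof E x)).
  by apply: eq_Rintegral => x; rewrite inE => -[_ nE]; rewrite !der_notE.
rewrite -gsum_gaps//.
  rewrite /gsum; congr (fine _ - fine _); apply: eq_esum => p [p12 _];
  by congr (Num.max _ _)%:E; rewrite /phi; field; rewrite subr_eq0 gt_eqF.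
have : lam.-integrable (OI `\` E) (EFin \o (fun x => der gh x * der gh' x)).
  by apply: integrableS im => //; exact: measurableD.
apply: eq_integrable; first exact: measurableD.
by move=> x; rewrite inE => -[_ nE] /=; rewrite !der_notE.
Qed.

(** Frees energy computations from the choice made by [rep]: by [adm_der_ae] any admissible pair has
    the same [der] a.e. *)
Lemma Eform_der f g h f' g' h' : adm E g h -> aeeq mu f g -> adm E g' h' -> aeeq mu f' g' ->
  Eform E mu f f' = 2^-1 * rip lam OI (der (g, h)) (der (g', h')).
Proof.
have tr u v w : aeeq mu u v -> aeeq mu u w -> aeeq mu v w.
  by apply: ae_imp2 => x -> ->.
have H u v w : L2 mu (cst 0) -> adm E v w -> aeeq mu u v ->
    [/\ adm E (rep E mu u).1 (rep E mu u).2, aeeq mu u (rep E mu u).1 &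
      {ae lam, forall x, OI x -> der (rep E mu u) x = der (v, w) x}].
  move=> _ a uv; have [a1 a2] : adm E (rep E mu u).1 (rep E mu u).2 /\ aeeq mu u (rep E mu u).1.
    apply: (@xgetPex _ (cst 0, cst 0) [set gh | adm E gh.1 gh.2 /\ aeeq mu u gh.1]).
    by exists (v, w).
  split=> //; have := adm_der_ae a1 a (adm_eq_on a1 a (tr _ _ _ a2 uv)).
  by case: (rep E mu u).
move=> a fg a' fg'; have L0 : L2 mu (cst 0) by exact: sqi_cst0.
have [b1 _ b2] := H _ _ _ L0 a fg; have [b1' _ b2'] := H _ _ _ L0 a' fg'.
rewrite rep_Eform//; congr (_ * _).
have m0 (u : (R -> R) * (R -> R)) : adm E u.1 u.2 -> measurable_fun setT (der u).
  by move=> /sqi_der; case: u => ? ? [].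
by apply: eq_rip_ae => //; [exact: m0|exact: m0|exact: (m0 (g, h))|exact: (m0 (g', h'))].
Qed.

End Admissible.

(** * Algebra of the form and of its norm *)

Section Forms.
Variables (R : realType) (E : set R)
  (mu : {measure set (measurableTypeR R) -> \bar R}).
Hypothesis EK : inK E.
Hypothesis muE : radon_full E mu.
Notation lam := (leb R).
Notation OI := (openI E).
Notation Fd := (Fdom E mu).
Notation EF := (Eform E mu).
Implicit Types (f g h u v w : R -> R) (x y z a b : R).

Let mOI := measurable_openI E.

Lemma aeeq_sym f g : aeeq mu f g -> aeeq mu g f.
Proof. by apply: ae_imp => x ->. Qed.

Lemma aeeq_trans f g h : aeeq mu f g -> aeeq mu g h -> aeeq mu f h.
Proof. by apply: ae_imp2 => x -> ->. Qed.

Lemma aeeq_on f g : (forall x, E x -> f x = g x) -> aeeq mu f g.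
Proof.
move=> fg; have := measure0_notin (measurableC (measurable_E EK)) muE.1.
by apply: ae_imp => x nEx; apply: fg; exact: contrapT.
Qed.

(** The set from which [rep] chooses depends only on the class of the function, so the chosen pairs
    are equal and not merely equivalent. *)
Lemma rep_aeeq f g : aeeq mu f g -> rep E mu f = rep E mu g.
Proof.
move=> fg; rewrite /rep; congr xget; apply/seteqP; split=> -[u v] /= [auv e]; split=> //.
  exact: aeeq_trans (aeeq_sym fg) e.
exact: aeeq_trans fg e.
Qed.

Lemma Eform_aeeq f f' g g' : aeeq mu f f' -> aeeq mu g g' -> EF f g = EF f' g'.
Proof. by move=> ff gg; rewrite /Eform (rep_aeeq ff) (rep_aeeq gg). Qed.

Lemma ip_aeeq f f' g g' : L2 mu f -> L2 mu f' -> L2 mu g -> L2 mu g' ->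
  aeeq mu f f' -> aeeq mu g g' -> ip mu f g = ip mu f' g'.
Proof.
move=> [mf _] [mf' _] [mg _] [mg' _] ff gg.
apply: (@eq_rip_ae R mu setT measurableT f f' g g') => //.
  by apply: ae_imp ff => x ->.
by apply: ae_imp gg => x ->.
Qed.

Lemma cvg_lin (F : set_system R) (FF : Filter F) (g g' : R -> R) a :
  g @ F --> 0 -> g' @ F --> 0 -> (fun x => a * g x + g' x) @ F --> 0.
Proof.
move=> g0 g0'; rewrite (_ : 0 = a * 0 + 0); last by rewrite mulr0 addr0.
by apply: cvgD => //; apply: cvgM => //; exact: cvg_cst.
Qed.

Lemma admZD a g h g' h' : adm E g h -> adm E g' h' ->
  adm E (fun x => a * g x + g' x) (fun x => a * h x + h' x).
Proof.
move=> A A'; have [[mh H] [hoo [L1 R1]]] := A; have [[mh' H'] [hoo' [L1' R1']]] := A'.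
have [m1 m2] : sqi lam OI (fun x => a * h x + h' x).
  by apply: sqiD => //; apply: sqiZ => //; exact: adm_sqi A.
split; [split=> // x y Ix Iy xy|split=> //; split=> c lc nE].
- have [i1 e1] := H x y Ix Iy xy; have [i2 e2] := H' x y Ix Iy xy.
  have i3 := integrableZl (mitvcc x y) a i1.
  split; first by have := integrableD (mitvcc x y) i3 i2; apply: eq_integrable.
  rewrite RintegralD//; rewrite RintegralZl//; rewrite -e1 -e2; ring.
- by apply: cvg_lin; [exact: L1|exact: L1'].
- by apply: cvg_lin; [exact: R1|exact: R1'].
Qed.

Lemma derZD a (gh gh' : (R -> R) * (R -> R)) x :
  der E (fun x => a * gh.1 x + gh'.1 x, fun x => a * gh.2 x + gh'.2 x) x =
  a * der E gh x + der E gh' x.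
Proof. by rewrite /der /slope /=; ring. Qed.

Lemma FdomZD a f g : Fd f -> Fd g -> Fd (fun x => a * f x + g x).
Proof.
move=> [Lf [f1 [f2 [af ef]]]] [Lg [g1 [g2 [ag eg]]]]; split.
  by apply: (@sqiD R mu setT) => //; exact: sqiZ.
exists (fun x => a * f1 x + g1 x), (fun x => a * f2 x + g2 x); split; first exact: admZD.
by apply: ae_imp2 ef eg => x -> ->.
Qed.

Lemma EformC f g : Fd f -> Fd g -> EF f g = EF g f.
Proof.
move=> [_ [f1 [f2 [af ef]]]] [_ [g1 [g2 [ag eg]]]].
by rewrite (Eform_der EK muE af ef ag eg) (Eform_der EK muE ag eg af ef) ripC.
Qed.

Lemma Eform_ge0 f : Fd f -> 0 <= EF f f.
Proof.
move=> [_ [f1 [f2 [af ef]]]]; rewrite (Eform_der EK muE af ef af ef).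
by rewrite mulr_ge0 ?invr_ge0// rip_ge0.
Qed.

Lemma EformZD a f g h : Fd f -> Fd g -> Fd h ->
  EF (fun x => a * f x + g x) h = a * EF f h + EF g h.
Proof.
move=> [_ [f1 [f2 [af ef]]]] [_ [g1 [g2 [ag eg]]]] [_ [h1 [h2 [ah eh]]]].
have afg := admZD a af ag.
have efg : aeeq mu (fun x => a * f x + g x) (fun x => a * f1 x + g1 x).
  by apply: ae_imp2 ef eg => x -> ->.
rewrite (Eform_der EK muE afg efg ah eh) (Eform_der EK muE af ef ah eh).
rewrite (Eform_der EK muE ag eg ah eh).
rewrite (_ : der _ _ = fun x => a * der E (f1, f2) x + der E (g1, g2) x); last first.
  by apply/funext => x; rewrite -derZD.
by rewrite ripZDl//; [ring|exact: sqi_der|exact: sqi_der|exact: sqi_der].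
Qed.

Lemma Fdom_zero f : Fd f -> Fd (fun=> 0).
Proof.
move=> Ff; have := FdomZD (-1) Ff Ff.
by under eq_fun do rewrite mulN1r addNr.
Qed.

Lemma FdomZ a f : Fd f -> Fd (fun x => a * f x).
Proof.
move=> Ff; have := FdomZD a Ff (Fdom_zero Ff).
by under eq_fun do rewrite addr0.
Qed.

Lemma FdomB f g : Fd f -> Fd g -> Fd (fun x => f x - g x).
Proof.
move=> Ff Fg; have := FdomZD (-1) Fg Ff.
by under eq_fun do rewrite mulN1r addrC.
Qed.

Lemma EformZ a f h : Fd f -> Fd h -> EF (fun x => a * f x) h = a * EF f h.
Proof.
move=> Ff Fh; have F0 := Fdom_zero Ff; have := EformZD a Ff F0 Fh.
under eq_fun do rewrite addr0.
have := EformZD (-1) F0 F0 Fh.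
under eq_fun do rewrite mulr0 addr0.
move=> e0 ->; move: e0; set z := EF (fun=> 0) h => e0.
by have z0 : z = 0 by [lra]; rewrite z0 addr0.
Qed.

Lemma EformZZ a b f g : Fd f -> Fd g ->
  EF (fun x => a * f x + b * g x) (fun x => a * f x + b * g x) =
  a ^+ 2 * EF f f + 2 * a * b * EF f g + b ^+ 2 * EF g g.
Proof.
move=> Ff Fg; have Fbg := FdomZ b Fg; have Fs := FdomZD a Ff Fbg.
rewrite EformZD// EformZ// (EformC Ff Fs) (EformC Fg Fs) !EformZD// !EformZ//.
by rewrite (EformC Fg Ff); ring.
Qed.

Lemma ipZZ a b f g : L2 mu f -> L2 mu g ->
  ip mu (fun x => a * f x + b * g x) (fun x => a * f x + b * g x) =
  a ^+ 2 * ip mu f f + 2 * a * b * ip mu f g + b ^+ 2 * ip mu g g.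
Proof. by move=> Lf Lg; exact: (@ripZD R mu setT measurableT a b f g Lf Lg). Qed.

Definition nrm2 f := ip mu f f.
Definition en f := EF f f.
Definition q1 f := E1 E mu f f.

Lemma q1E f : q1 f = en f + nrm2 f. Proof. by []. Qed.

Lemma nrm2_ge0 f : 0 <= nrm2 f. Proof. exact: rip_ge0. Qed.

Lemma en_ge0 f : Fd f -> 0 <= en f. Proof. exact: Eform_ge0. Qed.

Lemma Fdom_L2 f : Fd f -> L2 mu f. Proof. by case. Qed.

(** Nonnegativity of the energy of c a f - b g, divided by c. The weight c is left free so that a
    perturbation of small energy costs only a factor close to 1. *)
Lemma en_wtri a b c f g : 0 < c -> Fd f -> Fd g ->
  en (fun x => a * f x + b * g x) <= (1 + c) * a ^+ 2 * en f + (1 + c^-1) * b ^+ 2 * en g.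
Proof.
move=> c0 Ff Fg; rewrite /en EformZZ//.
have := en_ge0 (FdomZD (c * a) Ff (FdomZ (- b) Fg)); rewrite /en EformZZ// => H.
rewrite -subr_ge0 -(pmulr_rge0 _ c0); apply: le_trans H _.
rewrite le_eqVlt; apply/orP; left; apply/eqP.
by field; rewrite gt_eqF.
Qed.

Lemma nrm2_wtri a b f g : L2 mu f -> L2 mu g ->
  nrm2 (fun x => a * f x + b * g x) <= 2 * a ^+ 2 * nrm2 f + 2 * b ^+ 2 * nrm2 g.
Proof.
move=> Lf Lg; rewrite /nrm2 ipZZ//.
have := nrm2_ge0 (fun x => a * f x + (- b) * g x); rewrite /nrm2 ipZZ//; lra.
Qed.

Lemma q1_wtri a b f g : Fd f -> Fd g ->
  q1 (fun x => a * f x + b * g x) <= 2 * a ^+ 2 * q1 f + 2 * b ^+ 2 * q1 g.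
Proof.
move=> Ff Fg; rewrite !q1E; have := en_wtri a b ltr01 Ff Fg.
have := nrm2_wtri a b (Fdom_L2 Ff) (Fdom_L2 Fg); rewrite invr1; lra.
Qed.

Lemma subf_lin f g : (fun x => f x - g x) = (fun x => 1 * f x + (-1) * g x).
Proof. by apply/funext => x; rewrite mul1r mulN1r. Qed.

Lemma nrm2_tri3 f g h : L2 mu f -> L2 mu g -> L2 mu h ->
  nrm2 (fun x => f x - g x) <=
  2 * nrm2 (fun x => f x - h x) + 2 * nrm2 (fun x => g x - h x).
Proof.
move=> Lf Lg Lh; have B u v : L2 mu u -> L2 mu v -> L2 mu (fun x => u x - v x).
  by move=> Lu Lv; exact: (@sqiB R mu setT).
have := nrm2_wtri 1 (-1) (B _ _ Lf Lh) (B _ _ Lg Lh).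
rewrite (_ : (fun x => 1 * _ + _) = (fun x => f x - g x)); last first.
  by apply/funext => x; ring.
by rewrite sqrrN expr1n !mulr1.
Qed.

Lemma q1_tri3 f g h : Fd f -> Fd g -> Fd h ->
  q1 (fun x => f x - g x) <= 2 * q1 (fun x => f x - h x) + 2 * q1 (fun x => g x - h x).
Proof.
move=> Ff Fg Fh; have := q1_wtri 1 (-1) (FdomB Ff Fh) (FdomB Fg Fh).
rewrite (_ : (fun x => 1 * _ + _) = (fun x => f x - g x)); last first.
  by apply/funext => x; ring.
by rewrite sqrrN expr1n !mulr1.
Qed.

Lemma en_sub_sym f g : Fd f -> Fd g -> en (fun x => f x - g x) = en (fun x => g x - f x).
Proof.
move=> Ff Fg; rewrite !subf_lin /en !EformZZ// (EformC Fg Ff); ring.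
Qed.

Lemma nrm2_sub_sym f g : nrm2 (fun x => f x - g x) = nrm2 (fun x => g x - f x).
Proof.
by congr fine; apply: eq_integral => x _; congr EFin; ring.
Qed.

Lemma q1_sub_sym f g : Fd f -> Fd g -> q1 (fun x => f x - g x) = q1 (fun x => g x - f x).
Proof. by move=> Ff Fg; rewrite !q1E en_sub_sym// nrm2_sub_sym. Qed.

Lemma en_le_limit B f : Fd f ->
  (forall e : R, 0 < e -> exists v, [/\ Fd v, en v <= B + e & en (fun x => f x - v x) <= e]) ->
  en f <= B.
Proof.
move=> Ff H; rewrite leNgt; apply/negP => Bf.
have B0 : 0 <= B.
  rewrite leNgt; apply/negP => B0; have e0 : 0 < - B / 2 by rewrite divr_gt0 ?oppr_gt0.
  have [v [/en_ge0 Fv v1 _]] := H _ e0; lra.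
pose d := en f - B; have d0 : 0 < d by rewrite subr_gt0.
(* Taking v within energy c^2 of f, the weighted inequality gives en f <= B + c (B + 4) < B + d,
   against the definition of d. *)
pose c := Num.min 1 (d / (B + 6)).
have B6 : 0 < B + 6 by lra.
have c0 : 0 < c by rewrite lt_min ltr01 divr_gt0.
have c1 : c <= 1 by rewrite ge_min lexx.
have cd : c * (B + 6) <= d by rewrite -ler_pdivlMr// ge_min lexx orbT.
have [v [Fv v1 v2]] := H (c ^+ 2) (exprn_gt0 _ c0).
have := en_wtri 1 1 c0 Fv (FdomB Ff Fv).
rewrite (_ : (fun x => 1 * _ + _) = f); last by apply/funext => x; ring.
rewrite expr1n !mulr1 => h.
have ci : c^-1 * c ^+ 2 = c by rewrite expr2 mulrA mulVf ?mul1r ?gt_eqF.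
have i1 : (1 + c^-1) * en (fun x => f x - v x) <= c ^+ 2 + c.
  apply: (@le_trans _ _ ((1 + c^-1) * c ^+ 2)); last by rewrite mulrDl mul1r ci.
  by rewrite ler_wpM2l// addr_ge0// invr_ge0 ltW.
have i2 : (1 + c) * en v <= (1 + c) * (B + c ^+ 2) by rewrite ler_wpM2l//; lra.
have i3 : c ^+ 2 <= c by rewrite expr2 -[leRHS]mulr1 ler_wpM2l// ltW.
have i4 : c * c ^+ 2 <= c.
  by rewrite -[leRHS]mulr1 ler_wpM2l ?(ltW c0)//; exact: le_trans i3 c1.
rewrite /d in cd; nra.
Qed.

End Forms.

(** * Closures in the form norm *)

Section Closure.
Variables (R : realType) (E : set R)
  (mu : {measure set (measurableTypeR R) -> \bar R}).
Hypothesis EK : inK E.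
Hypothesis muE : radon_full E mu.
Notation Fd := (Fdom E mu).
Notation en := (en E mu).
Notation nrm2 := (nrm2 mu).
Notation q1 := (q1 E mu).
Implicit Types (f g h u v w : R -> R) (x y z a b : R).

Definition form_complete (F : set (R -> R)) :=
  forall u : nat -> R -> R, (forall n, F (u n)) ->
     (forall e : R, 0 < e -> exists N, forall m n, (N <= m)%N -> (N <= n)%N ->
        q1 (fun x => u n x - u m x) < e) ->
     exists f, F f /\ forall e : R, 0 < e -> exists N, forall n, (N <= n)%N ->
        q1 (fun x => u n x - f x) < e.

Definition linear_class (F : set (R -> R)) :=
  forall a f g, F f -> F g -> F (fun x => a * f x + g x).

Definition aeeq_closed (F : set (R -> R)) :=
  forall f g, F f -> measurable_fun setT g -> aeeq mu f g -> F g.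

Variables F V : set (R -> R).
Hypotheses (FFd : F `<=` Fd) (Fl : linear_class F) (Fae : aeeq_closed F)
  (Fc : form_complete F) (VF : V `<=` F) (Vl : linear_class V).

Definition form_closure : set (R -> R) :=
  [set f | F f /\ forall e : R, 0 < e -> exists2 v, V v & q1 (fun x => f x - v x) < e].

Let VFd v : V v -> Fd v. Proof. by move=> /VF /FFd. Qed.

Let linear0 (G : set (R -> R)) f : linear_class G -> G f -> G (fun=> 0).
Proof.
move=> Gl Gf; have := Gl (-1) f f Gf Gf.
by under eq_fun do rewrite mulN1r addNr.
Qed.

Lemma linear_classZ (G : set (R -> R)) a f : linear_class G -> G f ->
  G (fun x => a * f x).
Proof.
move=> Gl Gf; have := Gl a f _ Gf (linear0 Gl Gf).
by under eq_fun do rewrite addr0.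
Qed.

Lemma linear_classB (G : set (R -> R)) f g : linear_class G -> G f -> G g ->
  G (fun x => f x - g x).
Proof.
move=> Gl Gf Gg; have := Gl (-1) g f Gg Gf.
by under eq_fun do rewrite mulN1r addrC.
Qed.

Lemma linear_classD (G : set (R -> R)) f g : linear_class G -> G f -> G g ->
  G (fun x => f x + g x).
Proof.
move=> Gl Gf Gg; have := Gl 1 f g Gf Gg.
by under eq_fun do rewrite mul1r.
Qed.

Lemma nrm2_eq0_aeeq f g : L2 mu f -> L2 mu g -> nrm2 (fun x => f x - g x) <= 0 ->
  aeeq mu f g.
Proof.
move=> Lf Lg n0; have Lfg : L2 mu (fun x => f x - g x) by exact: (@sqiB R mu setT).
have z : nrm2 (fun x => f x - g x) = 0.
  by apply/eqP; rewrite eq_le n0 nrm2_ge0.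
have := @rip_eq0 R mu setT measurableT _ Lfg z.
by apply: ae_imp => x /(_ I) /eqP; rewrite subr_eq0 => /eqP.
Qed.

Lemma q1_nrm2_le f : Fd f -> nrm2 f <= q1 f.
Proof. by move=> Ff; rewrite q1E lerDr; exact: en_ge0. Qed.

Lemma q1_en_le f : en f <= q1 f.
Proof. by rewrite q1E lerDl; exact: nrm2_ge0. Qed.

Lemma q1_aeeq f g : L2 mu f -> L2 mu g -> aeeq mu f g -> q1 f = q1 g.
Proof.
move=> Lf Lg fg; rewrite !q1E /en /nrm2 (Eform_aeeq _ fg fg).
by rewrite (ip_aeeq Lf Lg Lf Lg fg fg).
Qed.

(* A Banach-Saks type statement: near minimizers of the energy among the
   elements of V at L2-distance at most e from w form a Cauchy sequence by
   the parallelogram identity. *)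
Lemma closure_of_bounded w B : L2 mu w ->
  (forall e : R, 0 < e -> exists v, [/\ V v, en v <= B & nrm2 (fun x => v x - w x) <= e]) ->
  form_closure w /\ en w <= B.
Proof.
move=> Lw H.
pose S e : set R := [set t | exists v, [/\ V v, nrm2 (fun x => v x - w x) <= e & t = en v]].
pose m e := inf (S e).
have S0 (e : R) : 0 < e -> has_inf (S e).
  move=> e0; split; last by exists 0 => _ [v [Vv _ ->]]; exact/en_ge0/VFd.
  by have [v [Vv _ v1]] := H e e0; exists (en v), v.
have mB (e : R) : 0 < e -> m e <= B.
  move=> e0; have [v [Vv vB v1]] := H e e0; apply: le_trans vB.
  by apply: ge_inf; [exact: (S0 e e0).2|exists v].
have m_ge0 (e : R) : 0 < e -> 0 <= m e.
  move=> e0; apply: lb_le_inf; first exact: (S0 e e0).1.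
  by move=> _ [v [Vv _ ->]]; exact/en_ge0/VFd.
have mono (e e' : R) : 0 < e -> e <= e' -> m e' <= m e.
  move=> e0 ee; apply: lb_le_inf; first exact: (S0 e e0).1.
  move=> _ [v [Vv v1 ->]]; apply: ge_inf; first exact: (S0 e' (lt_le_trans e0 ee)).2.
  by exists v; split=> //; exact: le_trans v1 ee.
pose T : set R := [set m e | e in [set e | 0 < e]].
have T0 : has_sup T.
  split; last by exists B => _ [e /= e0 <-]; exact: mB.
  by exists (m 1); exists 1 => //=; exact: ltr01.
(* As [m] is monotone, M is the limit of [m e] as e tends to 0. Near minimizers and their midpoints
   all have energy close to M, which leaves almost no energy for the differences. *)
pose M := sup T.
have mM (e : R) : 0 < e -> m e <= M by move=> e0; apply: ub_le_sup; [exact: T0.2|exists e].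
pose en_ n : R := n.+1%:R^-1.
have en0 n : 0 < en_ n by rewrite invr_gt0.
have K n : exists v, [/\ V v, nrm2 (fun x => v x - w x) <= en_ n & en v <= m (en_ n) + en_ n].
  have [_ [v [Vv v1 ->]] v2] := inf_adherent (en0 n) (S0 _ (en0 n)).
  by exists v; split=> //; exact: ltW.
have [v Hv] := choice K.
have small (e : R) : 0 < e -> exists N, forall n, (N <= n)%N -> en_ n <= e.
  move=> e0; exists (Num.bound e^-1) => n Nn; rewrite /en_ invf_ple ?posrE//.
  apply: ltW; apply: lt_le_trans (archi_boundP _) _; first by rewrite invr_ge0 ltW.
  by rewrite ler_nat (leq_trans Nn).
have par n k (e : R) : 0 < e -> en_ n <= e -> en_ k <= e ->
    q1 (fun x => v n x - v k x) <= 4 * (M - m e) + 8 * e.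
  move=> e0 ne ke; have [Vn n1 n2] := Hv n; have [Vk k1 k2] := Hv k.
  have [Fn Fk] := (VFd Vn, VFd Vk).
  have Vm : V (fun x => 2^-1 * v n x + 2^-1 * v k x).
    by apply: Vl => //; exact: linear_classZ.
  have e1 : en (fun x => v n x - v k x) = 2 * en (v n) + 2 * en (v k)
     - 4 * en (fun x => 2^-1 * v n x + 2^-1 * v k x).
    by rewrite subf_lin /en !EformZZ//; field.
  have Lwn := @sqiB R mu setT measurableT _ _ (Fdom_L2 Fn) Lw.
  have Lwk := @sqiB R mu setT measurableT _ _ (Fdom_L2 Fk) Lw.
  have h1 : nrm2 (fun x => (2^-1 * v n x + 2^-1 * v k x) - w x) <= e.
    have := nrm2_wtri 2^-1 2^-1 Lwn Lwk.
    rewrite (_ : (fun x => 2^-1 * (_ - _) + _) =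
      (fun x => (2^-1 * v n x + 2^-1 * v k x) - w x)); last by apply/funext => x; field.
    by have := le_trans n1 ne; have := le_trans k1 ke; lra.
  have h2 : m e <= en (fun x => 2^-1 * v n x + 2^-1 * v k x).
    by apply: ge_inf; [exact: (S0 e e0).2|exists (fun x => 2^-1 * v n x + 2^-1 * v k x)].
  have h3 := nrm2_tri3 (Fdom_L2 Fn) (Fdom_L2 Fk) Lw.
  rewrite q1E e1; have := le_trans n1 ne; have := le_trans k1 ke.
  by have := mM _ (en0 n); have := mM _ (en0 k); move: n2 k2 h2 h3 ne ke; clear; lra.
have [f [Ff fv]] : exists f, F f /\ forall e : R, 0 < e -> exists N, forall n, (N <= n)%N ->
        q1 (fun x => v n x - f x) < e.
  apply: Fc => [n|e e0]; first by apply: VF; case: (Hv n).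
  have e16 : 0 < e / 32 by rewrite divr_gt0.
  have [_ [e' /= e'0 <-] Me'] := sup_adherent e16 T0.
  have me0 : 0 < Num.min e' (e / 32) by rewrite lt_min e'0.
  have [N HN] := small _ me0; exists N => k n Nk Nn.
  apply: le_lt_trans (par n k _ me0 (HN _ Nn) (HN _ Nk)) _.
  have := mono _ _ me0 (_ : Num.min e' (e / 32) <= e'); rewrite ge_min lexx => /(_ isT).
  have : Num.min e' (e / 32) <= e / 32 by rewrite ge_min lexx orbT.
  by move: Me'; rewrite -/M; lra.
have Ffd := FFd Ff.
have wf : aeeq mu f w.
  apply: nrm2_eq0_aeeq => //; first exact: (Fdom_L2 Ffd).
  rewrite leNgt; apply/negP => n0; have e0 : 0 < nrm2 (fun x => f x - w x) / 8 by rewrite divr_gt0.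
  have [N HN] := fv _ e0; have [N' HN'] := small _ e0.
  have [Vn n1 _] := Hv (maxn N N'); have Fn := VFd Vn.
  have := nrm2_tri3 (Fdom_L2 Ffd) Lw (Fdom_L2 Fn).
  have := HN _ (leq_maxl N N'); have := HN' _ (leq_maxr N N').
  have := q1_nrm2_le (FdomB Fn Ffd).
  move=> h1 h2 h3.
  rewrite (nrm2_sub_sym _ f (v _)) (nrm2_sub_sym _ w (v _)) => h4.
  by have := le_trans n1 h2; lra.
have Fw : F w by apply: Fae wf => //; case: Lw.
have Fwd := FFd Fw.
split; last first.
  apply: (en_le_limit EK muE Fwd) => e e0.
  have [N HN] := fv _ e0; have [N' HN'] := small _ e0.
  have [Vn n1 n2] := Hv (maxn N N'); have Fn := VFd Vn; exists (v (maxn N N')); split=> //.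
    by apply: le_trans n2 _; rewrite lerD ?mB//; exact: HN' (leq_maxr _ _).
  apply: le_trans (q1_en_le _) _; apply: ltW.
  rewrite q1_sub_sym// (q1_aeeq _ _ (_ : aeeq mu _ (fun x => v (maxn N N') x - f x))).
  - exact: HN (leq_maxl _ _).
  - exact: (Fdom_L2 (FdomB Fn Fwd)).
  - exact: (Fdom_L2 (FdomB Fn Ffd)).
  - by apply: ae_imp wf => x ->.
split=> // e e0; have [N HN] := fv _ e0; have [Vn _ _] := Hv N.
have Fn := VFd Vn; exists (v N) => //.
rewrite q1_sub_sym// (q1_aeeq _ _ (_ : aeeq mu _ (fun x => v N x - f x))).
- exact: HN.
- exact: (Fdom_L2 (FdomB Fn Fwd)).
- exact: (Fdom_L2 (FdomB Fn Ffd)).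
- by apply: ae_imp wf => x ->.
Qed.

Lemma form_closure_lin : linear_class form_closure.
Proof.
move=> a f g [Ff Hf] [Fg Hg]; split; first exact: Fl.
move=> e e0; have C0 : 0 < e / (4 * (a ^+ 2 + 1)).
  by rewrite divr_gt0// mulr_gt0// ltr_wpDl// sqr_ge0.
have e4 : 0 < e / 4 by rewrite divr_gt0.
have [v Vv v1] := Hf _ C0; have [w Vw w1] := Hg _ e4.
exists (fun x => a * v x + w x); first exact: Vl.
have := q1_wtri EK muE a 1 (FdomB (FFd Ff) (VFd Vv)) (FdomB (FFd Fg) (VFd Vw)).
rewrite (_ : (fun x => a * (_ - _) + _) = (fun x => a * f x + g x - (a * v x + w x))); last first.
  by apply/funext => x; ring.
move=> /le_lt_trans; apply; rewrite expr1n mulr1.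
have : a ^+ 2 * q1 (fun x => f x - v x) <= e / 4.
  apply: (@le_trans _ _ ((a ^+ 2 + 1) * (e / (4 * (a ^+ 2 + 1))))).
    apply: ler_pM; rewrite ?sqr_ge0 ?lerDl ?(ltW v1)//.
    by rewrite q1E addr_ge0 ?nrm2_ge0// en_ge0//; apply: FdomB => //; [exact: FFd|exact: VFd].
  rewrite le_eqVlt; apply/orP; left; apply/eqP; field.
  by rewrite gt_eqF// ltr_wpDl// sqr_ge0.
by move: w1; lra.
Qed.

Lemma form_closure_ae : aeeq_closed form_closure.
Proof.
move=> f g [Ff Hf] mg fg; have Fg := Fae Ff mg fg; split=> // e e0.
have [v Vv v1] := Hf _ e0; exists v => //.
rewrite (q1_aeeq _ _ (_ : aeeq mu _ (fun x => f x - v x)))//.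
- by apply: Fdom_L2; apply: FdomB => //; [exact: FFd|exact: VFd].
- by apply: Fdom_L2; apply: FdomB => //; [exact: FFd|exact: VFd].
- by apply: ae_imp fg => x ->.
Qed.

Lemma form_closure_complete : form_complete form_closure.
Proof.
move=> u Hu uC; have [f [Ff fu]] := Fc (fun n => (Hu n).1) uC.
exists f; split=> //; split=> // e e0.
have e4 : 0 < e / 4 by rewrite divr_gt0.
have [N HN] := fu _ e4.
have [Fu Hv] := Hu N; have [v Vv v1] := Hv _ e4.
exists v => //.
have := q1_tri3 EK muE (FFd Ff) (VFd Vv) (FFd Fu); have := HN N (leqnn N).
rewrite (q1_sub_sym EK muE (FFd Ff) (FFd Fu)) (q1_sub_sym EK muE (VFd Vv) (FFd Fu)).
by move: v1; lra.
Qed.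

(** In [en_wtri] with weight c, the surplus c * en f takes one half of e, and the distance d is then
    chosen so that (1 + c^-1) * d is the other half. *)
Lemma form_closure_en f (e : R) : form_closure f -> 0 < e ->
  exists v, [/\ V v, en v <= en f + e & q1 (fun x => f x - v x) < e].
Proof.
move=> [Ff Hf] e0; have Ffd := FFd Ff; have ef := en_ge0 EK muE Ffd.
pose c := Num.min 1 (e / (2 * (en f + 1))).
have f1 : 0 < en f + 1 by lra.
have c0 : 0 < c by rewrite lt_min ltr01 divr_gt0// mulr_gt0.
have c1 : c * en f <= e / 2.
  apply: (@le_trans _ _ (e / (2 * (en f + 1)) * (en f + 1))).
    apply: ler_pM => //; [exact: ltW|by rewrite ge_min lexx orbT|by rewrite lerDl].
  by rewrite le_eqVlt; apply/orP; left; apply/eqP; field; rewrite gt_eqF.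
pose d := e / (2 * (1 + c^-1)).
have ci0 : 0 < c^-1 by rewrite invr_gt0.
have d0 : 0 < d by rewrite divr_gt0// mulr_gt0// addr_gt0.
have dE : (1 + c^-1) * d = e / 2.
  by rewrite /d; field; rewrite !gt_eqF//; lra.
have de : d <= e.
  by have : 0 <= c^-1 * d by [rewrite mulr_ge0 ?ltW]; move: dE; lra.
have [v Vv v1] := Hf _ d0; exists v; split=> //; last exact: lt_le_trans v1 de.
have Fv := VFd Vv; have := en_wtri EK muE 1 (-1) c0 Ffd (FdomB Ffd Fv).
rewrite (_ : (fun x => 1 * _ + _) = v); last by apply/funext => x; ring.
rewrite sqrrN expr1n !mulr1 => h.
have : (1 + c^-1) * en (fun x => f x - v x) <= (1 + c^-1) * d.
  rewrite ler_wpM2l ?addr_ge0 ?(ltW ci0)//.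
  by apply: le_trans (q1_en_le _) _; exact: ltW.
by rewrite dE; move: h c1; lra.
Qed.

Definition clip f x := Num.min (Num.max (f x) 0) 1.

Lemma clip_cases (u : R) : [\/ u <= 0 /\ Num.min (Num.max u 0) 1 = 0,
  0 <= u <= 1 /\ Num.min (Num.max u 0) 1 = u | 1 <= u /\ Num.min (Num.max u 0) 1 = 1].
Proof.
have [u0|/ltW u0] := leP u 0; first by apply: Or31; rewrite min_l ?ler01.
have [u1|/ltW u1] := leP u 1; [apply: Or32|apply: Or33]; split=> //.
by rewrite u0.
Qed.

Lemma clip_lip (s t : R) :
  `|Num.min (Num.max s 0) 1 - Num.min (Num.max t 0) 1| <= `|s - t|.
Proof.
wlog st : s t / t <= s => [H|].
  have [|/ltW] := leP t s; first exact: H.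
  by rewrite (distrC s) (distrC (Num.min _ _)); exact: H.
rewrite [leRHS]ger0_norm ?subr_ge0// ler_norml.
by have [[? ->]|[? ->]|[? ->]] := clip_cases s; have [[? ->]|[? ->]|[? ->]] := clip_cases t;
  apply/andP; split; lra.
Qed.

Lemma measurable_clip f : measurable_fun setT f -> measurable_fun setT (clip f).
Proof.
by move=> mf; apply: measurable_minr => //; apply: measurable_maxr.
Qed.

Lemma clip_L2 f : L2 mu f -> L2 mu (clip f).
Proof.
move=> [mf foo]; apply: (@le_sqi R mu setT measurableT (clip f) f) => //.
  exact: measurable_clip.
by move=> x _; have := clip_lip (f x) 0; rewrite /clip maxxx [Num.min 0 1]min_l ?ler01// !subr0.
Qed.

(** If v approximates f, then [clip v] approximates [clip f] in L2 because the contraction is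
    1-Lipschitz, and its energy is almost bounded by en f. [closure_of_bounded] needs no more than
    that. *)
Lemma form_closure_clip f : (forall v, V v -> V (clip v) /\ en (clip v) <= en v) ->
  form_closure f -> form_closure (clip f) /\ en (clip f) <= en f.
Proof.
move=> Vclip clf; have [Ff Hf] := clf; have Ffd := FFd Ff.
have K (d : R) : 0 < d -> form_closure (clip f) /\ en (clip f) <= en f + d.
  move=> d0; apply: closure_of_bounded; first by apply: clip_L2; exact: Fdom_L2 Ffd.
  move=> e e0; have md0 : 0 < Num.min d e by rewrite lt_min d0.
  have [v [Vv v1 v2]] := form_closure_en clf md0.
  have [Vcv cv] := Vclip v Vv; exists (clip v); split=> //.
    by apply: le_trans cv _; apply: le_trans v1 _; rewrite lerD2l ge_min lexx.
  apply: (@le_trans _ _ (nrm2 (fun x => f x - v x))); last first.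
    apply: le_trans (q1_nrm2_le (FdomB Ffd (VFd Vv))) _; apply: ltW.
    by apply: lt_le_trans v2 _; rewrite ge_min lexx orbT.
  have Lfv := Fdom_L2 (FdomB Ffd (VFd Vv)).
  apply: (@le_rip R mu setT measurableT) => //.
    by apply: measurable_funB; [case: (Fdom_L2 (VFd Vcv))|case: (clip_L2 (Fdom_L2 Ffd))].
  by move=> x _; rewrite distrC clip_lip.
split; first by case: (K 1 ltr01).
by apply/ler_addgt0Pr => d /K[].
Qed.

End Closure.

(** * Density of cores *)

(** The finite subcover property as an induction principle: a local property stable under subsets
    and binary unions holds on compact sets. It yields bounds, approximations and finite ranges
    below. *)
Lemma compact_ind (R : realType) (P : set R -> Prop) (K : set R) :
  compact K -> P set0 -> (forall A B, A `<=` B -> P B -> P A) ->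
  (forall A B, P A -> P B -> P (A `|` B)) ->
  (forall x, K x -> exists2 d : R, 0 < d & P (ball x d)) -> P K.
Proof.
move=> cK P0 Pm PU Ploc.
have [x|r Hr] := @choice R R (fun x d => K x -> 0 < d /\ P (ball x d)).
  have [Kx|nK] := pselect (K x); last by exists 0.
  by have [d d0 Pd] := Ploc x Kx; exists d.
move: cK; rewrite compact_cover => /(_ R K (fun x => ball x (r x))).
case=> [x Kx|x Kx|D' D'K cov].
- exact: ball_open.
- by exists x => //; apply: ballxx; exact: (Hr x Kx).1.
apply: (Pm _ _ cov); rewrite /cover bigcup_fset /=.
have H (s : seq R) : (forall x, x \in s -> K x) ->
    P (\big[setU/set0]_(x <- s) ball x (r x)).
  elim: s => [|x s IH] Ks; first by rewrite big_nil.
  rewrite big_cons; apply: PU; first by apply: (Hr x _).2; apply: Ks; rewrite mem_head.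
  by apply: IH => y ys; apply: Ks; rewrite in_cons ys orbT.
by apply: H => x xD; apply: set_mem; exact: D'K.
Qed.

(** * Uniform approximation by a core *)

Section CompactSupport.
Variables (R : realType) (E : set R).
Hypothesis EK : inK E.
Implicit Types (f g u v phi : R -> R) (x y c d : R).

Lemma cont_on_lip (theta : R -> R) f :
  (forall s t, `|theta s - theta t| <= `|s - t|) -> cont_on E f ->
  cont_on E (fun x => theta (f x)).
Proof.
move=> L cf x Ex e e0; have [d d0 H] := cf x Ex e e0; exists d => // y Ey xy.
exact: le_lt_trans (L _ _) (H y Ey xy).
Qed.

Lemma cont_onD f g : cont_on E f -> cont_on E g -> cont_on E (fun x => f x + g x).
Proof.
move=> cf cg x Ex e e0; have e2 : 0 < e / 2 by rewrite divr_gt0.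
have [d1 d10 H1] := cf x Ex _ e2; have [d2 d20 H2] := cg x Ex _ e2.
exists (Num.min d1 d2); first by rewrite lt_min d10.
move=> y Ey; rewrite lt_min => /andP[y1 y2].
rewrite (_ : f x + g x - _ = (f x - f y) + (g x - g y)); last by ring.
by rewrite (le_lt_trans (ler_normD _ _))// (splitr e) ltrD ?H1 ?H2.
Qed.

Lemma cont_onZ a f : cont_on E f -> cont_on E (fun x => a * f x).
Proof.
move=> cf x Ex e e0; have a0 : 0 < `|a| + 1 by rewrite ltr_wpDl.
have e2 : 0 < e / (`|a| + 1) by rewrite divr_gt0.
have [d d0 H] := cf x Ex _ e2; exists d => // y Ey /(H y Ey) h.
rewrite -mulrBr normrM; apply: (@le_lt_trans _ _ ((`|a| + 1) * `|f x - f y|)).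
  by rewrite ler_wpM2r// lerDl.
by rewrite mulrC -ltr_pdivlMr.
Qed.

Lemma CcP f : Cc E f <-> cont_on E f /\ exists K, [/\ compact K, K `<=` E &
  forall x, E x -> ~ K x -> f x = 0].
Proof.
split=> [[/cont_onP cf [K [cK [KE K0]]]]|[cf [K [cK KE K0]]]]; split=> //.
- by exists K.
- exact/cont_onP.
- by exists K.
Qed.

Lemma Cc_lip (theta : R -> R) f :
  (forall s t, `|theta s - theta t| <= `|s - t|) -> theta 0 = 0 -> Cc E f ->
  Cc E (fun x => theta (f x)).
Proof.
move=> L t0 /CcP[cf [K [cK KE K0]]]; apply/CcP; split; first exact: cont_on_lip.
by exists K; split=> // x Ex nK; rewrite K0.
Qed.

Lemma Cc_lin : linear_class (Cc E).
Proof.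
move=> a f g /CcP[cf [K [cK KE K0]]] /CcP[cg [K' [cK' KE' K0']]]; apply/CcP; split.
  by apply: cont_onD => //; exact: cont_onZ.
exists (K `|` K'); split.
- exact: compactU.
- by move=> x [/KE|/KE'].
- by move=> x Ex n; rewrite K0 ?K0' ?mulr0 ?addr0// => Kx; apply: n; [right|left].
Qed.

Lemma Cc_eq f g : (forall x, E x -> f x = g x) -> Cc E f -> Cc E g.
Proof.
move=> fg /CcP[cf [K [cK KE K0]]]; apply/CcP; split.
  move=> x Ex e e0; have [d d0 H] := cf x Ex e e0; exists d => // y Ey xy.
  by rewrite -!fg//; exact: H.
by exists K; split=> // x Ex nK; rewrite -fg// K0.
Qed.

Lemma Cc_clip f : Cc E f -> Cc E (clip f).
Proof.
apply: (Cc_lip (theta := fun s => Num.min (Num.max s 0) 1)); first exact: clip_lip.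
by rewrite maxxx min_l.
Qed.

Lemma Cc_bounded f : Cc E f -> exists2 M, 0 < M & forall x, E x -> `|f x| <= M.
Proof.
move=> /CcP[cf [K [cK KE K0]]].
have : exists2 M, 0 < M & forall x, E x -> K x -> `|f x| <= M.
  apply: (compact_ind (P := fun S => exists2 M : R, 0 < M & forall x, E x -> S x -> `|f x| <= M)) => //.
  - by exists 1.
  - by move=> A B AB [M M0 H]; exists M => // x Ex /AB; exact: H.
  - move=> A B [M M0 H] [N N0 H']; exists (M + N); first exact: addr_gt0.
    move=> x Ex [/(H x Ex)|/(H' x Ex)] /le_trans; apply; first by rewrite lerDl ltW.
    by rewrite lerDr ltW.
  - move=> x /KE Ex; have [d d0 H] := cf x Ex 1 ltr01; exists d => //.
    exists (`|f x| + 1); first by rewrite ltr_wpDl.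
    move=> y Ey /(H y Ey); rewrite distrC => /ltW h.
    rewrite (_ : f y = f x + (f y - f x)); last by ring.
    by rewrite (le_trans (ler_normD _ _))// lerD2l.
move=> [M M0 H]; exists M => // x Ex; have [Kx|nK] := pselect (K x); first exact: H.
by rewrite K0// normr0 ltW.
Qed.

Lemma E_compact a b : E a -> E b -> compact (E `&` `[a, b]).
Proof.
move=> Ea Eb; apply: (subclosed_compact _ (@segment_compact R a b)); last exact: subIsetr.
move=> c cl; have near0 (e : R) : 0 < e -> exists t, (E `&` `[a, b]) t /\ `|c - t| < e.
  move=> e0; have [t [Ht]] := cl _ (nbhsx_ballx c _ e0).
  by rewrite /ball /= => ct; exists t.
have cab : `[a, b]%classic c.
  apply: (closed_approx (compact_closed (@Rhausdorff R) (@segment_compact R a b))) => e.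
  by move=> /near0[t [[_ ?] ?]]; exists t.
split=> //; move: cab; rewrite /= in_itv/= => /andP[ac cb].
by apply: (E_closed_mid EK Ea Eb ac cb) => e /near0[t [[? _] ?]]; exists t.
Qed.

Variables V : set (R -> R).

(** A bump equal to 1 on a whole neighbourhood of x, and not only at x, so that finitely many of
    them handle a compact set. *)
Definition separating := forall x d, E x -> 0 < d -> exists phi,
  [/\ V phi, forall y, E y -> 0 <= phi y <= 1,
      exists2 d', 0 < d' & forall y, E y -> `|x - y| < d' -> phi y = 1 &
      forall y, E y -> d <= `|x - y| -> phi y = 0].

Hypotheses (Vl : linear_class V) (VC : V `<=` Cc E) (Vclip : forall v, V v -> V (clip v)).
Hypothesis Vsep : separating.

Lemma core0 : V (fun=> 0).
Proof.
have [x [_ [Ex _ _]]] := exists_lt EK.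
have [phi [Vphi _ _ _]] := Vsep Ex ltr01.
have := linear_classB Vl Vphi Vphi; by under eq_fun do rewrite subrr.
Qed.

(** The maximum is u plus the positive part of v - u, and that positive part is M * clip ((v - u) /
    M) as soon as M bounds |v - u| on E. *)
Lemma core_max u v : V u -> V v ->
  exists2 w, V w & forall x, E x -> w x = Num.max (u x) (v x).
Proof.
move=> Vu Vv; have Vd := linear_classB Vl Vv Vu.
have [M M0 HM] := Cc_bounded (VC Vd).
exists (fun x => M * clip (fun x => M^-1 * (v x - u x)) x + u x).
  by apply: Vl => //; apply: Vclip; exact: linear_classZ.
move=> x Ex; have := HM x Ex; rewrite ler_norml => /andP[h1 h2].
have i1 : M^-1 * (v x - u x) <= 1 by rewrite mulrC ler_pdivrMr// mul1r.
have Mi : M * (M^-1 * (v x - u x)) = v x - u x by rewrite mulrA mulfV ?mul1r ?gt_eqF.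
rewrite /clip; have [[a ->]|[a ->]|[a ->]] := clip_cases (M^-1 * (v x - u x)).
- rewrite mulr0 add0r max_l//; rewrite -subr_le0 -Mi.
  by rewrite pmulr_rle0.
- rewrite Mi subrK max_r// -subr_ge0 -Mi pmulr_rge0//; by case/andP: a.
- have e : M^-1 * (v x - u x) = 1 by apply/eqP; rewrite eq_le i1.
  rewrite -[in LHS]e Mi subrK max_r// -subr_ge0 -Mi e mulr1; exact: ltW.
Qed.

(** Near x a multiple of a bump, of height slightly below f x, stays under f everywhere and is
    within e of f close to x. Maxima glue these local minorants over the compact support. *)
Lemma core_approx_ge0 f (e : R) : Cc E f -> (forall x, E x -> 0 <= f x) -> 0 < e ->
  exists2 g, V g & forall x, E x -> 0 <= g x <= f x /\ f x - e <= g x.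
Proof.
move=> /CcP[cf [K [cK KE K0]]] f0 e0.
have : exists2 g, V g & forall x, E x -> 0 <= g x <= f x /\ (K x -> f x - e <= g x).
  apply: (compact_ind (P := fun S => exists2 g, V g &
    forall x, E x -> 0 <= g x <= f x /\ (S x -> f x - e <= g x))) => //.
  - by exists (fun=> 0); [exact: core0|move=> x Ex; rewrite lexx f0].
  - move=> A B AB [g Vg H]; exists g => // x /H[? h]; split=> // /AB; exact: h.
  - move=> A B [g Vg H] [g' Vg' H']; have [w Vw Hw] := core_max Vg Vg'.
    exists w => // x Ex; rewrite Hw//; have [/andP[g0 gf] gA] := H x Ex.
    have [/andP[g0' gf'] gB] := H' x Ex.
    split; first by rewrite le_max g0 ge_max gf.
    by rewrite le_max => -[/gA ->|/gB ->]; rewrite ?orbT.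
  - move=> x /KE Ex; have e2 : 0 < e / 2 by rewrite divr_gt0.
    have [d d0 Hd] := cf x Ex _ e2.
    have [phi [Vphi phi01 [d' d'0 phi1] phi0]] := Vsep Ex d0.
    pose c := Num.max (f x - e / 2) 0.
    have c0 : 0 <= c by rewrite le_max lexx orbT.
    exists (Num.min d d'); first by rewrite lt_min d0.
    exists (fun y => c * phi y); first exact: linear_classZ.
    move=> y Ey; have /andP[p0 p1] := phi01 y Ey; split; last first.
      rewrite /ball /= lt_min => /andP[yd yd']; rewrite phi1// mulr1.
      have := Hd y Ey yd; rewrite ltr_norml => /andP[h1 _].
      apply: (@le_trans _ _ (f x - e / 2)); first by lra.
      by rewrite le_max lexx.
    rewrite mulr_ge0//=; have [yd|dy] := ltP `|x - y| d; last by rewrite phi0// mulr0 f0.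
    apply: (@le_trans _ _ c); first by rewrite -[leRHS]mulr1 ler_wpM2l.
    rewrite ge_max f0// andbT; have := Hd y Ey yd; rewrite ltr_norml => /andP[_ h2].
    lra.
move=> [g Vg H]; exists g => // x Ex; have [h1 h2] := H x Ex; split=> //.
have [/h2//|/(K0 x Ex) ->] := pselect (K x).
by apply: le_trans (_ : 0 <= g x); [lra|case/andP: h1].
Qed.

Lemma Cc_pos f : Cc E f -> Cc E (fun x => Num.max (f x) 0).
Proof.
apply: (Cc_lip (theta := fun s => Num.max s 0)); last by rewrite maxxx.
move=> s t; have [s0|/ltW s0] := leP s 0; have [t0|/ltW t0] := leP t 0.
- by rewrite subrr normr0.
- by rewrite sub0r normrN ger0_norm// distrC ger0_norm; lra.
- by rewrite subr0 !ger0_norm; lra.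
- by [].
Qed.

Lemma core_approx f (e : R) : Cc E f -> 0 < e ->
  exists2 g, V g & forall x, E x -> `|f x - g x| < e.
Proof.
move=> Cf e0; have e2 : 0 < e / 2 by rewrite divr_gt0.
have Cn : Cc E (fun x => Num.max (- f x) 0).
  apply: Cc_pos; have := linear_classZ (-1) Cc_lin Cf.
  by under eq_fun do rewrite mulN1r.
have pos (s : R) : 0 <= Num.max s 0 by rewrite le_max lexx orbT.
have [g Vg Hg] := core_approx_ge0 (Cc_pos Cf) (fun x _ => pos (f x)) e2.
have [h Vh Hh] := core_approx_ge0 Cn (fun x _ => pos (- f x)) e2.
exists (fun x => g x - h x); first exact: linear_classB.
move=> x Ex; have [/andP[g0 g1] g2] := Hg x Ex; have [/andP[h0 h1] h2] := Hh x Ex.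
have -> : f x = Num.max (f x) 0 - Num.max (- f x) 0.
  have [f0|/ltW f0] := leP (f x) 0.
    by rewrite max_l ?oppr_ge0// sub0r opprK.
  by rewrite max_r ?oppr_le0// subr0.
rewrite ltr_norml; apply/andP; split; lra.
Qed.

End CompactSupport.

Lemma exhaust_left (R : realType) (A : set R) : A !=set0 ->
  exists c : nat -> R, (forall n, A (c n)) /\
    forall x, A x -> exists N, forall n, (N <= n)%N -> c n <= x.
Proof.
move=> A0; have [[m Am mA]|nmin] := pselect (exists2 m, A m & forall x, A x -> m <= x).
  by exists (fun=> m); split=> // x /mA mx; exists 0%N.
(* Thresholds decreasing to the lower end of A. Every point of A is eventually above them, since A
   has no minimum here. *)
pose t n : R := if pselect (has_lbound A) then inf A + n.+1%:R^-1 else - n%:R.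
have Ht n : exists c, A c /\ c <= t n.
  rewrite /t; case: pselect => [lb|nlb] /=.
    have [|c Ac /ltW ct] := @inf_adherent _ A n.+1%:R^-1 _ (conj A0 lb); first by rewrite invr_gt0.
    by exists c.
  apply: contrapT => H; apply: nlb; exists (- n%:R) => x Ax; rewrite leNgt; apply/negP => /ltW h.
  by apply: H; exists x.
have [c Hc] := choice Ht; exists c; split=> [n|x Ax]; first by case: (Hc n).
have [N HN] : exists N, forall n, (N <= n)%N -> t n <= x.
  rewrite /t; case: pselect => [lb|nlb] /=; last first.
    exists (Num.bound `|x|) => n Nn; have h := archi_boundP (normr_ge0 x).
    rewrite lerNl (le_trans (ler_norm _))// normrN; apply: ltW.
    by apply: lt_le_trans h _; rewrite ler_nat.
  have ix : inf A < x.
    rewrite lt_neqAle; apply/andP; split; last exact: ge_inf.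
    apply/eqP => e; apply: nmin; exists x => // y Ay; rewrite -e; exact: ge_inf.
  exists (Num.bound (x - inf A)^-1) => n Nn.
  rewrite -lerBrDl invf_ple ?posrE ?subr_gt0//; apply: ltW.
  apply: lt_le_trans (archi_boundP _) _; first by rewrite invr_ge0 subr_ge0 ltW.
  by rewrite ler_nat (leq_trans Nn).
by exists N => n Nn; apply: le_trans (HN n Nn); case: (Hc n).
Qed.

Lemma exhaust_right (R : realType) (A : set R) : A !=set0 ->
  exists c : nat -> R, (forall n, A (c n)) /\
    forall x, A x -> exists N, forall n, (N <= n)%N -> x <= c n.
Proof.
move=> [a Aa]; have [|c [Ac Hc]] := @exhaust_left R [set x | A (- x)].
  by exists (- a); rewrite /= opprK.
exists (fun n => - c n); split=> // x Ax; have [|N HN] := Hc (- x).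
  by rewrite /= opprK.
by exists N => n /HN; rewrite lerNr.
Qed.

Lemma ramp_left (R : realType) (E : set R) (a : R) : E a -> exists (rho : R -> R) c,
  [/\ measurable_fun setT rho, cont_on E rho, forall x, 0 <= rho x <= 1,
      forall x, a <= x -> rho x = 1 & [/\ E c, c <= a & forall x, E x -> x < c -> rho x = 0]].
Proof.
move=> Ea; have [amin|namin] := pselect (forall x, E x -> a <= x).
  exists (fun=> 1), a; split=> //; first by move=> x _ e e0; exists 1 => // y _ _; rewrite subrr normr0.
  - by move=> x; rewrite ler01 lexx.
  - by split=> // x /amin ax; rewrite ltNge ax.
have [c Ec ca] : exists2 c, E c & c < a.
  apply: contrapT => n; apply: namin => x Ex; rewrite leNgt; apply/negP => xa.
  by apply: n; exists x.
have k0 : 0 < a - c by rewrite subr_gt0.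
exists (clip (fun x => (a - c)^-1 * x + - ((a - c)^-1 * c))), c; split.
- by apply: measurable_clip; apply: measurable_funD => //; exact: measurable_funM.
- apply: (cont_on_lip (theta := fun s => Num.min (Num.max s 0) 1)); first exact: clip_lip.
  apply: cont_onD; last by move=> x _ e e0; exists 1 => // y _ _; rewrite subrr normr0.
  by apply: cont_onZ => x _ e e0; exists e.
- by move=> x; rewrite /clip; have [[_ ->]|[? ->]|[_ ->]] := clip_cases ((a - c)^-1 * x + - ((a - c)^-1 * c)) => //; rewrite ?lexx ?ler01.
- move=> x ax; rewrite /clip -mulrBr.
  have i1 : 1 <= (a - c)^-1 * (x - c) by rewrite mulrC ler_pdivlMr// mul1r lerB.
  have [[? _]|[? ->]|[? ->]] := clip_cases ((a - c)^-1 * (x - c)) => //; lra.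
- split=> //; first exact: ltW.
  move=> x _ xc; rewrite /clip -mulrBr.
  have i1 : (a - c)^-1 * (x - c) <= 0 by rewrite pmulr_rle0 ?invr_gt0// subr_le0 ltW.
  have [[? ->]|[? ->]|[? _]] := clip_cases ((a - c)^-1 * (x - c)) => //; lra.
Qed.

Lemma ramp_right (R : realType) (E : set R) (a : R) : E a -> exists (rho : R -> R) c,
  [/\ measurable_fun setT rho, cont_on E rho, forall x, 0 <= rho x <= 1,
      forall x, x <= a -> rho x = 1 & [/\ E c, a <= c & forall x, E x -> c < x -> rho x = 0]].
Proof.
move=> Ea; have [|rho [c [mr cr r01 r1 [Ec ca r0]]]] := @ramp_left R [set x | E (- x)] (- a).
  by rewrite /= opprK.
exists (fun x => rho (- x)), (- c); split=> //.
- by apply: (measurableT_comp mr); exact: oppr_measurable.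
- move=> x Ex e e0; have [|d d0 H] := cr (- x) _ e e0; first by rewrite /= opprK.
  exists d => // y Ey xy; apply: H; rewrite /= ?opprK//.
  by rewrite (_ : - x + y = - (x - y)) ?normrN//; ring.
- by move=> x xa; apply: r1; rewrite lerN2.
- split=> //; first by rewrite lerNr.
  by move=> x Ex cx; apply: r0; rewrite /= ?opprK// ltrNl.
Qed.

(** * Density of compactly supported continuous functions in L2 *)

Section Density.
Import HBNNSimple.
Variables (R : realType) (E : set R)
  (mu : {measure set (measurableTypeR R) -> \bar R}).
Hypothesis EK : inK E.
Hypothesis muE : radon_full E mu.
Notation nrm2 := (nrm2 mu).
Notation L2 := (L2 mu).
Implicit Types (f g h u v w : R -> R) (x y z a b : R).

Lemma bump_exists a b : E a -> E b -> exists w,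
  [/\ Cc E w, measurable_fun setT w, forall x, 0 <= w x <= 1 &
      forall x, a <= x <= b -> w x = 1].
Proof.
move=> Ea Eb.
have [p [c [mp cp p01 p1 [Ec ca p0]]]] := ramp_left Ea.
have [q [d [mq cq q01 q1 [Ed bd q0]]]] := ramp_right Eb.
(* After clipping, the sum minus 1 is 0 where either ramp vanishes and 1 where both are 1. *)
pose k x := p x + q x + -1; exists (clip k); split.
- apply/CcP; split.
    apply: (cont_on_lip (theta := fun s => Num.min (Num.max s 0) 1)); first exact: clip_lip.
    apply: cont_onD; first exact: cont_onD.
    by move=> x _ e e0; exists 1 => // y _ _; rewrite subrr normr0.
  exists (E `&` `[c, d]); split; [exact: E_compact|exact: subIsetl|].
  move=> x Ex nx; rewrite /clip /k; have /andP[p0' p1'] := p01 x; have /andP[q0' q1'] := q01 x.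
  have H : p x = 0 \/ q x = 0.
    have [xc|cx] := ltP x c; first by left; apply: p0.
    have [dx|xd] := ltP d x; first by right; apply: q0.
    by exfalso; apply: nx; split=> //=; rewrite in_itv/= cx.
  have [[? ->]|[? ->]|[? _]] := clip_cases (p x + q x + -1) => //; case: H => e; lra.
- by apply: measurable_clip; apply: measurable_funD => //; exact: measurable_funD.
- move=> x; rewrite /clip; have [[_ ->]|[? ->]|[_ ->]] := clip_cases (k x) => //; rewrite ?lexx ?ler01//.
- move=> x /andP[ax xb]; rewrite /clip /k p1// q1// addrK.
  by have [[? _]|[? ->]|[? ->]] := clip_cases (1 : R) => //; lra.
Qed.

Lemma L2_le_on f g : measurable_fun setT f -> (forall x, E x -> `|f x| <= `|g x|) ->
  L2 g -> L2 f.
Proof.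
move=> mf fg Lg; have mE := measurable_indic_E EK.
have mEf : measurable_fun setT (fun x => \1_E x * f x) by exact: measurable_funM.
have Lf : L2 (fun x => \1_E x * f x).
  apply: (@le_sqi R mu setT measurableT _ g) => // x _; rewrite normrM indicE.
  case: (boolP (x \in E)) => [/set_mem Ex|_]; first by rewrite normr1 mul1r fg.
  by rewrite normr0 mul0r.
apply: (@eq_sqi_ae R mu setT measurableT (fun x => \1_E x * f x)) => //.
have : aeeq mu (fun x => \1_E x * f x) f.
  by apply: (aeeq_on EK muE) => x Ex; rewrite indicE mem_set// mul1r.
by apply: ae_imp => x ->.
Qed.

Lemma Cc_L2 f : Cc E f -> measurable_fun setT f -> L2 f.
Proof.
move=> Cf mf; have [M M0 HM] := Cc_bounded Cf.
have [_ [K [cK KE K0]]] := (CcP E f).1 Cf.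
have mK : @measurable _ (measurableTypeR R) K.
  by apply: closed_measurable; apply: compact_closed => //; exact: Rhausdorff.
have mi : measurable_fun setT (fun x : R => M * \1_K x).
  by apply: measurable_funM.
apply: (@L2_le_on f (fun x => M * \1_K x)) => //.
  move=> x Ex; rewrite indicE; case: (boolP (x \in K)) => [_|/negP nK].
    by rewrite mulr1 (ger0_norm (ltW M0)) HM.
  by rewrite K0 ?normr0// => Kx; apply: nK; exact: mem_set.
split=> //; have [_ [fin _]] := muE.
rewrite (_ : (\int[mu]_x _)%E = (\int[mu]_(x in K) (M ^+ 2)%:E)%E); last first.
  rewrite [RHS]integral_mkcond; apply: eq_integral => x _; rewrite patchE indicE.
  by case: (_ \in _); rewrite ?mulr1// mulr0 expr0n.
rewrite integral_cst//.
by rewrite lte_mul_pinfty ?lee_fin ?sqr_ge0// fin.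
Qed.

Lemma L2_dominated (u : nat -> R -> R) f g : (forall n, measurable_fun setT (u n)) ->
  measurable_fun setT f -> L2 g -> (forall n x, E x -> `|u n x| <= `|g x|) ->
  (forall x, E x -> forall e : R, 0 < e -> exists N, forall n, (N <= n)%N -> `|u n x - f x| <= e) ->
  L2 f /\ forall e : R, 0 < e -> exists N, forall n, (N <= n)%N -> nrm2 (fun x => u n x - f x) < e.
Proof.
move=> mu_ mf Lg ug uf; have aeE : {ae mu, forall x, E x}.
  have := measure0_notin (measurableC (measurable_E EK)) muE.1.
  by apply: ae_imp => x nEx; exact: contrapT.
have fg x : E x -> `|f x| <= `|g x|.
  move=> Ex; apply/ler_addgt0Pr => e e0; have [N HN] := uf x Ex e e0.
  rewrite (_ : f x = u N x - (u N x - f x)); last by ring.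
  by rewrite (le_trans (ler_normB _ _))// lerD// ?ug// HN.
have Lf := L2_le_on mf fg Lg; split=> //.
have Lu n := L2_le_on (mu_ n) (ug n) Lg.
have Luf n : L2 (fun x => u n x - f x).
  exact: (@sqiB R mu setT measurableT _ _ (Lu n) Lf).
have := @dominated_convergence _ _ _ mu setT measurableT
  (fun n x => ((u n x - f x) ^+ 2)%:E) (cst 0%E) (fun x => ((2 * g x) ^+ 2)%:E).
case.
- by move=> n; apply/measurable_EFinP; apply: measurable_funX; case: (Luf n).
- exact: measurable_cst.
- apply: ae_imp aeE => x Ex _; apply/fine_cvgP; split; first exact: nearW.
  apply/cvgrPdist_le => e e0; have s0 : 0 < Num.sqrt e by rewrite sqrtr_gt0.
  have [N HN] := uf x Ex _ s0; exists N => // n /= /HN h.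
  rewrite sub0r normrN ger0_norm ?sqr_ge0// -[e]sqr_sqrtr ?(ltW e0)//.
  by rewrite -[leLHS]real_normK ?num_real// lerXn2r ?nnegrE// ltW.
- have Lg2 : sqi mu setT (fun x => 2 * g x) by exact: (@sqiZ R mu setT measurableT 2 g Lg).
  exact: (sqi_integrable_sqr Lg2).
- apply: ae_imp aeE => x Ex n _; rewrite /= lee_fin ger0_norm ?sqr_ge0//.
  rewrite -[leLHS]real_normK ?num_real// -[leRHS]real_normK ?num_real//.
  rewrite lerXn2r ?nnegrE//.
  rewrite (le_trans (ler_normB _ _))// normrM (ger0_norm (ler0n _ _)) mulr_natl mulr2n.
  by rewrite lerD ?ug// fg.
move=> _ _; rewrite integral0 => /fine_cvgP[_ /cvgrPdist_lt H] e e0.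
have [N _ HN] := H e e0; exists N => n /HN; rewrite /= sub0r normrN ger0_norm//.
by apply: fine_ge0; apply: integral_ge0 => x _; rewrite lee_fin sqr_ge0.
Qed.

Definition Cc_approx f := L2 f /\
  forall e : R, 0 < e -> exists g, [/\ Cc E g, L2 g & nrm2 (fun x => f x - g x) < e].

Lemma Cc_approx_lin : linear_class Cc_approx.
Proof.
move=> a f g [Lf Hf] [Lg Hg]; split.
  by apply: (@sqiD R mu setT) => //; exact: (@sqiZ R mu setT measurableT a f Lf).
move=> e e0; have C0 : 0 < a ^+ 2 + 1 by rewrite ltr_wpDl// sqr_ge0.
have ef : 0 < e / (4 * (a ^+ 2 + 1)) by rewrite divr_gt0// mulr_gt0.
have eg : 0 < e / 4 by rewrite divr_gt0.
have [f' [Cf Lf' ff]] := Hf _ ef; have [g' [Cg Lg' gg]] := Hg _ eg.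
exists (fun x => a * f' x + g' x); split; first exact: Cc_lin.
  by apply: (@sqiD R mu setT) => //; exact: (@sqiZ R mu setT measurableT a f' Lf').
have := nrm2_wtri a 1 (@sqiB R mu setT measurableT _ _ Lf Lf') (@sqiB R mu setT measurableT _ _ Lg Lg').
rewrite (_ : (fun x => a * (_ - _) + _) = (fun x => a * f x + g x - (a * f' x + g' x))); last first.
  by apply/funext => x; ring.
move=> /le_lt_trans; apply; rewrite expr1n mulr1.
have : a ^+ 2 * nrm2 (fun x => f x - f' x) <= e / 4.
  apply: (@le_trans _ _ ((a ^+ 2 + 1) * (e / (4 * (a ^+ 2 + 1))))).
    by apply: ler_pM; rewrite ?sqr_ge0 ?lerDl ?(ltW ff) ?nrm2_ge0.
  by rewrite le_eqVlt; apply/orP; left; apply/eqP; field; rewrite gt_eqF.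
lra.
Qed.

Lemma Cc_approx_dominated (u : nat -> R -> R) f g : (forall n, Cc_approx (u n)) ->
  measurable_fun setT f -> L2 g -> (forall n x, E x -> `|u n x| <= `|g x|) ->
  (forall x, E x -> forall e : R, 0 < e -> exists N, forall n, (N <= n)%N -> `|u n x - f x| <= e) ->
  Cc_approx f.
Proof.
move=> Hu mf Lg ug uf; have mu_ n : measurable_fun setT (u n) by case: (Hu n) => -[].
have [Lf H] := L2_dominated mu_ mf Lg ug uf; split=> // e e0.
have e4 : 0 < e / 4 by rewrite divr_gt0.
have [N HN] := H _ e4; have [Lu Hn] := Hu N; have [h [Ch Lh h1]] := Hn _ e4.
exists h; split=> //; have := nrm2_tri3 Lf Lh Lu.
rewrite (nrm2_sub_sym mu f (u N)) (nrm2_sub_sym mu h (u N)).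
by have := HN N (leqnn N); lra.
Qed.

(** [borel_ind] applied with the weight w: the indicator of a ray is a limit of steep ramps,
    complements are differences from w, and unions are limits of partial sums dominated by w. The
    weight provides the compact support and the dominating function. *)
Lemma Cc_approx_indic w : Cc E w -> measurable_fun setT w ->
  forall A : set (measurableTypeR R), measurable A -> Cc_approx (fun x => w x * \1_A x).
Proof.
move=> Cw mw; have Lw := Cc_L2 Cw mw.
have base h : Cc E h -> measurable_fun setT h -> Cc_approx h.
  move=> Ch mh; split; first exact: Cc_L2.
  move=> e e0; exists h; split=> //; first exact: Cc_L2.
  rewrite /nrm2 /ip; under eq_Rintegral do rewrite subrr mul0r.
  by rewrite Rintegral_cst// mul0r.
have mI (A : set (measurableTypeR R)) : measurable A ->
    measurable_fun setT (fun x : R => w x * \1_A x).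
  by move=> mA; apply: measurable_funM.
have le1 (A : set R) x : `|w x * \1_A x| <= `|w x|.
  by rewrite normrM indicE; case: (_ \in _); rewrite ?normr1 ?mulr1// normr0 mulr0.
apply: borel_ind => [|t|S mS HS|F mF tF HF].
- by under eq_fun do rewrite indicT mulr1; exact: base.
- pose u n x := w x * clip (fun x => n%:R * (x - t)) x.
  have c01 n x : 0 <= clip (fun x => n%:R * (x - t)) x <= 1.
    by rewrite /clip; have [[_ ->]|[? ->]|[_ ->]] := clip_cases (n%:R * (x - t)); rewrite ?lexx ?ler01.
  have [Mw Mw0 HMw] := Cc_bounded Cw.
  apply: (@Cc_approx_dominated u _ w) => //.
  + move=> n; apply: base.
      apply/CcP; have [cw [K [cK KE K0]]] := (CcP E w).1 Cw; split; last first.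
        by exists K; split=> // x Ex nK; rewrite /u K0// mul0r.
      have cc : cont_on E (clip (fun x => n%:R * (x - t))).
        apply: (cont_on_lip (theta := fun s => Num.min (Num.max s 0) 1)); first exact: clip_lip.
        apply: cont_onZ => x _ e e0; exists e => // y _.
        by rewrite (_ : x - t - (y - t) = x - y)//; ring.
      move=> x Ex e e0; have e2 : 0 < e / 2 by rewrite divr_gt0.
      have eM : 0 < e / 2 / Mw by rewrite divr_gt0.
      have [d1 d10 H1] := cw x Ex _ e2; have [d2 d20 H2] := cc x Ex _ eM.
      exists (Num.min d1 d2); first by rewrite lt_min d10.
      move=> y Ey; rewrite lt_min => /andP[y1 y2]; rewrite /u.
      set cx := clip _ x; set cy := clip _ y.
      rewrite (_ : w x * cx - w y * cy = (w x - w y) * cx + w y * (cx - cy)); last by ring.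
      have := H1 y Ey y1; have := H2 y Ey y2; rewrite -/cx -/cy ltr_pdivlMr// => h2 h1.
      have /andP[cx0 cx1] : 0 <= cx <= 1 by exact: c01.
      rewrite (le_lt_trans (ler_normD _ _))// !normrM (ger0_norm cx0) (splitr e) ltr_leD//.
        by apply: le_lt_trans h1; rewrite -[leRHS]mulr1 ler_wpM2l.
      by apply: le_trans (ltW h2); rewrite mulrC ler_wpM2l// HMw.
    apply: measurable_funM => //; apply: measurable_clip; apply: measurable_funM => //.
    exact: measurable_funB.
  + exact: mI.
  + move=> n x _; rewrite /u normrM; have /andP[c0 c1] := c01 n x.
    by rewrite (ger0_norm c0) -[leRHS]mulr1 ler_wpM2l.
  + move=> x _ e e0; rewrite indicE; have [xt|tx] := leP x t.
      exists 0%N => n _; rewrite /u memNset ?mulr0; last first.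
        by rewrite /= in_itv/= andbT ltNge xt.
      rewrite /clip; have h : n%:R * (x - t) <= 0 by rewrite mulr_ge0_le0// subr_le0.
      have -> : Num.min (Num.max (n%:R * (x - t)) 0) 1 = 0.
        by have [[? ->]|[? ->]|[? _]] := clip_cases (n%:R * (x - t)) => //; lra.
      by rewrite mulr0 subrr normr0 ltW.
    exists (Num.bound (x - t)^-1) => n Nn; rewrite /u mem_set ?mulr1; last first.
      by rewrite /= in_itv/= tx.
    have xt0 : 0 < x - t by rewrite subr_gt0.
    have h : 1 <= n%:R * (x - t).
      rewrite -ler_pdivrMr// div1r; apply: ltW; apply: lt_le_trans (archi_boundP _) _.
        by rewrite invr_ge0 ltW.
      by rewrite ler_nat.
    rewrite /clip; have -> : Num.min (Num.max (n%:R * (x - t)) 0) 1 = 1.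
      by have [[? _]|[? ->]|[? ->]] := clip_cases (n%:R * (x - t)) => //; lra.
    by rewrite mulr1 subrr normr0 ltW.
- have := Cc_approx_lin (-1) HS (base w Cw mw); congr Cc_approx; apply/funext => x.
  rewrite !indicE in_setC; case: (_ \in _) => /=; ring.
- pose A n := \big[setU/set0]_(k < n) F k.
  have mA n : @measurable _ (measurableTypeR R) (A n) by apply: bigsetU_measurable.
  apply: (@Cc_approx_dominated (fun n x => w x * \1_(A n) x) _ w) => //.
  + elim=> [|n IH].
      have := linear_classZ 0 Cc_approx_lin (base w Cw mw); congr Cc_approx; apply/funext => x.
      by rewrite /A big_ord0 indicE in_set0 mul0r mulr0.
    have := Cc_approx_lin 1 IH (HF n); congr Cc_approx; apply/funext => x.
    rewrite mul1r -mulrDr; congr (_ * _); rewrite /A big_ord_recr /= -/(A n) !indicE in_setU.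
    case: (boolP (x \in A n)) => [/set_mem|_] /=; last by rewrite add0r.
    rewrite /A -bigcup_mkord => -[k /= kn Fk]; rewrite memNset ?addr0// => Fn.
    have kE : k = n by apply: (tF k n I I); exists x.
    by rewrite kE ltnn in kn.
  + by apply: mI; exact: bigcup_measurable.
  + move=> x _ e e0; have [[k _ Fk]|nF] := pselect ((\bigcup_k F k) x).
      exists k.+1 => n kn; rewrite !indicE !mem_set; [by rewrite subrr normr0 ltW|by exists k|].
      by rewrite /A -bigcup_mkord; exists k.
    exists 0%N => n _; rewrite !indicE !memNset ?subrr ?normr0 ?(ltW e0)//.
    by rewrite /A -bigcup_mkord => -[k _ Fk]; apply: nF; exists k.
Qed.

(** A nonnegative f is the dominated limit of [w n * g n], where the [g n] are simple functions
    below f and the bumps [w n] are 1 on intervals exhausting E. Each product is a finite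
    combination of functions covered by [Cc_approx_indic]. *)
Lemma Cc_L2_dense f : L2 f -> Cc_approx f.
Proof.
move=> Lf; wlog f0 : f Lf / forall x, 0 <= f x => [H|].
  have mf := Lf.1; have pos (s : R) : 0 <= Num.max s 0 by rewrite le_max lexx orbT.
  have Lp : L2 (fun x => Num.max (f x) 0).
    apply: (@le_sqi R mu setT measurableT _ f) => //; first exact: measurable_maxr.
    move=> x _; rewrite ger0_norm//; have [f0|f0] := leP (f x) 0; first exact: normr_ge0.
    by rewrite ger0_norm// ltW.
  have Ln : L2 (fun x => Num.max (- f x) 0).
    apply: (@le_sqi R mu setT measurableT _ f) => //.
      by apply: measurable_maxr => //; exact: measurableT_comp.
    move=> x _; rewrite ger0_norm//; have [f0|f0] := leP (- f x) 0; first exact: normr_ge0.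
    by rewrite -normrN ger0_norm// ltW.
  have := linear_classB Cc_approx_lin (H _ Lp (fun=> pos _)) (H _ Ln (fun=> pos _)).
  congr Cc_approx; apply/funext => x; have [f0|/ltW f0] := leP (f x) 0.
    by rewrite max_l ?oppr_ge0// sub0r opprK.
  by rewrite max_r ?oppr_le0// subr0.
have [x0 [_ [Ex0 _ _]]] := exists_lt EK; have E0 : E !=set0 by exists x0.
have [c [Ec Hc]] := exhaust_left E0; have [d [Ed Hd]] := exhaust_right E0.
have [w Hw] := choice (fun n => bump_exists (Ec n) (Ed n)).
have mf : measurable_fun setT (fun x : measurableTypeR R => (f x)%:E).
  by apply/measurable_EFinP; case: Lf.
have [g [ndg gf]] := approximation measurableT mf (fun x _ => f0 x).
have gle n x : 0 <= g n x <= f x.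
  rewrite fun_ge0/=; have /fine_cvgP[_ cg] := gf x I.
  have nd : nondecreasing_seq (fun k => g k x).
    by move=> i j ij; exact: (lefP _ _ (ndg _ _ ij)).
  have := nondecreasing_cvgn_le nd (cvgP _ cg) n.
  by rewrite (_ : limn _ = f x)//; apply: cvg_lim.
apply: (@Cc_approx_dominated (fun n x => w n x * g n x) _ f) => //; last 2 first.
- move=> n x _; have [_ _ w01 _] := Hw n; have /andP[w0 w1] := w01 x.
  have /andP[g0 g1] := gle n x; rewrite normrM !ger0_norm//.
  by apply: le_trans g1; rewrite -[leRHS]mul1r ler_wpM2r.
- move=> x Ex e e0; have [N1 H1] := Hc x Ex; have [N2 H2] := Hd x Ex.
  have := gf x I => /fine_cvgP[_ /cvgrPdist_le/(_ e e0)[N3 _ H3]].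
  exists (maxn N3 (maxn N1 N2)) => n; rewrite !geq_max => /and3P[n3 n1 n2].
  have [_ _ _ w1] := Hw n; rewrite w1 ?H1 ?H2// mul1r distrC; exact: H3.
- move=> n; have [Cw mw _ _] := Hw n.
  have K m (t : nat -> R) (B : nat -> set (measurableTypeR R)) : (forall i, measurable (B i)) ->
      Cc_approx (fun x => \sum_(i < m) w n x * (t i * \1_(B i) x)).
    move=> mB; elim: m => [|m IH].
      have := linear_classZ 0 Cc_approx_lin (Cc_approx_indic Cw mw measurableT).
      by congr Cc_approx; apply/funext => x; rewrite big_ord0 mul0r.
    have := Cc_approx_lin (t m) (Cc_approx_indic Cw mw (mB m)) IH.
    by congr Cc_approx; apply/funext => x; rewrite big_ord_recr /=; ring.
  pose s := finmap.enum_fset (fset_set (range (g n))).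
  have mB i : @measurable _ (measurableTypeR R) (g n @^-1` [set s`_i]) by exact: measurable_sfunP.
  have := K (size s) (fun i => s`_i) _ mB; congr Cc_approx; apply/funext => x.
  by rewrite (fimfunEord (g n)) mulr_sumr.
- by case: Lf.
Qed.

End Density.

(** * The closure of a core is a Fukushima subspace *)

Section ClosureFukushima.
Variables (R : realType) (E : set R)
  (mu : {measure set (measurableTypeR R) -> \bar R}).
Hypothesis EK : inK E.
Hypothesis muE : radon_full E mu.
Notation Fd := (Fdom E mu).
Notation en := (en E mu).
Notation nrm2 := (nrm2 mu).
Notation L2 := (L2 mu).
Implicit Types (f g h u v w : R -> R) (x y z a b : R).

Variables F V : set (R -> R).
Hypotheses (FFd : F `<=` Fd) (Fl : linear_class F) (Fae : aeeq_closed mu F)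
  (Fc : form_complete E mu F) (VF : V `<=` F) (Vl : linear_class V)
  (VC : V `<=` Cc E) (Vclip : forall v, V v -> V (clip v) /\ en (clip v) <= en v)
  (Vsep : separating E V).

Let VL2 v : V v -> L2 v. Proof. by move=> /VF /FFd []. Qed.

(** Uniform closeness does not bound the L2 distance when mu is infinite; approximants kept between
    0 and g are dominated by g itself. *)
Lemma core_L2_ge0 g (e : R) : Cc E g -> measurable_fun setT g -> (forall x, 0 <= g x) ->
  0 < e -> exists2 h, V h & nrm2 (fun x => h x - g x) < e.
Proof.
move=> Cg mg g0 e0.
have K n : exists h, V h /\ forall x, E x -> 0 <= h x <= g x /\ g x - n.+1%:R^-1 <= h x.
  have [|h Vh Hh] := @core_approx_ge0 R E EK V Vl VC (fun v Vv => (Vclip Vv).1) Vsep g n.+1%:R^-1 Cg (fun x _ => g0 x).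
    by rewrite invr_gt0.
  by exists h.
have [h Hh] := choice K.
have [|//|||x Ex e' e'0|Lg /(_ e e0)[N HN]] := @L2_dominated R E mu EK muE h g g.
- by move=> n; have [/VL2[]] := Hh n.
- exact: Cc_L2 Cg mg.
- move=> n x Ex; have [_ H] := Hh n; have [/andP[h0 h1] _] := H x Ex.
  by rewrite !ger0_norm.
- exists (Num.bound e'^-1) => n Nn; have [_ H] := Hh n; have [/andP[h0 h1] h2] := H x Ex.
  rewrite distrC ger0_norm ?subr_ge0//; apply: (@le_trans _ _ n.+1%:R^-1).
    by rewrite lerBlDr addrC -lerBlDr.
  rewrite invf_ple ?posrE//; apply: ltW; apply: lt_le_trans (archi_boundP _) _.
    by rewrite invr_ge0 ltW.
  by rewrite ler_nat (leq_trans Nn).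
by exists (h N); [case: (Hh N)|exact: HN].
Qed.

Lemma core_L2_dense f (e : R) : L2 f -> 0 < e ->
  exists2 h, V h & nrm2 (fun x => f x - h x) < e.
Proof.
move=> Lf e0; have e16 : 0 < e / 16 by rewrite divr_gt0.
have [_ /(_ _ e16)[g [Cg Lg fg]]] := Cc_L2_dense EK muE Lf.
have mg := Lg.1.
have Cn : Cc E (fun x => Num.max (- g x) 0).
  apply: Cc_pos; have := linear_classZ (-1) (@Cc_lin R E) Cg.
  by under eq_fun do rewrite mulN1r.
have pos (s : R) : 0 <= Num.max s 0 by rewrite le_max lexx orbT.
have mp : measurable_fun setT (fun x => Num.max (g x) 0) by exact: measurable_maxr.
have mn : measurable_fun setT (fun x => Num.max (- g x) 0).
  by apply: measurable_maxr => //; exact: measurableT_comp.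
have [h1 Vh1 H1] := core_L2_ge0 (Cc_pos Cg) mp (fun=> pos _) e16.
have [h2 Vh2 H2] := core_L2_ge0 Cn mn (fun=> pos _) e16.
have Vh := linear_classB Vl Vh1 Vh2; exists (fun x => h1 x - h2 x) => //.
have Lp := Cc_L2 EK muE (Cc_pos Cg) mp; have Ln := Cc_L2 EK muE Cn mn.
have := nrm2_wtri 1 (-1) (@sqiB R mu setT measurableT _ _ (VL2 Vh1) Lp)
  (@sqiB R mu setT measurableT _ _ (VL2 Vh2) Ln).
rewrite (_ : (fun x => 1 * _ + _) = (fun x => (h1 x - h2 x) - g x)); last first.
  apply/funext => x; have [g0|/ltW g0] := leP (g x) 0.
    by rewrite max_l ?oppr_ge0//; ring.
  by rewrite max_r ?oppr_le0//; ring.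
have := nrm2_tri3 Lf (VL2 Vh) Lg; rewrite /= sqrrN expr1n; lra.
Qed.

(** Density and regularity come from the core V, completeness from F, the contraction from
    [form_closure_clip], and the algebraic axioms from the ambient domain. *)
Lemma form_closure_fukushima : fukushima E mu (form_closure E mu F V).
Proof.
have clF : form_closure E mu F V `<=` F by move=> f [].
have clFd : form_closure E mu F V `<=` Fd by move=> f /clF /FFd.
have VclV v : V v -> form_closure E mu F V v.
  move=> Vv; split; first exact: VF.
  move=> e e0; exists v => //; have Fv := FFd (VF Vv).
  have := q1_wtri EK muE 0 0 Fv Fv.
  rewrite (_ : (fun x => 0 * _ + _) = (fun x => v x - v x)); last by apply/funext => x; ring.
  by rewrite expr0n /= mulr0 !mul0r addr0 => /le_lt_trans; apply.
have cll := form_closure_lin EK muE FFd Fl VF Vl.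
have core f (e : R) : Cc E f -> 0 < e -> exists2 g, V g & forall x, E x -> `|f x - g x| < e.
  by move=> Cf e0; exact: (core_approx EK Vl VC (fun v Vv => (Vclip Vv).1) Vsep Cf e0).
have cl0 := core0 EK Vl Vsep.
split=> //; split; first by move=> f /clFd [].
split; first by exact: (form_closure_ae FFd Fae VF).
split; first by exact: VclV.
split; first by move=> f g; exact: linear_classD.
split; first by move=> a f; exact: linear_classZ.
split.
  move=> f Lf e e0; have [h Vh Hh] := core_L2_dense Lf e0; exists h; split=> //; exact: VclV.
split; first by move=> f g /clFd Ff /clFd Fg; exact: (EformC EK muE Ff Fg).
split; first by move=> f /clFd Ff; exact: (Eform_ge0 EK muE Ff).
split; first by move=> a f g h /clFd Ff /clFd Fg /clFd Fh; exact: (EformZD EK muE a Ff Fg Fh).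
split; first by exact: (form_closure_complete EK muE FFd Fc VF).
split; first by move=> f clf g; exact: (form_closure_clip EK muE FFd Fae Fc VF Vl Vclip clf).
split; last first.
  move=> f Cf e e0; have [g Vg Hg] := core f e Cf e0; exists g, g; split; first exact: VclV.
  by split; [exact: VC|split=> //; exact: ae_all].
move=> f [Ff Hf] e e0; have [v Vv v1] := Hf e e0; exists v; split; first exact: VclV.
by split=> //; exists v; split; [exact: VC|exact: ae_all].
Qed.

End ClosureFukushima.

(** * Point evaluation is bounded in the form norm *)

Section PointEvaluation.
Variables (R : realType) (E : set R)
  (mu : {measure set (measurableTypeR R) -> \bar R}).
Hypothesis EK : inK E.
Hypothesis muE : radon_full E mu.
Notation lam := (leb R).
Notation OI := (openI E).
Notation Fd := (Fdom E mu).
Notation en := (en E mu).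
Notation nrm2 := (nrm2 mu).
Notation L2 := (L2 mu).
Implicit Types (f g h u v w : R -> R) (x y z a b d : R).

Lemma Rintegral_itv_split_E h x y : lam.-integrable `[x, y] (EFin \o h) ->
  Rintegral lam `[x, y] h = Rintegral lam (`[x, y] `&` E) h + Rintegral lam (`[x, y] `\` E) h.
Proof.
have mE := measurable_E EK => jf; rewrite -Rintegral_setU ?setUIDK//.
- by apply: measurableI => //; exact: mitvcc.
- by apply: measurableD => //; exact: mitvcc.
- by apply/disj_setPS => t [[_ Et] [_ /(_ Et)]].
Qed.

Lemma Rintegral_itv_oo h x y : measurable_fun setT h ->
  Rintegral lam `]x, y[ h = Rintegral lam `[x, y] h.
Proof.
move=> mh; congr fine; rewrite (@integral_itv_bndoo R x y _ true false)//.
by apply/measurable_EFinP; exact: measurable_funS mh.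
Qed.

Lemma slope_itv_gap u p : gaps E p -> Rintegral lam `]p.1, p.2[ (slope E u) = u p.2 - u p.1.
Proof.
move=> gp; have [p12 _] := gp.
rewrite /Rintegral (eq_integral (fun=> ((u p.2 - u p.1) / (p.2 - p.1))%:E)); last first.
  by move=> x; rewrite inE/= in_itv/= => xp; rewrite (slope_gap _ gp xp).
by rewrite (gap_measure _ gp)/= divfK// subr_eq0 gt_eqF.
Qed.

(** On E the functions h and [der] agree, and over every gap between x and y they have the same
    integral. *)
Lemma adm_der_itv g h x y : adm E g h -> E x -> E y -> x <= y ->
  g y - g x = Rintegral lam `[x, y] (der E (g, h)).
Proof.
move=> A Ex Ey xy; have [Ix Iy] := (E_Iset Ex, E_Iset Ey).
rewrite (adm_itv A Ix Iy xy).
have sh := adm_sqi A; have ss := sqi_slope EK A; have sd := sqi_der EK A.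
have ih := sqi_integrable_itv (sqi_OI_itv Ix Iy sh).
have is_ := sqi_integrable_itv (sqi_OI_itv Ix Iy ss).
have id_ := sqi_integrable_itv (sqi_OI_itv Ix Iy sd).
rewrite !Rintegral_itv_split_E//; congr (_ + _).
  by apply: eq_Rintegral => t; rewrite inE => -[_ Et]; exact: esym (der_E (g, h) Et).
rewrite (Rintegral_gaps_eq EK Ex Ey ih is_).
  by apply: eq_Rintegral => t; rewrite inE => -[_ nEt]; exact: esym (der_notE (g, h) nEt).
move=> p gp xp py; have [p12 [E1 [E2 _]]] := gp.
rewrite slope_itv_gap// Rintegral_itv_oo; last by case: sh.
by rewrite -(adm_itv A (E_Iset E1) (E_Iset E2) (ltW p12)).
Qed.

Lemma der_holder g h x y : adm E g h -> E x -> E y ->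
  (g x - g y) ^+ 2 <= `|x - y| * rip lam OI (der E (g, h)) (der E (g, h)).
Proof.
move=> A Ex Ey; wlog xy : x y Ex Ey / x <= y => [H|].
  have [xy|/ltW yx] := leP x y; first exact: H.
  by rewrite distrC -sqrrN opprB; exact: H.
rewrite -sqrrN opprB (adm_der_itv A Ex Ey xy) distrC ger0_norm ?subr_ge0//.
by apply: holder_OI => //; [exact: E_Iset|exact: E_Iset|exact: sqi_der].
Qed.

Lemma en_der f g h : adm E g h -> aeeq mu f g ->
  rip lam OI (der E (g, h)) (der E (g, h)) = 2 * en f.
Proof.
by move=> A fg; rewrite /en (Eform_der EK muE A fg A fg) mulrA mulfV ?mul1r.
Qed.

(** If x has points of E on a given side, one of them bounds K there; if not, x itself does, and the
    room 1 on that side is arbitrary because E has no point in it. *)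
Lemma local_compact x : E x -> exists d K a b,
  [/\ 0 < d, compact K, K `<=` E, forall y, E y -> `|x - y| <= d -> K y &
      [/\ E a, E b, a <= x <= b, a <= x - d \/ (forall y, E y -> a <= y) &
          x + d <= b \/ (forall y, E y -> y <= b)]].
Proof.
move=> Ex.
have [a [Ea ax al]] : exists a, [/\ E a, a <= x & a < x \/ (a = x /\ forall y, E y -> a <= y)].
  have [xm|nm] := pselect (forall y, E y -> x <= y); first by exists x; split=> //; right.
  apply: contrapT => n; apply: nm => y Ey; rewrite leNgt; apply/negP => yx.
  by apply: n; exists y; split=> //; [exact: ltW|left].
have [b [Eb xb br]] : exists b, [/\ E b, x <= b & x < b \/ (b = x /\ forall y, E y -> y <= b)].
  have [xm|nm] := pselect (forall y, E y -> y <= x); first by exists x; split=> //; right.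
  apply: contrapT => n; apply: nm => y Ey; rewrite leNgt; apply/negP => yx.
  by apply: n; exists y; split=> //; [exact: ltW|left].
pose da := if a < x then x - a else 1; pose db := if x < b then b - x else 1.
have da0 : 0 < da by rewrite /da; case: ifP => // h; rewrite subr_gt0.
have db0 : 0 < db by rewrite /db; case: ifP => // h; rewrite subr_gt0.
exists (Num.min da db), (E `&` `[a, b]), a, b; split.
- by rewrite lt_min da0.
- exact: E_compact.
- exact: subIsetl.
- move=> y Ey; rewrite le_min => /andP[]; rewrite !ler_norml => /andP[_ h1] /andP[h2 _].
  split=> //=; rewrite in_itv/=; apply/andP; split.
    by case: al => [ax'|[_ /(_ y Ey)]//]; move: h1; rewrite /da ax'; lra.
  by case: br => [xb'|[_ /(_ y Ey)]//]; move: h2; rewrite /db xb'; lra.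
- split=> //; first by rewrite ax.
    case: al => [ax'|[_ H]]; [left|by right].
    have : Num.min da db <= da by rewrite ge_min lexx.
    by rewrite {2}/da ax'; lra.
  case: br => [xb'|[_ H]]; [left|by right].
  have : Num.min da db <= db by rewrite ge_min lexx orbT.
  by rewrite {2}/db xb'; lra.
Qed.

(** For t in E within distance 1 of x, [der_holder] gives g(x)^2 <= 2 g(t)^2 + 4 en f. Averaging
    over a neighbourhood of finite positive mass m turns g(t)^2 into the L2 norm and gives C = 2 / m
    + 4. *)
Lemma eval_bound x : E x -> exists2 C, 0 < C & forall f g h, Fd f -> adm E g h -> aeeq mu f g ->
  g x ^+ 2 <= C * q1 E mu f.
Proof.
move=> Ex; have [d [K [_ [_ [d0 cK KE Kd _]]]]] := local_compact Ex.
pose r := Num.min d 1; have r0 : 0 < r by rewrite lt_min d0 ltr01.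
pose U := ball x r; have mU : @measurable _ (measurableTypeR R) U.
  by apply: open_measurable; exact: ball_open.
have [mE [fin pos]] := muE.
have mK : @measurable _ (measurableTypeR R) K.
  by apply: closed_measurable; apply: compact_closed => //; exact: Rhausdorff.
have mUE : @measurable _ (measurableTypeR R) (U `&` E).
  by apply: measurableI => //; exact: measurable_E.
have UK : U `&` E `<=` K.
  move=> y [Uy Ey]; apply: Kd => //; apply: ltW; apply: lt_le_trans Uy _.
  by rewrite /r ge_min lexx.
have mfin : (mu (U `&` E) < +oo)%E.
  by apply: le_lt_trans (fin K cK KE); apply: le_measure; rewrite ?inE.
have mpos : (0 < mu (U `&` E))%E.
  have : (0 < mu U)%E.
    by apply: pos; [exact: ball_open|exists x; split=> //; exact: ballxx].
  rewrite (_ : mu U = mu (U `&` E))//; apply/eqP; rewrite eq_le; apply/andP; split; last first.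
    by apply: le_measure; rewrite ?inE//; exact: subIsetl.
  have mEc := measurableC (measurable_E EK).
  rewrite -[X in mu X](setUIDK U E); apply: le_trans (measureU2 _ _ _) _ => //.
    by apply: measurableD => //; exact: measurable_E.
  rewrite -[leRHS]adde0 leeD2l// -mE; apply: le_measure; rewrite ?inE//.
    by apply: measurableD => //; exact: measurable_E.
pose m := fine (mu (U `&` E)).
have m0 : 0 < m by rewrite fine_gt0// mpos.
exists (2 / m + 4); first by rewrite addr_gt0// divr_gt0.
move=> f g h Ff A fg; have ef := en_ge0 EK muE Ff.
have Lf := Fdom_L2 Ff.
pose c := g x ^+ 2 - 4 * en f.
have key : c * m <= 2 * nrm2 f.
  have [c0|c0] := leP c 0.
    by apply: (@le_trans _ _ 0); [rewrite mulr_le0_ge0// ltW|rewrite mulr_ge0// nrm2_ge0].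
  have -> : c * m = Rintegral mu (U `&` E) (fun=> c) by rewrite Rintegral_cst.
  have iL : mu.-integrable setT (EFin \o (fun t => 2 * (f t * f t))).
    by have := integrableZl measurableT 2 (sqi_integrableM measurableT Lf Lf); apply: eq_integrable.
  have -> : 2 * nrm2 f = Rintegral mu setT (fun t => 2 * (f t * f t)).
    by rewrite RintegralZl//; exact: (sqi_integrableM measurableT Lf Lf).
  apply: (@le_trans _ _ (Rintegral mu (U `&` E) (fun t => 2 * (f t * f t)))); last first.
    rewrite /Rintegral fine_le//.
    - by apply: integrable_fin_num => //; apply: integrableS iL.
    - exact: integrable_fin_num.
    apply: ge0_subset_integral => //.
      by case/integrableP: iL.
    by move=> t _; rewrite lee_fin mulr_ge0// -expr2 sqr_ge0.
  have aeK : {ae mu, forall t, (U `&` E) t -> c <= 2 * (f t * f t)}.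
    have ed := en_der A fg.
    apply: ae_imp fg => t -> [Ut Et]; have := der_holder A Ex Et; rewrite ed.
    have xt1 : `|x - t| <= 1.
      by apply: ltW; apply: lt_le_trans Ut _; rewrite /r ge_min lexx orbT.
    have : `|x - t| * (2 * en f) <= 1 * (2 * en f) by rewrite ler_wpM2r// mulr_ge0.
    rewrite /c -expr2 mul1r => h1 /le_trans /(_ h1) h2.
    by have := sqr_ge0 (g x - 2 * g t); have := sqr_ge0 (g x - g t); lra.
  rewrite /Rintegral fine_le//.
  - by rewrite integral_cst// fin_numM// ge0_fin_numE.
  - by apply: integrable_fin_num => //; apply: integrableS iL.
  apply: ae_ge0_le_integral => //.
  - by move=> t _; rewrite lee_fin ltW.
  - by move=> t _; rewrite lee_fin mulr_ge0// -expr2 sqr_ge0.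
  - by case/integrableP: iL => + _; exact: measurable_funS.
rewrite q1E; have n0 := nrm2_ge0 mu f.
have : g x ^+ 2 <= 2 / m * nrm2 f + 4 * en f.
  rewrite -lerBlDr -/c -ler_pdivlMr// in key *.
  by rewrite mulrAC.
have : 0 <= 2 / m * en f by rewrite mulr_ge0// divr_ge0// ltW.
lra.
Qed.

End PointEvaluation.

(** * Closed sets with interior: no minimal element *)

Section Trapezoid.
Variables (R : realType) (E : set R).
Hypothesis EK : inK E.
Implicit Types (A : set R) (f g u v theta : R -> R) (x y z a b c d : R).

(** Nowhere density in the form in which it is used: each interval contains a free closed interval
    of positive length, wide enough for a ramp at positive distance from A. *)
Definition nowhere A := forall a b : R, a < b ->
  exists c d : R, [/\ a < c, c < d, d < b & forall x, c <= x <= d -> ~ A x].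

(** The radius d is uniform over A. For A = E this makes u equal at the two ends of every gap
    shorter than d. *)
Definition flat A u := exists2 d : R, 0 < d & forall a x y, A a -> E x -> E y ->
  `|x - a| < d -> `|y - a| < d -> u x = u y.

Lemma flat_comp A theta u : flat A u -> flat A (fun x => theta (u x)).
Proof.
move=> [d d0 H]; exists d => // a x y Aa Ex Ey xa ya.
by rewrite (H a x y).
Qed.

Lemma flat_comp2 A (theta : R -> R -> R) u v : flat A u -> flat A v ->
  flat A (fun x => theta (u x) (v x)).
Proof.
move=> [d d0 H] [d' d'0 H']; exists (Num.min d d'); first by rewrite lt_min d0.
move=> a x y Aa Ex Ey; rewrite !lt_min => /andP[x1 x2] /andP[y1 y2].
by rewrite (H a x y)// (H' a x y).
Qed.

Lemma flat_lin A : linear_class (flat A).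
Proof.
move=> k f g ff fg; exact: (flat_comp2 (fun s t => k * s + t) ff fg).
Qed.

Definition rampf c d x := Num.min (Num.max ((d - c)^-1 * (x - c)) 0) 1.

Lemma rampf_cont c d : cont_on E (rampf c d).
Proof.
apply: (cont_on_lip (theta := fun s => Num.min (Num.max s 0) 1)); first exact: clip_lip.
apply: cont_onZ => x _ e e0; exists e => // y _.
by rewrite (_ : x - c - (y - c) = x - y)//; ring.
Qed.

Lemma rampf_measurable c d : measurable_fun setT (rampf c d).
Proof.
apply: (@measurable_clip R (fun x => (d - c)^-1 * (x - c))).
by apply: measurable_funM => //; exact: measurable_funB.
Qed.

Lemma rampf01 c d x : 0 <= rampf c d x <= 1.
Proof.
by rewrite /rampf; have [[_ ->]|[? ->]|[_ ->]] := clip_cases ((d - c)^-1 * (x - c));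
  rewrite ?lexx ?ler01.
Qed.

Lemma rampf0 c d x : c < d -> x <= c -> rampf c d x = 0.
Proof.
move=> cd xc; have h : (d - c)^-1 * (x - c) <= 0.
  by rewrite pmulr_rle0 ?subr_le0// invr_gt0 subr_gt0.
by rewrite /rampf; have [[? ->]|[? ->]|[? _]] := clip_cases ((d - c)^-1 * (x - c)) => //; lra.
Qed.

Lemma rampf1 c d x : c < d -> d <= x -> rampf c d x = 1.
Proof.
move=> cd dx; have h : 1 <= (d - c)^-1 * (x - c).
  by rewrite mulrC ler_pdivlMr ?subr_gt0// mul1r lerB.
by rewrite /rampf; have [[? _]|[? ->]|[? ->]] := clip_cases ((d - c)^-1 * (x - c)) => //; lra.
Qed.

Definition trap c d c' d' x := clip (fun x => rampf c d x + (1 - rampf c' d' x) + -1) x.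

Lemma trapE c d c' d' x : trap c d c' d' x = clip (fun x => rampf c d x - rampf c' d' x) x.
Proof. by congr (clip _ x); apply/funext => t; ring. Qed.

Lemma trap1 c d c' d' x : c < d -> c' < d' -> d <= x -> x <= c' -> trap c d c' d' x = 1.
Proof.
move=> cd cd' dx xc; rewrite trapE /clip rampf1// rampf0// subr0.
by have [[? _]|[? ->]|[? ->]] := clip_cases (1 : R) => //; lra.
Qed.

Lemma trap0 c d c' d' x : c < d -> c' < d' -> x <= c \/ d' <= x -> trap c d c' d' x = 0.
Proof.
move=> cd cd' H; have := rampf01 c d x; have := rampf01 c' d' x => /andP[h1 h2] /andP[h3 h4].
have h : rampf c d x - rampf c' d' x <= 0.
  by case: H => H; [rewrite (rampf0 cd H) sub0r oppr_le0|rewrite (rampf1 cd' H) subr_le0].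
rewrite trapE /clip.
by have [[? ->]|[? ->]|[? _]] := clip_cases (rampf c d x - rampf c' d' x) => //; lra.
Qed.

(* The two ramps of a trapezoid around x are placed inside intervals free of A. *)
Lemma trapezoid_exists A x r : nowhere A -> E x -> 0 < r -> exists theta,
  [/\ Cc E theta, measurable_fun setT theta, forall y, 0 <= theta y <= 1,
      exists2 d', 0 < d' & forall y, `|x - y| < d' -> theta y = 1 &
      [/\ forall y, r <= `|x - y| -> theta y = 0,
          exists2 d', 0 < d' & forall a, A a ->
            (forall y, `|y - a| < d' -> theta y = 0) \/ (forall y, `|y - a| < d' -> theta y = 1) &
          exists a b, [/\ E a, E b, a <= b, forall y, E y -> y <= a -> theta y = theta a &
            forall y, E y -> b <= y -> theta y = theta b]]].
Proof.
move=> nA Ex r0; have [d [K [a [b [d0 cK KE Kd [Ea Eb /andP[ax xb] al br]]]]]] := local_compact EK Ex.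
pose s := Num.min r d; have s0 : 0 < s by rewrite lt_min r0.
have sr : s <= r by rewrite ge_min lexx.
have sd : s <= d by rewrite ge_min lexx orbT.
have [|c1 [d1 [h1 h2 h3 n1]]] := nA (x - s) x; first by rewrite gtrBl.
have [|c2 [d2 [k1 k2 k3 n2]]] := nA x (x + s); first by rewrite ltrDl.
(* Each ramp occupies the middle third of a free interval; the outer thirds keep it away from A. *)
pose w1 := (d1 - c1) / 3; pose w2 := (d2 - c2) / 3.
have w10 : 0 < w1 by rewrite divr_gt0// subr_gt0.
have w20 : 0 < w2 by rewrite divr_gt0// subr_gt0.
have e1 : d1 = c1 + 3 * w1 by rewrite /w1; field.
have e2 : d2 = c2 + 3 * w2 by rewrite /w2; field.
pose p := c1 + w1; pose p' := c1 + 2 * w1; pose q := c2 + w2; pose q' := c2 + 2 * w2.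
have pp : p < p' by rewrite /p /p'; lra.
have qq : q < q' by rewrite /q /q'; lra.
pose th := trap p p' q q'.
have t1 y : p' <= y -> y <= q -> th y = 1 by exact: trap1.
have t0 y : y <= p \/ q' <= y -> th y = 0 by exact: trap0.
have far y : s <= `|x - y| -> th y = 0.
  move=> h; apply: t0; have [yx|xy] := leP y x.
    by left; move: h; rewrite ger0_norm ?subr_ge0// /p; lra.
  by right; move: h; rewrite ltr0_norm ?subr_lt0// /q'; lra.
exists th; split.
- apply/CcP; split.
    apply: (cont_on_lip (theta := fun s => Num.min (Num.max s 0) 1)); first exact: clip_lip.
    apply: cont_onD; last by move=> y _ e e0; exists 1 => // z _ _; rewrite subrr normr0.
    apply: cont_onD; first exact: rampf_cont.
    rewrite (_ : (fun y => 1 - rampf q q' y) = fun y => -1 * rampf q q' y + 1); last first.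
      by apply/funext => y; ring.
    apply: cont_onD; first by apply: cont_onZ; exact: rampf_cont.
    by move=> y _ e e0; exists 1 => // z _ _; rewrite subrr normr0.
  exists K; split=> // y Ey nK; apply: far; rewrite leNgt; apply/negP => h; apply: nK.
  by apply: Kd => //; apply: ltW; exact: lt_le_trans h sd.
- apply: measurable_clip; apply: measurable_funD => //.
  by apply: measurable_funD; [exact: rampf_measurable|apply: measurable_funB => //; exact: rampf_measurable].
- by move=> y; rewrite /th /trap /clip; set t := (X in Num.max X); have [[_ ->]|[? ->]|[_ ->]] := clip_cases t;
    rewrite ?lexx ?ler01.
- exists (Num.min (x - p') (q - x)); first by rewrite lt_min !subr_gt0 /p' /q; apply/andP; split; lra.
  move=> y; rewrite lt_min !ltr_norml => /andP[/andP[? ?] /andP[? ?]]; apply: t1; lra.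
- split.
  + by move=> y h; apply: far; exact: le_trans sr h.
  + exists (Num.min w1 w2); first by rewrite lt_min w10.
    move=> t At; have nt1 : t < c1 \/ d1 < t.
      have [|c1t] := ltP t c1; [by left|have [|td1] := ltP d1 t; first by right].
      by exfalso; apply: (n1 t) => //; rewrite c1t.
    have nt2 : t < c2 \/ d2 < t.
      have [|c1t] := ltP t c2; [by left|have [|td1] := ltP d2 t; first by right].
      by exfalso; apply: (n2 t) => //; rewrite c1t.
    case: nt1 => nt1.
      left=> y; rewrite lt_min !ltr_norml => /andP[/andP[? ?] /andP[? ?]]; apply: t0; left.
      by rewrite /p; lra.
    case: nt2 => nt2.
      right=> y; rewrite lt_min !ltr_norml => /andP[/andP[? ?] /andP[? ?]].
      by apply: t1; rewrite /p' /q; lra.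
    left=> y; rewrite lt_min !ltr_norml => /andP[/andP[? ?] /andP[? ?]]; apply: t0; right.
    by rewrite /q'; lra.
  + exists a, b; split=> //; first exact: le_trans ax xb.
      move=> y Ey ya; case: al => [al|/(_ y Ey) ay].
        have h : s <= x - y by move: ya al sd; clear; lra.
        have h' : s <= x - a by move: al sd; clear; lra.
        by rewrite (far y) ?(far a)//; [exact: le_trans h' (ler_norm _)|exact: le_trans h (ler_norm _)].
      by have -> : y = a by apply/eqP; rewrite eq_le ya.
    move=> y Ey yb; case: br => [br|/(_ y Ey) by_].
      have h : s <= y - x by move: yb br sd; clear; lra.
      have h' : s <= b - x by move: br sd; clear; lra.
      by rewrite (far y) ?(far b)// distrC; [exact: le_trans h' (ler_norm _)|exact: le_trans h (ler_norm _)].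
    by have -> : y = b by apply/eqP; rewrite eq_le yb by_.
Qed.

End Trapezoid.

(** * Shrinking a Fukushima subspace *)

Section Fukushima.
Variables (R : realType) (E : set R)
  (mu : {measure set (measurableTypeR R) -> \bar R}).
Hypothesis EK : inK E.
Hypothesis muE : radon_full E mu.
Notation lam := (leb R).
Notation OI := (openI E).
Notation Fd := (Fdom E mu).
Notation en := (en E mu).
Notation q1 := (q1 E mu).
Implicit Types (A : set R) (f g h u v w : R -> R) (x y z a b : R).

(** A ramp is the scaled difference of the truncations of s to [0, b] and [0, a], each of which is a
    rescaled unit contraction. Linear classes stable under [clip] are thus stable under ramps with
    positive thresholds. *)
Lemma rampf_clip a b s : 0 < a -> a < b ->
  rampf a b s = (b - a)^-1 * (b * Num.min (Num.max (b^-1 * s) 0) 1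
    - a * Num.min (Num.max (a^-1 * s) 0) 1).
Proof.
move=> a0 ab; have b0 := lt_trans a0 ab; have ba : 0 < b - a by rewrite subr_gt0.
have scale (c t : R) : 0 < c -> c * Num.min (Num.max (c^-1 * t) 0) 1 = Num.min (Num.max t 0) c.
  move=> c0; have cn : c != 0 by rewrite gt_eqF.
  by rewrite minr_pMr ?(ltW c0)// maxr_pMr ?(ltW c0)// mulr0 mulr1 mulVKf.
rewrite !scale// /rampf.
have [sa|as_] := leP s a.
  rewrite (_ : Num.min (Num.max s 0) b = Num.max s 0); last first.
    by apply/min_idPl; rewrite ge_max (le_trans sa) ?ltW.
  rewrite (_ : Num.min (Num.max s 0) a = Num.max s 0); last first.
    by apply/min_idPl; rewrite ge_max sa ltW.
  by rewrite subrr mulr0; have := rampf0 ab sa.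
have s0 := lt_trans a0 as_; rewrite !(max_l (ltW s0)) (min_r (ltW as_)).
have [sb|bs] := leP s b.
  have h : 0 <= (b - a)^-1 * (s - a) by rewrite mulr_ge0 ?invr_ge0 ?subr_ge0// ltW.
  have h' : (b - a)^-1 * (s - a) <= 1 by rewrite mulrC ler_pdivrMr// mul1r lerB.
  by rewrite (max_l h) (min_l h').
by rewrite mulVf ?gt_eqF//; have := rampf1 ab (ltW bs).
Qed.

Lemma rampf_closed (G : set (R -> R)) g a b : linear_class G ->
  (forall v, G v -> G (clip v)) -> 0 < a -> a < b -> G g -> G (fun x => rampf a b (g x)).
Proof.
move=> Gl Gc a0 ab Gg; under eq_fun do rewrite rampf_clip//.
have Gs c : G (fun x => Num.min (Num.max (c^-1 * g x) 0) 1).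
  by apply: (Gc (fun x => c^-1 * g x)); exact: linear_classZ.
apply: linear_classZ => //; apply: linear_classB => //; exact: linear_classZ.
Qed.

Variable F : set (R -> R).
Hypothesis Ffuk : fukushima E mu F.

Lemma fuk_Fd : F `<=` Fd. Proof. by case: Ffuk. Qed.

Lemma fuk_ae : aeeq_closed mu F.
Proof. by case: Ffuk => _ [_ [+ _]]. Qed.

Lemma fuk_lin : linear_class F.
Proof.
case: Ffuk => _ [_ [_ [_ [D [Z _]]]]] a f g Ff Fg.
exact: (D _ _ (Z a f Ff) Fg).
Qed.

Lemma fuk_complete : form_complete E mu F.
Proof. by case: Ffuk => _ [_ [_ [_ [_ [_ [_ [_ [_ [_ [+ _]]]]]]]]]]. Qed.

Lemma fuk_clip f : F f -> F (clip f) /\ en (clip f) <= en f.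
Proof. by case: Ffuk => _ [_ [_ [_ [_ [_ [_ [_ [_ [_ [_ [+ _]]]]]]]]]]] => /[apply]. Qed.

Lemma cont_on_measurable f : cont_on E f -> measurable_fun setT (f \_ E).
Proof.
move=> /cont_onP cf; have mE := measurable_E EK.
apply/(measurable_restrictT f mE).
exact: (@subspace_continuous_measurable_fun R E f mE cf).
Qed.

(** Members of F are measurable, while [Cc] constrains a function only on E; the extension of g0 by
    zero satisfies both requirements. *)
Lemma fuk_Cc g g0 : F g -> Cc E g0 -> aeeq mu g g0 ->
  exists g', [/\ F g', Cc E g', aeeq mu g g' & forall x, E x -> g' x = g0 x].
Proof.
move=> Fg Cg0 gg0; have e : forall x, E x -> (g0 \_ E) x = g0 x.
  by move=> x Ex; rewrite patchE mem_set.
have gg : aeeq mu g (g0 \_ E).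
  by apply: aeeq_trans gg0 _; apply: (aeeq_on EK muE) => x /e ->.
exists (g0 \_ E); split=> //; last by apply: Cc_eq Cg0 => x /e ->.
by apply: fuk_ae Fg _ gg; apply: cont_on_measurable; have [] := (CcP E g0).1 Cg0.
Qed.

Lemma fuk_uniform f (e : R) : Cc E f -> 0 < e ->
  exists g, [/\ F g, Cc E g & forall x, E x -> `|f x - g x| < e].
Proof.
move=> Cf e0; case: Ffuk => _ [_ [_ [_ [_ [_ [_ [_ [_ [_ [_ [_ [_ H]]]]]]]]]]]].
have [g [g0 [Fg [Cg [gg0 fg]]]]] := H f Cf e e0.
have [g' [Fg' Cg' _ e']] := fuk_Cc Fg Cg gg0.
by exists g'; split=> // x Ex; rewrite e'// fg.
Qed.

Definition flat_core A := [set u | F u /\ Cc E u /\ flat E A u].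

Lemma flat_core_lin A : linear_class (flat_core A).
Proof.
move=> a f g [Ff [Cf Lf]] [Fg [Cg Lg]]; split; first exact: fuk_lin.
by split; [exact: Cc_lin|exact: flat_lin].
Qed.

Lemma flat_core_clip A v : flat_core A v -> flat_core A (clip v) /\ en (clip v) <= en v.
Proof.
move=> [Fv [Cv Lv]]; have [Fc ec] := fuk_clip Fv; split=> //; split=> //.
split; first exact: Cc_clip.
exact: (flat_comp (fun s => Num.min (Num.max s 0) 1)).
Qed.

(** A trapezoid that is 0 or 1 near A need not belong to F, but some g in F lies within 1/4 of it.
    The ramp from 1/4 to 3/4 sends g back to exactly 0 and 1 on the plateaus, which restores
    flatness. *)
Lemma flat_core_sep A : nowhere A -> separating E (flat_core A).
Proof.
move=> nA x d Ex d0.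
have [th [Cth mth th01 [d1 d10 near1] [far0 [d2 d20 flatA] _]]] := trapezoid_exists EK nA Ex d0.
have q0 : 0 < 4^-1 :> R by rewrite invr_gt0.
have [g [Fg Cg gth]] := fuk_uniform Cth q0.
have q34 : 4^-1 < 3 / 4 :> R by lra.
pose phi y := rampf 4^-1 (3 / 4) (g y).
have p1 y : E y -> th y = 1 -> phi y = 1.
  move=> Ey t; apply: rampf1 => //; have := gth y Ey.
  by rewrite t ltr_norml => /andP[_ ?]; lra.
have p0 y : E y -> th y = 0 -> phi y = 0.
  move=> Ey t; apply: rampf0 => //; have := gth y Ey.
  by rewrite t ltr_norml => /andP[? _]; lra.
have cl (G : set (R -> R)) : linear_class G -> (forall v, G v -> G (clip v)) -> G g -> G phi.
  by move=> Gl Gc; apply: rampf_closed.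
exists phi; split.
- split; first by apply: cl => //; [exact: fuk_lin|move=> v /fuk_clip []].
  split; first by apply: cl => //; [exact: Cc_lin|exact: Cc_clip].
  exists d2 => // a y z Aa Ey Ez ya za.
  by case: (flatA a Aa) => H; [rewrite !p0// H|rewrite !p1// H].
- by move=> y _; exact: rampf01.
- by exists d1 => // y Ey xy; apply: p1 => //; exact: near1.
- by move=> y Ey dxy; apply: p0 => //; exact: far0.
Qed.

Lemma flat_core_fukushima A : nowhere A -> fukushima E mu (form_closure E mu F (flat_core A)).
Proof.
move=> nA; apply: (form_closure_fukushima EK muE fuk_Fd fuk_lin fuk_ae fuk_complete).
- by move=> v [].
- exact: flat_core_lin.
- by move=> v [_ []].
- exact: flat_core_clip.
- exact: flat_core_sep.
Qed.

(** A is the complement of balls around the rationals; the n-th ball has length k / 2^(n+1), so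
    their total length is at most k. *)
Lemma nowhere_fat (x y k : R) : x < y -> 0 < k ->
  exists A : set R, [/\ nowhere A, @measurable _ (measurableTypeR R) A &
    (lam (`[x, y] `\` A) <= k%:E)%E].
Proof.
move=> xy k0; pose r n : R := k / 2 / (2 ^ n.+1)%:R.
have r0 n : 0 < r n by rewrite !divr_gt0// ltr0n expn_gt0.
pose B n : set R := if @unpickle rat n is Some q then ball (ratr q : R) (r n) else set0.
have mB n : @measurable _ (measurableTypeR R) (B n).
  rewrite /B; case: unpickle => [q|]; last exact: measurable0.
  by apply: open_measurable; exact: ball_open.
have lB n : (lam (B n) <= (k / (2 ^ n.+1)%:R)%:E)%E.
  rewrite /B; case: unpickle => [q|]; last by rewrite measure0 lee_fin divr_ge0 ?ltW.
  rewrite ball_itv [leLHS]lebesgue_measure_itv /= lte_fin; case: ifP => _; last first.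
    by rewrite lee_fin divr_ge0 ?ltW.
  by rewrite -EFinB lee_fin /r le_eqVlt; apply/orP; left; apply/eqP; field; rewrite pnatr_eq0 expn_eq0.
have mU : @measurable _ (measurableTypeR R) (\bigcup_n B n) by exact: bigcup_measurable.
exists (~` \bigcup_n B n); split.
- move=> a b ab; have [q] := rat_in_itvoo ab; rewrite in_itv/= => /andP[aq qb].
  set n := pickle q; pose s := Num.min (r n) (Num.min (ratr q - a) (b - ratr q)) / 2.
  have s0 : 0 < s by rewrite divr_gt0// !lt_min r0 !subr_gt0 aq.
  have sr : s < r n.
    have : 2 * s <= r n by rewrite /s mulrC divfK// ge_min lexx.
    by lra.
  have sa : 2 * s <= ratr q - a by rewrite /s mulrC divfK// !ge_min lexx !orbT.
  have sb : 2 * s <= b - ratr q by rewrite /s mulrC divfK// !ge_min lexx !orbT.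
  exists (ratr q - s), (ratr q + s); split; [lra|lra|lra|].
  move=> t /andP[t1 t2] /=; apply; have Bn : B n t.
    rewrite /B /n pickleK /ball /= -/n; apply: le_lt_trans sr.
    by rewrite ler_norml; apply/andP; split; lra.
  exact: (ex_intro2 _ _ n I Bn).
- exact: measurableC.
- apply: (@le_trans _ _ (lam (\bigcup_n B n))).
    apply: le_measure; rewrite ?inE//.
      by apply: measurableD; [exact: mitvcc|exact: measurableC].
    by move=> t [_ /contrapT].
  apply: (@le_trans _ _ (\sum_(n <oo) lam (B n))%E); first exact: measure_sigma_subadditive.
  apply: le_trans (epsilon_trick0 xpredT (ltW k0)).
  by apply: lee_nneseries => // n _ _; exact: measure_ge0.
Qed.

(* The density vanishes on A wherever the function is flat near A, so only
   the complement of A contributes to the increment over an interval in E. *)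
Lemma flat_increment A g h x y (k : R) : x < y -> `[x, y] `<=` E -> adm E g h ->
  @measurable _ (measurableTypeR R) A -> (lam (`[x, y] `\` A) <= k%:E)%E -> flat E A g ->
  (g y - g x) ^+ 2 <= k * rip lam OI (der E (g, h)) (der E (g, h)).
Proof.
move=> xy xyE ad mA Ak [d d0 fl].
have Ex : E x by apply: xyE; rewrite /= in_itv/= lexx ltW.
have Ey : E y by apply: xyE; rewrite /= in_itv/= lexx ltW.
have [Ix Iy] := (E_Iset Ex, E_Iset Ey).
have mI := @mitvcc R x y.
have sd := sqi_der EK ad; set D := der E (g, h) in sd *.
have mD := sd.1.
have incr s t : x <= s -> s <= t -> t <= y -> g t - g s = Rintegral lam `[s, t] D.
  move=> xs st ty; apply: (adm_der_itv EK ad) => //; apply: xyE; rewrite /= in_itv/=.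
    by rewrite xs (le_trans st).
  by rewrite ty (le_trans xs).
have h0 : {ae lam, forall t, (A `&` `]x, y[) t -> D t = 0}.
  apply: ae_local => t [At]; rewrite /= in_itv/= => /andP[xt ty].
  pose s := Num.min d (Num.min (t - x) (y - t)) / 2.
  have s0 : 0 < s by rewrite divr_gt0// !lt_min d0 !subr_gt0 xt.
  have s1 : 2 * s <= d by rewrite /s mulrC divfK// ge_min lexx.
  have s2 : 2 * s <= t - x by rewrite /s mulrC divfK// !ge_min lexx !orbT.
  have s3 : 2 * s <= y - t by rewrite /s mulrC divfK// !ge_min lexx !orbT.
  exists (t - s), (t + s); split; first by apply/andP; split; lra.
  have iD : lam.-integrable `[t - s, t + s] (EFin \o D).
    by apply: integrable_itvS (sqi_integrable_itv (sqi_OI_itv Ix Iy sd)); lra.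
  have : {ae lam, forall z, t - s <= z <= t + s -> D z = 0}.
    apply: ae_eq0_itv => //; first by lra.
    move=> z /andP[z1 z2]; rewrite -incr; [|lra|lra|lra].
    rewrite (fl t (t + s) z)// ?subrr//; try (apply: xyE; rewrite /= in_itv/=; apply/andP; split; lra).
      by rewrite addrC addKr gtr0_norm; lra.
    by rewrite ltr_norml; apply/andP; split; lra.
  by apply: ae_imp => z Hz /andP[z1 z2]; apply: Hz; rewrite !ltW.
pose J := `[x, y] `\` A.
have mJ : @measurable _ (measurableTypeR R) J by exact: measurableD.
have m1 : measurable_fun setT (\1_J : R -> R).
  exact: (@measurable_indic _ (measurableTypeR R) R setT J mJ).
have sJ : sqi lam `[x, y] (\1_J : R -> R).
  apply: (le_sqi mI m1 _ (sqi_cst_itv x y 1)) => t _.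
  by rewrite indicE; case: (_ \in _); rewrite /= ?normr0 ?normr1.
have sDI := sqi_OI_itv Ix Iy sd.
have e1 : g y - g x = rip lam `[x, y] D (\1_J : R -> R).
  rewrite (incr x y)//; last exact: ltW.
  have e2 : Rintegral lam `]x, y[ (fun t => D t * \1_J t) = rip lam `[x, y] D (\1_J : R -> R).
    by apply: Rintegral_itv_oo; exact: measurable_funM.
  rewrite -e2 -Rintegral_itv_oo//; congr fine; apply: ae_eq_integral.
  - exact: measurable_itv.
  - by apply/measurable_EFinP; exact: measurable_funS mD.
  - by apply/measurable_EFinP; apply: measurable_funS (measurable_funM mD m1).
  - apply: ae_imp h0 => t Ht; rewrite /= in_itv/= => txy; congr EFin.
    have [At|nA] := pselect (A t); first by rewrite Ht ?mul0r//; split=> //=; rewrite in_itv.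
    rewrite indicE mem_set ?mulr1//; split=> //=; rewrite in_itv/=.
    by case/andP: txy => /ltW -> /ltW ->.
rewrite e1; apply: le_trans (rip_cs mI sDI sJ) _; rewrite mulrC.
apply: ler_pM; rewrite ?rip_ge0//; last exact: rip_itv_le.
rewrite -lee_fin -integral_sqr_rip//; apply: le_trans Ak.
rewrite (eq_integral (fun t : measurableTypeR R => (\1_J t)%:E)); last first.
  by move=> t _; rewrite indicE; case: (_ \in _); rewrite ?expr1n ?expr0n.
rewrite integral_indic//; apply: le_measure; rewrite ?inE; [exact: measurableI|exact: mJ|].
by move=> t [].
Qed.

Lemma Cc_rep f g h : Cc E f -> adm E g h -> aeeq mu f g -> forall x, E x -> g x = f x.
Proof.
move=> /CcP[cf _] ad fg; apply: (aeeq_eq_on EK muE) => //; first exact: adm_cont_on ad.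
exact: aeeq_sym.
Qed.

Lemma fuk_not_minimal : interior E !=set0 ->
  exists F', [/\ fukushima E mu F', F' `<=` F & F' <> F].
Proof.
move=> [x0 /nbhs_ballP[d0 /= d00 dE]].
pose x := x0 - d0 / 2; pose y := x0 + d0 / 2.
have xy : x < y by rewrite /x /y; lra.
have xyE : `[x, y] `<=` E.
  move=> t; rewrite /= in_itv/= => /andP[xt ty]; apply: dE.
  by rewrite /ball /= ltr_norml; apply/andP; split; move: xt ty; rewrite /x /y; lra.
have Ex : E x by apply: xyE; rewrite /= in_itv/= lexx ltW.
have Ey : E y by apply: xyE; rewrite /= in_itv/= lexx ltW.
(* Flatness near the empty set is no constraint, so [flat_core_sep] then separates points within F
   itself. *)
have n0 : nowhere (set0 : set R).
  by move=> a b ab; exists ((2 * a + b) / 3), ((a + 2 * b) / 3); split; [lra|lra|lra|by move=> t _ []].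
have yx0 : 0 < y - x by rewrite subr_gt0.
have [phi [[Fphi [Cphi _]] _ [d1 d10 p1] p0]] := flat_core_sep n0 Ex yx0.
have phix : phi x = 1 by apply: p1 => //; rewrite subrr normr0.
have phiy : phi y = 0 by apply: p0 => //; rewrite distrC ger0_norm ?lexx// ltW.
have Fdphi := fuk_Fd Fphi; have ephi := en_ge0 EK muE Fdphi.
(* An approximant of energy at most en phi + 1 has squared increment at most 2 k (en phi + 1) = 1/8,
   by [flat_increment]. *)
pose k := (16 * (en phi + 1))^-1.
have k0 : 0 < k by rewrite invr_gt0 mulr_gt0// ltr_wpDl.
have [A [nA mA lA]] := nowhere_fat xy k0.
exists (form_closure E mu F (flat_core A)); split; first exact: flat_core_fukushima.
  by move=> f [].
move=> eF; have : form_closure E mu F (flat_core A) phi by rewrite eF.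
move=> cl; have [C1 C10 H1] := eval_bound EK muE Ex; have [C2 C20 H2] := eval_bound EK muE Ey.
(* By [eval_bound] this tolerance keeps the values at x and y within 1/4 of 1 and 0, so the squared
   increment is at least 1/4 and exceeds 1/8. *)
pose e := Num.min 1 (Num.min (C1^-1 / 16) (C2^-1 / 16)).
have e0 : 0 < e by rewrite !lt_min ltr01 !divr_gt0 ?invr_gt0.
have VF : flat_core A `<=` F by move=> v [].
have [v [[Fv [Cv fv]] v1 v2]] := form_closure_en EK muE fuk_Fd VF cl e0.
have Fdv := fuk_Fd Fv.
have [_ [g [h [ad vg]]]] := Fdv.
have gv := Cc_rep Cv ad vg.
have flg : flat E A g.
  by case: fv => d d0' fl; exists d => // a s t Aa Es Et sa ta; rewrite !gv// (fl a s t).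
have inc := flat_increment xy xyE ad mA lA flg; rewrite (en_der EK muE ad vg) in inc.
have Fdd := FdomB Fdphi Fdv; have [_ [g' [h' [ad' dg']]]] := Fdd.
have gd' : forall t, E t -> g' t = phi t - v t.
  apply: (@Cc_rep (fun t => phi t - v t) g' h') => //.
  exact: (linear_classB (@Cc_lin R E) Cphi Cv).
have := H1 _ _ _ Fdd ad' dg'; have := H2 _ _ _ Fdd ad' dg'.
rewrite !gd'// phix phiy -!gv// => b2 b1.
have ce C : 0 < C -> e <= C^-1 / 16 -> C * q1 (fun t => phi t - v t) <= 16^-1.
  move=> C0 eC; apply: (@le_trans _ _ (C * (C^-1 / 16))).
    by rewrite ler_wpM2l ?(ltW C0)//; apply: ltW; exact: lt_le_trans v2 eC.
  by rewrite mulrA mulfV ?mul1r// gt_eqF.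
have c1 : (1 - g x) ^+ 2 <= 16^-1.
  by apply: le_trans b1 (ce _ C10 _); rewrite !ge_min lexx orbT.
have c2 : (0 - g y) ^+ 2 <= 16^-1.
  by apply: le_trans b2 (ce _ C20 _); rewrite !ge_min lexx !orbT.
have ev : en v <= en phi + 1 by apply: le_trans v1 _; rewrite lerD2l ge_min lexx.
have kv : k * (2 * en v) <= 8^-1.
  apply: (@le_trans _ _ (k * (2 * (en phi + 1)))).
    by rewrite ler_wpM2l ?(ltW k0)// ler_wpM2l.
  by rewrite /k le_eqVlt; apply/orP; left; apply/eqP; field; rewrite gt_eqF// ltr_wpDl.
have := le_trans inc kv.
have a1 : 3 / 4 <= g x by nra.
have a2 : g y <= 1 / 4 by nra.
by nra.
Qed.

End Fukushima.

(** * Functions whose energy is carried by the gaps *)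

Section StepDomain.
Variables (R : realType) (E : set R)
  (mu : {measure set (measurableTypeR R) -> \bar R}).
Hypothesis EK : inK E.
Hypothesis muE : radon_full E mu.
Notation lam := (leb R).
Notation OI := (openI E).
Notation Fd := (Fdom E mu).
Notation en := (en E mu).
Notation L2 := (L2 mu).
Notation slope := (slope E).
Implicit Types (f g h u v w : R -> R) (x y z t a b c : R).

Let mOI := measurable_openI E.

(** A point of (a, b) outside E lies either in a gap or beyond one end of E, and both situations
    leave a free interval. *)
Lemma interior_nowhere : interior E = set0 -> nowhere E.
Proof.
move=> iE a b ab.
have [x axb nEx] : exists2 x, a < x < b & ~ E x.
  apply: contrapT => n; have : interior E ((a + b) / 2).
    have := @near_in_itvoo _ a b ((a + b) / 2).
    rewrite in_itv/= !(midf_lt ab) => /(_ isT); apply: filterS => t.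
    rewrite in_itv/= => atb; apply: contrapT => nEt; apply: n; exists t => //.
  by rewrite iE.
have sub c d : c < d -> a <= c -> d <= b -> (forall t, c < t < d -> ~ E t) ->
    exists c d, [/\ a < c, c < d, d < b & forall x, c <= x <= d -> ~ E x].
  move=> cd ac db H; exists ((2 * c + d) / 3), ((c + 2 * d) / 3).
  by split; [lra|lra|lra|move=> t /andP[t1 t2]; apply: H; apply/andP; split; lra].
have /andP[ax xb] := axb.
have [Ox|nOx] := pselect (OI x).
  have [gp /andP[px xp]] := gapofP EK Ox nEx; have [_ [_ [_ nE]]] := gp.
  apply: (sub (Num.max a (gapof E x).1) (Num.min b (gapof E x).2)).
  - by rewrite lt_min !gt_max ab (lt_trans px xp) (lt_trans ax xp) (lt_trans px xb).
  - by rewrite le_max lexx.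
  - by rewrite ge_min lexx.
  - by move=> t; rewrite gt_max lt_min => /andP[/andP[_ pt] /andP[_ tp]]; apply: nE; rewrite pt.
have [[y Ey yx]|ny] := pselect (exists2 y, E y & y < x).
  apply: (sub x b) => //; first exact: ltW.
  move=> t /andP[xt _] Et; apply: nOx; apply/(openIP E); exists y, t; split=> //.
apply: (sub a x) => //; first exact: ltW.
by move=> t /andP[_ tx] Et; apply: ny; exists t.
Qed.

Definition gap_density x : R := 1 - \1_E x.

Lemma gap_density01 x : gap_density x = 0 \/ gap_density x = 1.
Proof.
by rewrite /gap_density indicE; case: (_ \in _); rewrite ?subrr ?subr0; [left|right].
Qed.

Lemma gap_densityE x : E x -> gap_density x = 0.
Proof. by move=> Ex; rewrite /gap_density indicE mem_set// subrr. Qed.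

Lemma gap_densityNE x : ~ E x -> gap_density x = 1.
Proof. by move=> Ex; rewrite /gap_density indicE memNset// subr0. Qed.

Lemma gap_density_ge0 x : 0 <= gap_density x.
Proof. by case: (gap_density01 x) => ->. Qed.

Lemma gap_density_le1 x : gap_density x <= 1.
Proof. by case: (gap_density01 x) => ->; rewrite ?ler01. Qed.

Lemma measurable_gap_density : measurable_fun setT gap_density.
Proof. by apply: measurable_funB => //; exact: measurable_indic_E. Qed.

Lemma sqi_gap_density x y : sqi lam `[x, y] gap_density.
Proof.
apply: (le_sqi (mitvcc x y) measurable_gap_density _ (sqi_cst_itv x y 1)) => t _.
by rewrite normr1 ger0_norm ?gap_density_ge0// gap_density_le1.
Qed.

(** The integral over a set carries no orientation, hence the two branches for a primitive
    normalised at 0. *)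
Definition sc x : R := if 0 <= x then Rintegral lam `[0, x] gap_density
  else - Rintegral lam `[x, 0] gap_density.

Lemma sc_incr x y : x <= y -> sc y - sc x = Rintegral lam `[x, y] gap_density.
Proof.
have I a b := sqi_integrable_itv (sqi_gap_density a b).
move=> xy; rewrite /sc; have [x0|x0] := leP 0 x.
  by rewrite (le_trans x0 xy) (Rintegral_itv_split x0 xy)// addrC addKr.
have [y0|y0] := leP 0 y.
  by rewrite (Rintegral_itv_split (ltW x0) y0)// opprK addrC.
by rewrite opprK (Rintegral_itv_split xy (ltW y0))// addrC addrK.
Qed.

Lemma sc_le x y : x <= y -> sc x <= sc y.
Proof.
move=> xy; rewrite -subr_ge0 sc_incr//; apply: Rintegral_ge0 => t _.
exact: gap_density_ge0.
Qed.

Lemma sc_lip x y : x <= y -> sc y - sc x <= y - x.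
Proof.
move=> xy; rewrite sc_incr//; apply: (@le_trans _ _ (Rintegral lam `[x, y] (cst 1))).
  apply: le_Rintegral; [exact: mitvcc|exact: sqi_integrable_itv (sqi_gap_density x y)| |].
    exact: sqi_integrable_itv (sqi_cst_itv x y 1).
  by move=> t _; exact: gap_density_le1.
by rewrite Rintegral_cst ?mul1r ?leb_itvcc//; exact: mitvcc.
Qed.

(* Vanishing at the left endpoint, required only if it is not in E and the
   scale sc is bounded there; bcr is the same at the right endpoint. *)
Definition bcl u := (forall x, E x -> exists2 y, E y & y < x) ->
  (exists c, forall x, E x -> c <= sc x) ->
  forall e : R, 0 < e -> exists2 x0, E x0 & forall x, E x -> x <= x0 -> `|u x| <= e.

Definition bcr u := (forall x, E x -> exists2 y, E y & x < y) ->
  (exists c, forall x, E x -> sc x <= c) ->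
  forall e : R, 0 < e -> exists2 x0, E x0 & forall x, E x -> x0 <= x -> `|u x| <= e.

Definition slope_prim u := forall x y, E x -> E y -> x <= y ->
  u y - u x = Rintegral lam `[x, y] (slope u).

Definition steprep u :=
  [/\ sqi lam OI (slope u), slope_prim u, bcl u & bcr u].

Definition step_domain : set (R -> R) :=
  [set f | L2 f /\ exists2 u, steprep u & aeeq mu f u].

(* Off the gaps gapof is (0, 0), so that lin u = u there. *)
Definition lin u x := if (gapof E x).1 < (gapof E x).2
  then u (gapof E x).1 + slope u x * (x - (gapof E x).1) else u x.

Lemma lin_E u x : E x -> lin u x = u x.
Proof. by move=> Ex; rewrite /lin (gapof_E Ex) ltxx. Qed.

Lemma lin_gap u p x : gaps E p -> p.1 < x < p.2 ->
  lin u x = u p.1 + (u p.2 - u p.1) / (p.2 - p.1) * (x - p.1).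
Proof.
by move=> gp xp; rewrite /lin (slope_gap u gp xp) (gapof_eq gp xp); case: gp => ->.
Qed.

Lemma slope_lin u : slope (lin u) = slope u.
Proof. by apply: (slope_eq_on EK) => x Ex; rewrite lin_E. Qed.

Lemma der_lin u : der E (lin u, slope u) = slope u.
Proof.
apply/funext => x; have [Ex|nEx] := pselect (E x); first by rewrite der_E.
by rewrite der_notE// slope_lin.
Qed.

Lemma slope_itv_sub u p x y : gaps E p -> p.1 <= x -> x <= y -> y <= p.2 ->
  Rintegral lam `[x, y] (slope u) = (u p.2 - u p.1) / (p.2 - p.1) * (y - x).
Proof.
move=> gp px xy yp; rewrite -Rintegral_itv_oo; last exact: measurable_slope.
rewrite /Rintegral (eq_integral (fun=> ((u p.2 - u p.1) / (p.2 - p.1))%:E)); last first.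
  move=> t; rewrite inE/= in_itv/= => /andP[xt ty].
  by rewrite (slope_gap u gp)// (le_lt_trans px xt) (lt_le_trans ty yp).
rewrite integral_cst//= [X in fine (_ * X)%E]lebesgue_measure_itv/= lte_fin.
have := xy; rewrite le_eqVlt => /predU1P[->|->]; last by rewrite -EFinB.
by rewrite ltxx mule0 subrr mulr0.
Qed.

Lemma Iset_gap x : Iset E x -> ~ E x -> exists2 p, gaps E p & p.1 < x < p.2.
Proof. by case=> [Ox nE|//]; have [gp xp] := gapofP EK Ox nE; exists (gapof E x). Qed.

(** Split at a point of E between x and y if there is one. Otherwise x and y lie in the same gap,
    where [lin u] is affine. *)
Lemma lin_incr u x y : sqi lam OI (slope u) -> slope_prim u -> Iset E x -> Iset E y ->
  x <= y -> lin u y - lin u x = Rintegral lam `[x, y] (slope u).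
Proof.
move=> su pu Ix Iy xy.
have I a b : Iset E a -> Iset E b -> lam.-integrable `[a, b] (EFin \o slope u).
  by move=> Ia Ib; exact: sqi_integrable_itv (sqi_OI_itv Ia Ib su).
have U a t : E a -> Iset E t -> a <= t -> lin u t - u a = Rintegral lam `[a, t] (slope u).
  move=> Ea It at_; have [Et|nEt] := pselect (E t); first by rewrite lin_E// pu.
  have [p gp pt] := Iset_gap It nEt; have /andP[p1 p2] := pt; have [_ [E1 [E2 _]]] := gp.
  have ap : a <= p.1 by case: (gap_notin gp Ea) => // h; have := lt_le_trans p2 h; rewrite ltNge at_.
  rewrite (Rintegral_itv_split ap (ltW p1) (I _ _ (E_Iset Ea) It)) -(pu a p.1)//.
  rewrite (slope_itv_sub u gp (lexx _) (ltW p1) (ltW p2)) (lin_gap u gp pt); ring.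
have D t b : E b -> Iset E t -> t <= b -> u b - lin u t = Rintegral lam `[t, b] (slope u).
  move=> Eb It tb; have [Et|nEt] := pselect (E t); first by rewrite lin_E// pu.
  have [p gp pt] := Iset_gap It nEt; have /andP[p1 p2] := pt; have [p12 [E1 [E2 _]]] := gp.
  have pb : p.2 <= b by case: (gap_notin gp Eb) => // h; have := le_lt_trans h p1; rewrite ltNge tb.
  rewrite (Rintegral_itv_split (ltW p2) pb (I _ _ It (E_Iset Eb))) -(pu p.2 b)//.
  rewrite (slope_itv_sub u gp (ltW p1) (ltW p2) (lexx _)) (lin_gap u gp pt); field.
  by rewrite subr_eq0 gt_eqF.
have [[z Ez /andP[xz zy]]|nz] := pselect (exists2 z, E z & x <= z <= y).
  rewrite (Rintegral_itv_split xz zy (I _ _ Ix Iy)) -(U z y)// -(D x z)//; ring.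
have nEx : ~ E x by move=> Ex; apply: nz; exists x => //; rewrite lexx.
have [p gp xp] := Iset_gap Ix nEx; have /andP[p1 p2] := xp; have [p12 [E1 [E2 _]]] := gp.
have yp : y < p.2 by rewrite ltNge; apply/negP => h; apply: nz; exists p.2 => //; rewrite h ltW.
have yp' : p.1 < y < p.2 by rewrite (lt_le_trans p1 xy).
rewrite (slope_itv_sub u gp (ltW p1) xy (ltW yp)) (lin_gap u gp xp) (lin_gap u gp yp'); ring.
Qed.

Lemma lin_bound u p x (e : R) : gaps E p -> p.1 < x < p.2 ->
  `|u p.1| <= e -> `|u p.2| <= e -> `|lin u x| <= e.
Proof.
move=> gp xp; rewrite (lin_gap u gp xp) !ler_norml; have [p12 _] := gp; have /andP[h1 h2] := xp.
have d0 : 0 < p.2 - p.1 by rewrite subr_gt0.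
pose k := (x - p.1) / (p.2 - p.1).
have k0 : 0 <= k by rewrite divr_ge0// ?subr_ge0 ltW.
have k1 : k <= 1 by rewrite ler_pdivrMr// mul1r lerB// ltW.
rewrite (_ : _ / _ * _ = (u p.2 - u p.1) * k); last by rewrite /k; field; rewrite gt_eqF.
by move=> /andP[? ?] /andP[? ?]; apply/andP; split; nra.
Qed.

Lemma lend_nomin (c : R) : c%:E = lend E -> ~ E c -> forall x, E x -> exists2 y, E y & y < x.
Proof.
move=> lc nEc x Ex; apply: contrapT => n; apply: nEc.
suff -> : c = x by [].
apply/eqP; rewrite eq_le -!lee_fin lc lend_le//=.
by apply: le_ereal_inf_tmp => _ [y Ey <-]; rewrite lee_fin leNgt; apply/negP => yx; apply: n; exists y.
Qed.

Lemma rend_nomax (c : R) : c%:E = rend E -> ~ E c -> forall x, E x -> exists2 y, E y & x < y.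
Proof.
move=> lc nEc x Ex; apply: contrapT => n; apply: nEc.
suff -> : c = x by [].
apply/eqP; rewrite eq_le -!lee_fin lc rend_ge//= andbT.
by apply: ge_ereal_sup => _ [y Ey <-]; rewrite lee_fin leNgt; apply/negP => yx; apply: n; exists y.
Qed.

Lemma lin_small_left u x0 (e : R) : E x0 -> (forall x, E x -> x <= x0 -> `|u x| <= e) ->
  forall x, Iset E x -> x <= x0 -> `|lin u x| <= e.
Proof.
move=> Ex0 H x Ix xx0; have [Ex|nEx] := pselect (E x); first by rewrite lin_E// H.
have [p gp xp] := Iset_gap Ix nEx; have [p12 [E1 [E2 _]]] := gp; have /andP[p1 p2] := xp.
have p2x : p.2 <= x0.
  by case: (gap_notin gp Ex0) => // h; have := le_lt_trans h p1; rewrite ltNge xx0.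
by apply: (lin_bound gp xp); apply: H => //; exact: le_trans (ltW p12) p2x.
Qed.

Lemma lin_small_right u x0 (e : R) : E x0 -> (forall x, E x -> x0 <= x -> `|u x| <= e) ->
  forall x, Iset E x -> x0 <= x -> `|lin u x| <= e.
Proof.
move=> Ex0 H x Ix xx0; have [Ex|nEx] := pselect (E x); first by rewrite lin_E// H.
have [p gp xp] := Iset_gap Ix nEx; have [p12 [E1 [E2 _]]] := gp; have /andP[p1 p2] := xp.
have p2x : x0 <= p.1.
  by case: (gap_notin gp Ex0) => // h; have := lt_le_trans p2 h; rewrite ltNge xx0.
by apply: (lin_bound gp xp); apply: H => //; exact: le_trans p2x (ltW p12).
Qed.

(** A finite endpoint of E is also at finite [sc] distance, so the conditions [bcl] and [bcr],
    stated in the scale, contain the Euclidean boundary conditions of [adm]. Values inside a gap are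
    convex combinations of values on E, hence equally small. *)
Lemma adm_lin u : steprep u -> adm E (lin u) (slope u).
Proof.
move=> [su pu bl br]; split.
  split; first exact: measurable_slope.
  move=> x y Ix Iy xy; split; first exact: sqi_integrable_itv (sqi_OI_itv Ix Iy su).
  exact: lin_incr.
split; first by case: su.
split=> c lc nEc; apply/cvgrPdist_le => e e0.
- have [|x0 Ex0 H] := bl (lend_nomin lc nEc) _ e e0.
    by exists (sc c) => x Ex; apply: sc_le; rewrite -lee_fin lc lend_le.
  have cx0 : c < x0.
    have [y Ey yx] := lend_nomin lc nEc Ex0.
    by apply: le_lt_trans yx; rewrite -lee_fin lc lend_le.
  near=> t; rewrite sub0r normrN; apply: (lin_small_left Ex0 H); last by near: t; exact: nbhs_right_le.
  left; split; first by rewrite -lc lte_fin; near: t; exact: nbhs_right_gt.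
  apply: lt_le_trans (rend_ge Ex0); rewrite lte_fin; near: t; exact: nbhs_right_lt.
- have [|x0 Ex0 H] := br (rend_nomax lc nEc) _ e e0.
    by exists (sc c) => x Ex; apply: sc_le; rewrite -lee_fin lc rend_ge.
  have cx0 : x0 < c.
    have [y Ey yx] := rend_nomax lc nEc Ex0.
    by apply: lt_le_trans yx _; rewrite -lee_fin lc rend_ge.
  near=> t; rewrite sub0r normrN; apply: (lin_small_right Ex0 H); last by near: t; exact: nbhs_left_ge.
  left; split; last by rewrite -lc lte_fin; near: t; exact: nbhs_left_lt.
  apply: le_lt_trans (lend_le Ex0) _; rewrite lte_fin; near: t; exact: nbhs_left_gt.
Unshelve. all: by end_near. Qed.

Lemma aeeq_lin f u : aeeq mu f u -> aeeq mu f (lin u).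
Proof.
move=> fu; apply: aeeq_trans fu _; apply: (aeeq_on EK muE) => x Ex.
by rewrite lin_E.
Qed.

Lemma step_domain_Fdom : step_domain `<=` Fd.
Proof.
move=> f [Lf [u su fu]]; split=> //; exists (lin u), (slope u); split; first exact: adm_lin.
exact: aeeq_lin.
Qed.

Lemma Eform_step f g u v : steprep u -> aeeq mu f u -> steprep v -> aeeq mu g v ->
  Eform E mu f g = 2^-1 * rip lam OI (slope u) (slope v).
Proof.
move=> su fu sv gv.
rewrite (Eform_der EK muE (adm_lin su) (aeeq_lin fu) (adm_lin sv) (aeeq_lin gv)).
by rewrite !der_lin.
Qed.

Lemma en_step f u : steprep u -> aeeq mu f u -> rip lam OI (slope u) (slope u) = 2 * en f.
Proof. by move=> su fu; rewrite /en (Eform_step su fu su fu) mulrA mulfV ?mul1r. Qed.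

(** Whatever pair [rep] selects, its density agrees a.e. on E with the slope of a step
    representative, which is 0 there. *)
Lemma jump_step f g : step_domain f -> step_domain g -> Eform E mu f g = jump E mu f g.
Proof.
move=> Sf Sg; rewrite /Eform -[RHS]add0r; congr (_ + _).
have Z k : step_domain k -> measurable_fun setT (rep E mu k).2 /\
    {ae lam, forall x, OI x -> E x -> (rep E mu k).2 x = 0}.
  move=> Sk; have [Lk [u su ku]] := Sk; have [a1 a2] := rep_adm (step_domain_Fdom Sk).
  split; first by case: a1 => -[].
  have au := adm_lin su; have e : aeeq mu (rep E mu k).1 (lin u).
    exact: aeeq_trans (aeeq_sym a2) (aeeq_lin ku).
  have := adm_der_ae EK a1 au (adm_eq_on EK muE a1 au e).
  apply: ae_imp => x Hx Ox Ex; have := Hx Ox.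
  by rewrite der_lin (slope_E u Ex) der_E.
have [mf zf] := Z f Sf; have [mg _] := Z g Sg.
have mD : @measurable _ (measurableTypeR R) (E `&` OI).
  by apply: measurableI => //; exact: measurable_E.
rewrite (_ : Rintegral _ _ _ = Rintegral lam (E `&` OI) (cst 0)).
  by rewrite Rintegral_cst// mul0r mulr0.
congr fine; apply: ae_eq_integral => //.
- by apply/measurable_EFinP; apply: measurable_funS (measurable_funM mf mg).
- by apply/measurable_EFinP; exact: measurable_cst.
- by apply: ae_imp zf => x Hx [Ex Ox]; rewrite Hx// mul0r.
Qed.

Lemma slope_linear a u v x : slope (fun x => a * u x + v x) x = a * slope u x + slope v x.
Proof. by rewrite /slope; ring. Qed.

Lemma steprep_lin a u v : steprep u -> steprep v -> steprep (fun x => a * u x + v x).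
Proof.
move=> [su pu lu ru] [sv pv lv rv]; have e := funext (slope_linear a u v).
have a0 : 0 < `|a| + 1 by rewrite ltr_wpDl.
have bnd (e' s t : R) : `|s| <= e' / 2 / (`|a| + 1) -> `|t| <= e' / 2 -> `|a * s + t| <= e'.
  move=> hs ht; rewrite (le_trans (ler_normD _ _))// normrM (splitr e') lerD//.
  apply: (@le_trans _ _ ((`|a| + 1) * `|s|)); first by rewrite ler_wpM2r// lerDl.
  by rewrite mulrC -ler_pdivlMr.
split.
- by rewrite e; apply: sqiD => //; exact: sqiZ.
- move=> x y Ex Ey xy; have [Ix Iy] := (E_Iset Ex, E_Iset Ey).
  have iu := sqi_integrable_itv (sqi_OI_itv Ix Iy su).
  have iv := sqi_integrable_itv (sqi_OI_itv Ix Iy sv).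
  have iau := sqi_integrable_itv (sqiZ (mitvcc x y) a (sqi_OI_itv Ix Iy su)).
  rewrite e RintegralD ?mitvcc// RintegralZl ?mitvcc// -pu// -pv//; ring.
- move=> H1 H2 e' e0; have e2 : 0 < e' / 2 by rewrite divr_gt0.
  have [x1 Ex1 K1] := lu H1 H2 _ (divr_gt0 e2 a0); have [x2 Ex2 K2] := lv H1 H2 _ e2.
  exists (Num.min x1 x2); first by rewrite /Num.min; case: ifP.
  by move=> x Ex; rewrite le_min => /andP[h1 h2]; apply: bnd; [exact: K1|exact: K2].
- move=> H1 H2 e' e0; have e2 : 0 < e' / 2 by rewrite divr_gt0.
  have [x1 Ex1 K1] := ru H1 H2 _ (divr_gt0 e2 a0); have [x2 Ex2 K2] := rv H1 H2 _ e2.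
  exists (Num.max x1 x2); first by rewrite /Num.max; case: ifP.
  by move=> x Ex; rewrite ge_max => /andP[h1 h2]; apply: bnd; [exact: K1|exact: K2].
Qed.

Lemma step_domain_lin : linear_class step_domain.
Proof.
move=> a f g [Lf [u su fu]] [Lg [v sv gv]]; split.
  by apply: (@sqiD R mu setT) => //; exact: (@sqiZ R mu setT measurableT a f Lf).
exists (fun x => a * u x + v x); first exact: steprep_lin.
by apply: ae_imp2 fu gv => x -> ->.
Qed.

Lemma step_domain_ae : aeeq_closed mu step_domain.
Proof.
move=> f g [Lf [u su fu]] mg fg; split.
  by apply: (eq_sqi_ae measurableT mg _ Lf); apply: ae_imp fg => x ->.
by exists u => //; exact: aeeq_trans (aeeq_sym fg) fu.
Qed.

End StepDomain.

(** * The core of locally constant functions *)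

Section StepCore.
Variables (R : realType) (E : set R)
  (mu : {measure set (measurableTypeR R) -> \bar R}).
Hypothesis EK : inK E.
Hypothesis muE : radon_full E mu.
Notation lam := (leb R).
Notation OI := (openI E).
Notation en := (en E mu).
Notation L2 := (L2 mu).
Notation slope := (slope E).
Implicit Types (f g h u v w theta : R -> R) (x y z t a b c d : R).

Let mOI := measurable_openI E.

Lemma slope_lip theta u x : (forall s t, `|theta s - theta t| <= `|s - t|) ->
  `|slope (fun x => theta (u x)) x| <= `|slope u x|.
Proof. by move=> L; rewrite /slope !normrM ler_wpM2r. Qed.

Lemma flat_short u d p : (forall a x y, E a -> E x -> E y ->
    `|x - a| < d -> `|y - a| < d -> u x = u y) -> gaps E p -> p.2 - p.1 < d ->
  u p.2 = u p.1.
Proof.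
move=> fl [p12 [E1 [E2 _]]] pd; apply: (fl p.1) => //.
  by rewrite gtr0_norm ?subr_gt0.
by rewrite subrr normr0 (lt_trans _ pd)// subr_gt0.
Qed.

(** Walk from x to y through E. If E meets [x + d/2, x + d), step to such a point, over which u does
    not vary. Otherwise cross the gap around x + d/2, where the increment is the integral of the
    slope. Each move covers at least d/2, so finitely many suffice. *)
Lemma flat_slope_prim u : flat E E u -> sqi lam OI (slope u) -> slope_prim E u.
Proof.
move=> [d d0 fl] su.
have I x y : E x -> E y -> lam.-integrable `[x, y] (EFin \o slope u).
  by move=> Ex Ey; exact: sqi_integrable_itv (sqi_OI_itv (E_Iset Ex) (E_Iset Ey) su).
have short x y : E x -> E y -> x <= y -> y - x < d ->
    u y - u x = Rintegral lam `[x, y] (slope u).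
  move=> Ex Ey xy yx; rewrite (fl x y x)//; last first.
  - by rewrite subrr normr0.
  - by rewrite ger0_norm// subr_ge0.
  rewrite subrr (@eq_Rintegral _ _ _ lam _ (fun=> 0)).
    by rewrite Rintegral_cst ?mul0r//; exact: mitvcc.
  move=> t; rewrite inE/= in_itv/= => txy.
  have [[Ot nEt]|n] := pselect (OI t /\ ~ E t); last by rewrite /slope (gapof_out n) !subrr mul0r.
  have [gp tp] := gapofP EK Ot nEt; have [h1 h2] := gap_sub_itv Ex Ey gp txy tp.
  rewrite (flat_short fl gp) ?subrr ?mul0r//.
  by apply: le_lt_trans yx; lra.
have ind n x y : E x -> E y -> x <= y -> y - x <= n%:R * (d / 2) ->
    u y - u x = Rintegral lam `[x, y] (slope u).
  elim: n x y => [|n IH] x y Ex Ey xy yn.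
    by apply: short => //; rewrite mul0r in yn; exact: le_lt_trans yn d0.
  have [yd|dy] := ltP (y - x) d; first exact: short.
  have yn' : y - x <= n%:R * (d / 2) + d / 2 by move: yn; rewrite -natr1 mulrDl mul1r.
  have [[z Ez /andP[z1 z2]]|nz] := pselect (exists2 z, E z & x + d / 2 <= z < x + d).
    have xz : x <= z by lra.
    have zy : z <= y by lra.
    rewrite (Rintegral_itv_split xz zy (I _ _ Ex Ey)) -(short x z)//; last by lra.
    rewrite -(IH z y)//; [ring|lra].
  have nE : ~ E (x + d / 2) by move=> Ed; apply: nz; exists (x + d / 2) => //; rewrite lexx/=; lra.
  have Od : OI (x + d / 2) by apply/(openIP E); exists x, y; split=> //; lra.
  have [gp /andP[p1 p2]] := gapofP EK Od nE; set p := gapof E _ in gp p1 p2.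
  have [p12 [E1 [E2 _]]] := gp.
  have xp : x <= p.1 by case: (gap_notin gp Ex) => // h; lra.
  have py : p.2 <= y by case: (gap_notin gp Ey) => // h; lra.
  have xp2 := le_trans xp (ltW p12).
  rewrite (Rintegral_itv_split xp2 py (I _ _ Ex Ey)).
  rewrite (Rintegral_itv_split xp (ltW p12) (I _ _ Ex E2)) -(short x p.1)//; last by lra.
  rewrite (slope_itv_sub EK u gp (lexx _) (ltW p12) (lexx _)) -(IH p.2 y)//; last by lra.
  by field; rewrite subr_eq0 gt_eqF.
move=> x y Ex Ey xy; apply: (ind (Num.bound ((y - x) / (d / 2)))) => //.
have d2 : 0 < d / 2 by rewrite divr_gt0.
rewrite -ler_pdivrMr//; apply: ltW; apply: archi_boundP.
by rewrite divr_ge0 ?subr_ge0// ltW.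
Qed.

(** Without a least point, E continues to the left of the compact support, and u vanishes there. *)
Lemma Cc_bcl u : Cc E u -> bcl E u.
Proof.
move=> /CcP[_ [K [cK KE K0]]] nomin _ e e0.
have [x1 [_ [Ex1 _ _]]] := exists_lt EK.
have : exists2 x0, E x0 & forall x, K x -> E x -> x0 < x.
  apply: (compact_ind (P := fun S => exists2 x0, E x0 & forall x, S x -> E x -> x0 < x)) => //.
  - by exists x1.
  - by move=> A B AB [x0 Ex0 H]; exists x0 => // x /AB; exact: H.
  - move=> A B [x0 Ex0 H] [x2 Ex2 H']; exists (Num.min x0 x2).
      by rewrite /Num.min; case: ifP.
    by move=> x [/H|/H'] h /h; rewrite gt_min => ->; rewrite ?orbT.
  - move=> x /KE Ex; have [y Ey yx] := nomin x Ex; exists (x - y); first by rewrite subr_gt0.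
    exists y => // z; rewrite /ball /= ltr_norml => /andP[_ ?] _; lra.
move=> [x0 Ex0 H]; exists x0 => // x Ex xx0; rewrite K0 ?normr0 ?ltW// => Kx.
by have := H x Kx Ex; rewrite ltNge xx0.
Qed.

Lemma Cc_bcr u : Cc E u -> bcr E u.
Proof.
move=> /CcP[_ [K [cK KE K0]]] nomax _ e e0.
have [x1 [_ [Ex1 _ _]]] := exists_lt EK.
have : exists2 x0, E x0 & forall x, K x -> E x -> x < x0.
  apply: (compact_ind (P := fun S => exists2 x0, E x0 & forall x, S x -> E x -> x < x0)) => //.
  - by exists x1.
  - by move=> A B AB [x0 Ex0 H]; exists x0 => // x /AB; exact: H.
  - move=> A B [x0 Ex0 H] [x2 Ex2 H']; exists (Num.max x0 x2).
      by rewrite /Num.max; case: ifP.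
    by move=> x [/H|/H'] h /h; rewrite lt_max => ->; rewrite ?orbT.
  - move=> x /KE Ex; have [y Ey yx] := nomax x Ex; exists (y - x); first by rewrite subr_gt0.
    exists y => // z; rewrite /ball /= ltr_norml => /andP[? _] _; lra.
move=> [x0 Ex0 H]; exists x0 => // x Ex xx0; rewrite K0 ?normr0 ?ltW// => Kx.
by have := H x Kx Ex; rewrite ltNge xx0.
Qed.

Definition step_core : set (R -> R) :=
  [set u | [/\ L2 u, Cc E u, flat E E u & sqi lam OI (slope u)]].

Lemma step_core_steprep u : step_core u -> steprep E u.
Proof.
move=> [Lu Cu fu su]; split=> //; [exact: flat_slope_prim|exact: Cc_bcl|exact: Cc_bcr].
Qed.

Lemma step_core_sub : step_core `<=` step_domain E mu.
Proof.
move=> u cu; have [Lu _ _ _] := cu; split=> //; exists u; first exact: step_core_steprep.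
exact: ae_all.
Qed.

Lemma step_core_lin : linear_class step_core.
Proof.
move=> a u v [Lu Cu fu su] [Lv Cv fv sv]; split.
- by apply: (@sqiD R mu setT) => //; exact: (@sqiZ R mu setT measurableT a u Lu).
- exact: Cc_lin.
- exact: flat_lin.
- rewrite (funext (slope_linear E a u v)); apply: sqiD => //; exact: sqiZ.
Qed.

Lemma step_core_clip v : step_core v -> step_core (clip v) /\ en (clip v) <= en v.
Proof.
move=> cv; have [Lv Cv fv sv] := cv.
have sl x : `|slope (clip v) x| <= `|slope v x|.
  by apply: (@slope_lip (fun s => Num.min (Num.max s 0) 1)); exact: clip_lip.
have sc : sqi lam OI (slope (clip v)).
  by apply: le_sqi sv => //; exact: measurable_slope.
have cc : step_core (clip v).
  split=> //; [exact: clip_L2|exact: Cc_clip|].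
  exact: (flat_comp (fun s => Num.min (Num.max s 0) 1)).
split=> //; rewrite -(ler_pM2l (ltr0n _ 2)).
rewrite -(en_step EK muE (step_core_steprep cc) (ae_all _ (fun=> erefl))).
rewrite -(en_step EK muE (step_core_steprep cv) (ae_all _ (fun=> erefl))).
by apply: le_rip => //; exact: measurable_slope.
Qed.

Lemma sqi_indic_itv (k a b : R) : sqi lam OI (fun x => k * \1_(`[a, b]%classic) x).
Proof.
have mk : measurable_fun setT (fun x : R => k * \1_(`[a, b]%classic) x).
  by apply: measurable_funM.
split=> //; have [_ fin] := sqi_cst_itv a b k; apply: le_lt_trans fin.
rewrite [leRHS]integral_mkcond.
apply: (@le_trans _ _ (\int[lam]_x ((k * \1_(`[a, b]%classic) x) ^+ 2)%:E)%E).
  apply: ge0_subset_integral => //.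
    by apply/measurable_EFinP; exact: measurable_funX.
  by move=> t _; rewrite lee_fin sqr_ge0.
rewrite le_eqVlt; apply/orP; left; apply/eqP; apply: eq_integral => x _.
by rewrite patchE indicE; case: (_ \in _); rewrite ?mulr1// mulr0 expr0n.
Qed.

(** The trapezoid for A = E works. It does not vary over gaps shorter than its flatness radius d',
    has slope at most 1 / d' on longer gaps, and no slope outside [a, b], so its energy is
    finite. *)
Lemma step_core_sep : nowhere E -> separating E step_core.
Proof.
move=> nE x r Ex r0.
have [th [Cth mth th01 [d1 d10 near1] [far0 [d d0 fl] [a [b [Ea Eb ab la rb]]]]]] :=
  trapezoid_exists EK nE Ex r0.
have fth : flat E E th.
  by exists d => // c y z Ec _ _ yc zc; case: (fl c Ec) => H; rewrite !H.
have [d' d'0 fl'] := fth.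
exists th; split.
- split=> //; first exact: Cc_L2 Cth mth.
  apply: le_sqi (sqi_indic_itv d'^-1 a b) => //; first exact: measurable_slope.
  move=> t _; have [[Ot nEt]|n] := pselect (OI t /\ ~ E t); last first.
    by rewrite {1}/slope (gapof_out n) !subrr mul0r normr0.
  have [gp tp] := gapofP EK Ot nEt; set p := gapof E t in gp tp.
  have [p12 [E1 [E2 _]]] := gp; rewrite (slope_gap th gp tp).
  have [pa|ap] := gap_notin gp Ea; last first.
    by rewrite (la _ E1 (le_trans (ltW p12) ap)) (la _ E2 ap) subrr mul0r normr0.
  have [bp|pb] := gap_notin gp Eb.
    by rewrite (rb _ E1 bp) (rb _ E2 (le_trans bp (ltW p12))) subrr mul0r normr0.
  have [ps|pl] := ltP (p.2 - p.1) d'.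
    by rewrite (flat_short fl' gp ps) subrr mul0r normr0.
  rewrite indicE mem_set; last first.
    by case/andP: tp => h1 h2; rewrite /= in_itv/= (le_trans pa (ltW h1)) (le_trans (ltW h2) pb).
  have pp : 0 < p.2 - p.1 by rewrite subr_gt0.
  have di : 0 < d'^-1 by rewrite invr_gt0.
  rewrite mulr1 normrM normrV ?unitfE ?gt_eqF// (gtr0_norm pp) (gtr0_norm di).
  rewrite -[leRHS]mul1r; apply: ler_pM; rewrite ?normr_ge0 ?invr_ge0 ?(ltW pp)//; last first.
    by rewrite lef_pV2 ?posrE.
  have /andP[? ?] := th01 p.1; have /andP[? ?] := th01 p.2.
  by rewrite ler_norml; apply/andP; split; lra.
- by move=> y _; exact: th01.
- by exists d1 => // y _; exact: near1.
- by move=> y _; exact: far0.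
Qed.

End StepCore.

Lemma real_cauchy (R : realType) (a : nat -> R) :
  (forall e : R, 0 < e -> exists N, forall m n, (N <= m)%N -> (N <= n)%N -> `|a n - a m| < e) ->
  cvgn a.
Proof.
move=> H; apply/cauchy_cvgP; apply: cauchy_exP => e e0; have [N HN] := H e e0.
by exists (a N), N => // n Nn; rewrite /ball/= distrC; exact: HN.
Qed.

Lemma fatou_sqr (R : realType) (m : {measure set (measurableTypeR R) -> \bar R})
    (D : set (measurableTypeR R)) (h : nat -> R -> R) (k : R -> R) (c : R) (N : nat) :
  measurable D -> (forall n, measurable_fun setT (h n)) -> measurable_fun setT k ->
  (forall x, D x -> (fun n => h n x) @ \oo --> k x) ->
  (forall n, (N <= n)%N -> sqi m D (h n) /\ rip m D (h n) (h n) <= c) ->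
  sqi m D k /\ rip m D k k <= c.
Proof.
move=> mD mh mk hk H.
have mX (f : R -> R) : measurable_fun setT f ->
    measurable_fun D (fun x : measurableTypeR R => (f x ^+ 2)%:E).
  by move=> mf; apply/measurable_EFinP; apply: measurable_funS (measurable_funX 2 mf).
have le : (\int[m]_(x in D) (k x ^+ 2)%:E <= c%:E)%E.
  rewrite (eq_integral (fun x : measurableTypeR R => limn_einf (fun n => (h n x ^+ 2)%:E))); last first.
    move=> x /set_mem Dx; apply/esym; apply: (cvg_limn_einf_sup _).1.
    apply: cvg_EFin; first exact: nearW.
    have hx := hk x Dx.
    by rewrite expr2; under eq_fun do rewrite /= expr2; exact: cvgM.
  have := @fatou _ _ _ m D mD (fun n x => (h n x ^+ 2)%:E) (fun n => mX _ (mh n))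
    (fun n x _ => sqr_ge0 (h n x)).
  move=> /le_trans; apply; rewrite limn_einf_lim; apply: lime_le; first exact: is_cvg_einfs.
  apply: nearW => n; pose n' := maxn n N.
  apply: (@le_trans _ _ (\int[m]_(x in D) (h n' x ^+ 2)%:E)%E).
    by apply: ereal_inf_lbound; exists n' => //=; exact: leq_maxl.
  have [s l] := H n' (leq_maxr _ _).
  by rewrite (integral_sqr_rip mD s) lee_fin.
have sk : sqi m D k by split=> //; exact: le_lt_trans le (ltry _).
by split=> //; rewrite -lee_fin -integral_sqr_rip.
Qed.

Lemma cvg_norm_le (R : realType) (a : nat -> R) (l e : R) (N : nat) : a @ \oo --> l ->
  (forall n, (N <= n)%N -> `|a n| <= e) -> `|l| <= e.
Proof.
move=> al H; rewrite leNgt; apply/negP => h.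
have d0 : 0 < `|l| - e by rewrite subr_gt0.
have /cvgrPdist_lt/(_ _ d0)[M _ HM] := al.
have := HM _ (leq_maxl M N); have := H _ (leq_maxr M N).
by have := ler_normD (l - a (maxn M N)) (a (maxn M N)); rewrite /= subrK; lra.
Qed.

(** * Completeness of the step domain *)

Section StepComplete.
Variables (R : realType) (E : set R)
  (mu : {measure set (measurableTypeR R) -> \bar R}).
Hypothesis EK : inK E.
Hypothesis muE : radon_full E mu.
Notation lam := (leb R).
Notation OI := (openI E).
Notation en := (en E mu).
Notation L2 := (L2 mu).
Notation slope := (slope E).
Notation sc := (sc E).
Implicit Types (f g h u v w : R -> R) (x y z t a b c d : R).

Let mOI := measurable_openI E.

(** Since the slope vanishes on E, Cauchy-Schwarz can be applied against [gap_density] instead of 1,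
    which replaces the Euclidean distance by the increment of [sc]. *)
Lemma sc_holder u x y : steprep E u -> E x -> E y -> x <= y ->
  (u y - u x) ^+ 2 <= (sc y - sc x) * rip lam OI (slope u) (slope u).
Proof.
move=> [su pu _ _] Ex Ey xy; have [Ix Iy] := (E_Iset Ex, E_Iset Ey).
have ss := sqi_OI_itv Ix Iy su; have sg := sqi_gap_density EK x y.
rewrite (pu x y)// (sc_incr EK)//.
have -> : Rintegral lam `[x, y] (slope u) = rip lam `[x, y] (gap_density E) (slope u).
  apply: eq_Rintegral => t _; have [Et|nEt] := pselect (E t).
    by rewrite -[LHS]/(slope u t) (slope_E u Et) mulr0.
  by rewrite gap_densityNE// mul1r.
apply: le_trans (rip_cs (mitvcc x y) sg ss) _.
rewrite (_ : rip lam `[x, y] (gap_density E) (gap_density E) =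
    Rintegral lam `[x, y] (gap_density E)); last first.
  apply: eq_Rintegral => t _; rewrite -[RHS]/(gap_density E t) -[LHS]/(gap_density E t * gap_density E t).
  by case: (gap_density01 E t) => ->; rewrite ?mulr0 ?mulr1.
apply: ler_wpM2l; last exact: rip_itv_le.
by apply: Rintegral_ge0 => t _; exact: gap_density_ge0.
Qed.

Lemma sqr_le_limit s (B : R) : (forall e : R, 0 < e -> exists2 r, `|r| <= e & (s - r) ^+ 2 <= B) ->
  s ^+ 2 <= B.
Proof.
move=> H; rewrite leNgt; apply/negP => Bs.
have B0 : 0 <= B by have [r _] := H 1 ltr01; exact: le_trans (sqr_ge0 _).
have s0 : 0 < `|s|.
  by rewrite normr_gt0; apply: contraTneq Bs => ->; rewrite expr0n -leNgt.
rewrite -real_normK ?num_real// in Bs.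
pose e := (`|s| ^+ 2 - B) / (2 * `|s|).
have e0 : 0 < e by rewrite divr_gt0 ?mulr_gt0// subr_gt0.
have es : e * (2 * `|s|) = `|s| ^+ 2 - B by rewrite /e divfK// mulf_neq0// gt_eqF.
have [r re] := H e e0.
have : `|s| - e <= `|s - r|.
  by have := ler_normD (s - r) r; rewrite subrK; lra.
have : 0 <= `|s| - e by nra.
by rewrite -[(s - r) ^+ 2]real_normK ?num_real//; nra.
Qed.

(** The left point in [sc_holder] moves to the left end, where [bcl] makes u small. Being uniform in
    terms of the energy, the bound lets the boundary condition survive limits. *)
Lemma bcl_bound u c x : steprep E u -> (forall x, E x -> exists2 y, E y & y < x) ->
  (forall x, E x -> c <= sc x) -> E x ->
  u x ^+ 2 <= (sc x - c) * rip lam OI (slope u) (slope u).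
Proof.
move=> su nomin cE Ex; apply: sqr_le_limit => e e0.
have [_ _ bl _] := su; have [|x0 Ex0 H] := bl nomin _ e e0; first by exists c.
have [y [Ey yx yx0]] : exists y, [/\ E y, y <= x & y <= x0].
  by have [h|/ltW h] := leP x x0; [exists x|exists x0].
exists (u y); first exact: H.
apply: le_trans (sc_holder su Ey Ex yx) _; apply: ler_wpM2r; first exact: rip_ge0.
by rewrite lerB// cE.
Qed.

Lemma bcr_bound u c x : steprep E u -> (forall x, E x -> exists2 y, E y & x < y) ->
  (forall x, E x -> sc x <= c) -> E x ->
  u x ^+ 2 <= (c - sc x) * rip lam OI (slope u) (slope u).
Proof.
move=> su nomax cE Ex; apply: sqr_le_limit => e e0.
have [_ _ _ br] := su; have [|x0 Ex0 H] := br nomax _ e e0; first by exists c.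
have [y [Ey yx yx0]] : exists y, [/\ E y, x <= y & x0 <= y].
  by have [h|/ltW h] := leP x0 x; [exists x|exists x0].
exists (u y); first exact: H.
rewrite -sqrrN opprB; apply: le_trans (sc_holder su Ex Ey yx) _; apply: ler_wpM2r; first exact: rip_ge0.
by rewrite lerB// cE.
Qed.

Lemma steprep_cont_on u : steprep E u -> cont_on E u.
Proof.
move=> su x Ex e e0; have [d d0 H] := adm_cont_on (adm_lin EK su) Ex e0.
by exists d => // y Ey /(H y Ey); rewrite !lin_E.
Qed.

Lemma steprepB u v : steprep E u -> steprep E v -> steprep E (fun x => u x - v x).
Proof.
move=> su sv; rewrite (_ : (fun x => _) = (fun x => (-1) * v x + u x)).
  exact: steprep_lin.
by apply/funext => x; ring.
Qed.

Lemma slopeB u v x : slope (fun x => u x - v x) x = slope u x - slope v x.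
Proof. by rewrite /slope; ring. Qed.

Lemma slope_cvg (w : nat -> R -> R) k x :
  (forall x, E x -> (fun n => w n x) @ \oo --> k x) -> OI x ->
  (fun n => slope (w n) x) @ \oo --> slope k x.
Proof.
move=> H Ox; have [Ex|nEx] := pselect (E x).
  by rewrite slope_E//; under eq_fun do rewrite slope_E//; exact: cvg_cst.
have [[_ [E1 [E2 _]]] _] := gapofP EK Ox nEx.
by rewrite /slope; apply: cvgMl; apply: cvgB; exact: H.
Qed.

(** Pointwise convergence on E makes the slopes converge, and Fatou turns the Cauchy property into
    energy convergence to k. Increments then pass to the limit by Hoelder, boundary conditions by
    [bcl_bound] and [bcr_bound]. *)
Lemma step_limit (w : nat -> R -> R) k : (forall n, steprep E (w n)) ->
  (forall x, E x -> (fun n => w n x) @ \oo --> k x) ->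
  (forall e : R, 0 < e -> exists N, forall m n, (N <= m)%N -> (N <= n)%N ->
    rip lam OI (slope (fun x => w n x - w m x)) (slope (fun x => w n x - w m x)) <= e) ->
  steprep E k /\ forall e : R, 0 < e -> exists N, forall n, (N <= n)%N ->
    rip lam OI (slope (fun x => w n x - k x)) (slope (fun x => w n x - k x)) <= e.
Proof.
move=> sw wk H.
have K (e : R) : 0 < e -> exists N, forall m, (N <= m)%N ->
    sqi lam OI (slope (fun x => k x - w m x)) /\
    rip lam OI (slope (fun x => k x - w m x)) (slope (fun x => k x - w m x)) <= e.
  move=> e0; have [N HN] := H e e0; exists N => m Nm.
  apply: (@fatou_sqr R lam OI (fun n => slope (fun x => w n x - w m x)) _ e N) => //.
  - by move=> n; exact: measurable_slope.
  - exact: measurable_slope.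
  - move=> x Ox; apply: slope_cvg => // z Ez; apply: cvgB; first exact: wk.
    exact: cvg_cst.
  - by move=> n Nn; split; [case: (steprepB (sw n) (sw m))|exact: HN].
have sk : sqi lam OI (slope k).
  have [N /(_ N (leqnn N))[s _]] := K 1 ltr01; have [sN _ _ _] := sw N.
  have := sqiD mOI s sN; congr (sqi _ _ _); apply/funext => x.
  by rewrite slopeB subrK.
have rN (e : R) : 0 < e -> exists N, forall n, (N <= n)%N ->
    rip lam OI (slope (fun x => w n x - k x)) (slope (fun x => w n x - k x)) <= e.
  move=> e0; have [N HN] := K e e0; exists N => n /HN[_]; congr (_ <= _).
  by apply: eq_Rintegral => x _; rewrite !slopeB; ring.
split=> //; split=> //.
- move=> x y Ex Ey xy; have [Ix Iy] := (E_Iset Ex, E_Iset Ey).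
  have ik := sqi_integrable_itv (sqi_OI_itv Ix Iy sk).
  have c1 : (fun n => w n y - w n x) @ \oo --> k y - k x by apply: cvgB; exact: wk.
  apply: (cvg_unique _ c1) => //; apply/cvgrPdist_lt => e e0.
  have yx : 0 < y - x + 1 by rewrite ltr_wpDl// subr_ge0.
  have e1 : 0 < e ^+ 2 / (y - x + 1) by rewrite divr_gt0// exprn_gt0.
  have [N HN] := K _ e1; exists N => // n /HN[s l].
  have [swn pw _ _] := sw n; rewrite /= (pw x y)//.
  have iw := sqi_integrable_itv (sqi_OI_itv Ix Iy swn).
  rewrite -(RintegralB (mitvcc x y) ik iw).
  apply: sqr_lt_norm; first exact: ltW.
  have -> : Rintegral lam `[x, y] (fun t => slope k t - slope (w n) t) =
    Rintegral lam `[x, y] (slope (fun x => k x - w n x)).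
    by apply: eq_Rintegral => t _; exact: esym (slopeB k (w n) t).
  apply: le_lt_trans (holder_OI Ix Iy xy s) _.
  apply: (@le_lt_trans _ _ ((y - x) * (e ^+ 2 / (y - x + 1)))).
    by rewrite ler_wpM2l// subr_ge0.
  by rewrite mulrA ltr_pdivrMr// mulrC ltr_pM2l ?exprn_gt0// ltrDl.
- move=> nomin [c cE] e e0; have [x1 [_ [Ex1 _ _]]] := exists_lt EK.
  have S0 : 0 < sc x1 - c + 1 by rewrite ltr_wpDl// subr_ge0 cE.
  have e1 : 0 < (e / 2) ^+ 2 / (sc x1 - c + 1) by rewrite divr_gt0// exprn_gt0// divr_gt0.
  have [N HN] := H _ e1.
  have [_ _ bN _] := sw N; have e2 : 0 < e / 2 by rewrite divr_gt0.
  have [|x2 Ex2 H2] := bN nomin _ _ e2; first by exists c.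
  have [x0 [Ex0 x01 x02]] : exists y, [/\ E y, y <= x1 & y <= x2].
    by have [h|/ltW h] := leP x1 x2; [exists x1|exists x2].
  exists x0 => // x Ex xx0.
  have le n : (N <= n)%N -> `|w n x - w N x| <= e / 2.
    move=> Nn; rewrite -(@ler_pXn2r _ 2)// ?nnegrE ?(ltW e2)// real_normK ?num_real//.
    apply: le_trans (bcl_bound (steprepB (sw n) (sw N)) nomin cE Ex) _.
    apply: (@le_trans _ _ ((sc x1 - c + 1) * ((e / 2) ^+ 2 / (sc x1 - c + 1)))); last first.
      by rewrite mulrC divfK// gt_eqF.
    apply: ler_pM; [by rewrite subr_ge0 cE|exact: rip_ge0| |exact: HN].
    have : sc x <= sc x1 by apply: (sc_le EK); exact: le_trans xx0 x01.
    by move=> h; rewrite -addrA lerD// lerDl.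
  have : `|k x - w N x| <= e / 2.
    apply: (cvg_norm_le _ le); apply: cvgB; first exact: wk.
    exact: cvg_cst.
  have := H2 x Ex (le_trans xx0 x02); have := ler_normD (k x - w N x) (w N x).
  by rewrite subrK; lra.
- move=> nomax [c cE] e e0; have [x1 [_ [Ex1 _ _]]] := exists_lt EK.
  have S0 : 0 < c - sc x1 + 1 by rewrite ltr_wpDl// subr_ge0 cE.
  have e1 : 0 < (e / 2) ^+ 2 / (c - sc x1 + 1) by rewrite divr_gt0// exprn_gt0// divr_gt0.
  have [N HN] := H _ e1.
  have [_ _ _ bN] := sw N; have e2 : 0 < e / 2 by rewrite divr_gt0.
  have [|x2 Ex2 H2] := bN nomax _ _ e2; first by exists c.
  have [x0 [Ex0 x01 x02]] : exists y, [/\ E y, x1 <= y & x2 <= y].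
    by have [h|/ltW h] := leP x2 x1; [exists x1|exists x2].
  exists x0 => // x Ex xx0.
  have le n : (N <= n)%N -> `|w n x - w N x| <= e / 2.
    move=> Nn; rewrite -(@ler_pXn2r _ 2)// ?nnegrE ?(ltW e2)// real_normK ?num_real//.
    apply: le_trans (bcr_bound (steprepB (sw n) (sw N)) nomax cE Ex) _.
    apply: (@le_trans _ _ ((c - sc x1 + 1) * ((e / 2) ^+ 2 / (c - sc x1 + 1)))); last first.
      by rewrite mulrC divfK// gt_eqF.
    apply: ler_pM; [by rewrite subr_ge0 cE|exact: rip_ge0| |exact: HN].
    have : sc x1 <= sc x by apply: (sc_le EK); exact: le_trans x01 xx0.
    by lra.
  have : `|k x - w N x| <= e / 2.
    apply: (cvg_norm_le _ le); apply: cvgB; first exact: wk.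
    exact: cvg_cst.
  have := H2 x Ex (le_trans x02 xx0); have := ler_normD (k x - w N x) (w N x).
  by rewrite subrK; lra.
Qed.

(** [eval_bound] makes a form Cauchy sequence converge pointwise on E. This one limit serves for the
    energy by [step_limit] and for L2 by Fatou; its extension by zero supplies a measurable member
    of the class. *)
Lemma step_complete : form_complete E mu (step_domain E mu).
Proof.
move=> u Fu C.
have /choice[w Hw] : forall n, exists w, steprep E w /\ aeeq mu (u n) w.
  by move=> n; have [_ [w sw uw]] := Fu n; exists w.
have sw n := (Hw n).1; have uw n := (Hw n).2.
have ud m n : aeeq mu (fun x => u n x - u m x) (fun x => w n x - w m x).
  by apply: ae_imp2 (uw n) (uw m) => x -> ->.
have Lu n : L2 (u n) by case: (Fu n).
have Fd n := step_domain_Fdom EK muE (Fu n).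
have cw x : E x -> cvgn (fun n => w n x).
  move=> Ex; apply: real_cauchy => e e0; have [c c0 ev] := eval_bound EK muE Ex.
  have [|N HN] := C (e ^+ 2 / c); first by rewrite divr_gt0// exprn_gt0.
  exists N => m n Nm Nn; apply: sqr_lt_norm; first exact: ltW.
  have swd := steprepB (sw n) (sw m).
  have := ev _ _ _ (FdomB (Fd n) (Fd m)) (adm_lin EK swd) (aeeq_lin EK muE (ud m n)).
  rewrite lin_E// => /le_lt_trans; apply.
  by rewrite mulrC -ltr_pdivlMr//; exact: HN.
pose k x := limn (fun n => w n x).
have wk x : E x -> (fun n => w n x) @ \oo --> k x by move=> Ex; exact: cw.
have [sk kN] : steprep E k /\ forall e : R, 0 < e -> exists N, forall n, (N <= n)%N ->
    rip lam OI (slope (fun x => w n x - k x)) (slope (fun x => w n x - k x)) <= e.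
  apply: step_limit => // e e0; have e2 : 0 < e / 2 by rewrite divr_gt0.
  have [N HN] := C _ e2; exists N => m n Nm Nn.
  rewrite (en_step EK muE (steprepB (sw n) (sw m)) (ud m n)).
  have := HN m n Nm Nn; rewrite q1E.
  by have := nrm2_ge0 mu (fun x => u n x - u m x); lra.
pose r f := f \_ E; have mr f : steprep E f -> measurable_fun setT (r f).
  by move=> sf; apply: cont_on_measurable => //; exact: steprep_cont_on.
have rE f x : E x -> r f x = f x by move=> Ex; rewrite /r patchE mem_set.
have ur n : aeeq mu (u n) (r (w n)).
  by apply: aeeq_trans (uw n) _; apply: (aeeq_on EK muE) => x Ex; rewrite rE.
have Lr n : L2 (r (w n)).
  by apply: (eq_sqi_ae measurableT (mr _ (sw n)) _ (Lu n)); apply: ae_imp (ur n) => x ->.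
have nN (e : R) : 0 < e -> exists N, forall m, (N <= m)%N ->
    L2 (fun x => r k x - r (w m) x) /\ nrm2 mu (fun x => r k x - r (w m) x) <= e.
  move=> e0; have [N HN] := C e e0; exists N => m Nm.
  apply: (@fatou_sqr R mu setT (fun n x => r (w n) x - r (w m) x) _ e N) => //.
  - by move=> n; apply: measurable_funB; apply: mr.
  - by apply: measurable_funB; exact: mr.
  - move=> x _; apply: cvgB; last exact: cvg_cst.
    have [Ex|nEx] := pselect (E x).
      by rewrite rE//; under eq_fun do rewrite rE//; exact: wk.
    by rewrite /r patchE memNset//; under eq_fun do rewrite patchE memNset//; exact: cvg_cst.
  - move=> n Nn; split; first exact: (sqiB (m := mu) measurableT (Lr n) (Lr m)).
    rewrite -[rip _ _ _ _]/(nrm2 mu (fun x => r (w n) x - r (w m) x)).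
    have -> : nrm2 mu (fun x => r (w n) x - r (w m) x) = nrm2 mu (fun x => u n x - u m x).
      have Ls v v' : L2 v -> L2 v' -> L2 (fun x => v x - v' x).
        by move=> Lv Lv'; exact: (sqiB (m := mu) measurableT Lv Lv').
      apply: ip_aeeq; try exact: Ls.
        by apply: ae_imp2 (ur n) (ur m) => x -> ->.
      by apply: ae_imp2 (ur n) (ur m) => x -> ->.
    have := HN m n Nm Nn; rewrite q1E => /ltW; apply: le_trans.
    by rewrite lerDr (en_ge0 EK muE)//; exact: FdomB.
have Lk : L2 (r k).
  have [N /(_ N (leqnn N))[s _]] := nN 1 ltr01.
  have := sqiD (m := mu) measurableT s (Lr N).
  by congr (sqi _ _ _); apply/funext => x; rewrite subrK.
have rk : aeeq mu (r k) k by apply: (aeeq_on EK muE) => x Ex; rewrite rE.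
exists (r k); split; first by split=> //; exists k.
move=> e e0; have e2 : 0 < e / 2 by rewrite divr_gt0.
have [N1 H1] := kN _ e2; have [N2 H2] := nN _ e2.
exists (maxn N1 N2) => n; rewrite geq_max => /andP[/H1 h1 /H2[_ h2]].
have ad : aeeq mu (fun x => u n x - r k x) (fun x => w n x - k x).
  by apply: ae_imp2 (uw n) rk => x -> ->.
move: h1; rewrite (en_step EK muE (steprepB (sw n) sk) ad) q1E.
have -> : nrm2 mu (fun x => u n x - r k x) = nrm2 mu (fun x => r k x - r (w n) x).
  rewrite nrm2_sub_sym; apply: ip_aeeq.
  - exact: (sqiB (m := mu) measurableT Lk (Lu n)).
  - exact: (sqiB (m := mu) measurableT Lk (Lr n)).
  - exact: (sqiB (m := mu) measurableT Lk (Lu n)).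
  - exact: (sqiB (m := mu) measurableT Lk (Lr n)).
  - by apply: ae_imp (ur n) => x ->.
  - by apply: ae_imp (ur n) => x ->.
by move: h2 e2; lra.
Qed.

End StepComplete.

(** * Approximation by step functions *)

Lemma rip_vanish (R : realType) (m : {measure set (measurableTypeR R) -> \bar R})
    (D : set (measurableTypeR R)) (h : nat -> R -> R) (g : R -> R) (e : R) :
  measurable D -> (forall n, measurable_fun setT (h n)) -> sqi m D g ->
  (forall n x, D x -> `|h n x| <= `|g x|) ->
  (forall x, D x -> exists N, forall n, (N <= n)%N -> h n x = 0) -> 0 < e ->
  exists n, rip m D (h n) (h n) < e.
Proof.
move=> mD mh sg hg h0 e0.
have := @dominated_convergence _ _ _ m D mD (fun n x => (h n x ^+ 2)%:E) (cst 0%E)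
  (fun x => (g x ^+ 2)%:E).
case.
- move=> n; apply/measurable_EFinP; apply: measurable_funS (measurable_funX 2 (mh n)) => //.
- exact: measurable_cst.
- apply: ae_all => x Dx; apply/fine_cvgP; split; first exact: nearW.
  apply/cvgrPdist_le => d d0; have [N HN] := h0 x Dx.
  by exists N => // n /HN hn; rewrite /= hn expr0n subrr normr0 ltW.
- exact: sqi_integrable_sqr.
- apply: ae_all => x Dx n; rewrite /= lee_fin ger0_norm ?sqr_ge0//.
  rewrite -[leLHS]real_normK ?num_real// -[leRHS]real_normK ?num_real//.
  by rewrite lerXn2r ?nnegrE// hg.
move=> _ _; rewrite integral0 => /fine_cvgP[_ /cvgrPdist_lt /(_ e e0)[N _ HN]].
exists N; have sh : sqi m D (h N) by exact: (le_sqi mD (mh N) (hg N) sg).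
have := HN N (leqnn N); rewrite /= sub0r normrN integral_sqr_rip//= ger0_norm//.
exact: rip_ge0.
Qed.

Section Clamp.
Variables (R : realType) (a b : R).
Hypothesis ab : a <= b.
Implicit Types x y : R.

Definition clamp x := Num.min (Num.max x a) b.

Lemma clamp_cases x :
  [\/ x <= a /\ clamp x = a, a <= x <= b /\ clamp x = x | b <= x /\ clamp x = b].
Proof.
rewrite /clamp; have [h|/ltW h] := leP x a; first by apply: Or31; rewrite min_l.
by have [h'|/ltW h'] := leP x b; [apply: Or32; rewrite h|apply: Or33].
Qed.

Lemma clamp_left x : x <= a -> clamp x = a.
Proof. by move=> xa; rewrite /clamp max_r// min_l. Qed.

Lemma clamp_right x : b <= x -> clamp x = b.
Proof. by move=> bx; rewrite /clamp max_l ?min_r//; exact: le_trans ab bx. Qed.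

Lemma clamp_id x : a <= x -> x <= b -> clamp x = x.
Proof. by move=> ax xb; rewrite /clamp max_l ?min_l. Qed.

Lemma clamp_itv x : a <= clamp x <= b.
Proof. by case: (clamp_cases x) => -[h ->]; rewrite ?lexx ?ab. Qed.

Lemma clamp_le x y : x <= y -> clamp x <= clamp y.
Proof.
move=> xy; case: (clamp_cases x) => -[hx ->]; case: (clamp_cases y) => -[hy ->];
  try (move: hx; case/andP); try (move: hy; case/andP); move: xy ab; lra.
Qed.

Lemma clamp_sub x y : x <= y -> clamp y - clamp x <= y - x.
Proof.
move=> xy; case: (clamp_cases x) => -[hx ->]; case: (clamp_cases y) => -[hy ->];
  try (move: hx; case/andP); try (move: hy; case/andP); move: xy ab; lra.
Qed.

End Clamp.

Lemma clamp_const (R : realType) (a x : R) : clamp a a x = a.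
Proof. by rewrite /clamp min_r// le_max lexx orbT. Qed.

(** * Discarding the short gaps *)

Section StepTruncation.
Variables (R : realType) (E : set R).
Hypothesis EK : inK E.
Notation lam := (leb R).
Notation OI := (openI E).
Notation slope := (slope E).
Implicit Types (f g h u v w : R -> R) (x y z t a b c d : R).

Definition long_slope u d t :=
  slope u t * (if d <= (gapof E t).2 - (gapof E t).1 then 1 else 0).

Lemma measurable_long_slope u d : measurable_fun setT (long_slope u d).
Proof.
exact: (measurable_gapof EK (fun p => (u p.2 - u p.1) / (p.2 - p.1) *
  (if d <= p.2 - p.1 then 1 else 0))).
Qed.

Lemma long_slope_cases u d t : long_slope u d t = slope u t \/ long_slope u d t = 0.
Proof. by rewrite /long_slope; case: ifP => _; [left; rewrite mulr1|right; rewrite mulr0]. Qed.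

Lemma long_slope_le u d t : `|long_slope u d t| <= `|slope u t|.
Proof. by case: (long_slope_cases u d t) => ->; rewrite ?normr0. Qed.

Lemma Rintegral0_itv h x y : (forall t, x <= t <= y -> h t = 0) ->
  Rintegral lam `[x, y] h = 0.
Proof.
move=> H; rewrite (@eq_Rintegral _ _ _ lam _ (fun=> 0)).
  by rewrite Rintegral_cst ?mul0r//; exact: mitvcc.
by move=> t; rewrite inE/= in_itv/=; exact: H.
Qed.

Lemma long_slope_short u d x y : E x -> E y -> y - x < d ->
  Rintegral lam `[x, y] (long_slope u d) = 0.
Proof.
move=> Ex Ey yx; apply: Rintegral0_itv => t txy.
have [[Ot nEt]|n] := pselect (OI t /\ ~ E t); last first.
  by rewrite /long_slope /slope (gapof_out n) !subrr !mul0r.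
have [gp tp] := gapofP EK Ot nEt; have [h1 h2] := gap_sub_itv Ex Ey gp txy tp.
by rewrite /long_slope ifF ?mulr0//; apply/negP => h; lra.
Qed.

Lemma long_slope_gap u d p : gaps E p -> Rintegral lam `[p.1, p.2] (long_slope u d) =
  if d <= p.2 - p.1 then u p.2 - u p.1 else 0.
Proof.
move=> gp; rewrite -Rintegral_itv_oo; last exact: measurable_long_slope.
have H t : p.1 < t < p.2 -> long_slope u d t = slope u t * (if d <= p.2 - p.1 then 1 else 0).
  by move=> tp; rewrite /long_slope (gapof_eq gp tp).
case: ifP H => _ H.
  rewrite -(slope_itv_gap u gp); apply: eq_Rintegral => t; rewrite inE/= in_itv/= => tp.
  by rewrite -[LHS]/(long_slope u d t) H// mulr1.
rewrite (@eq_Rintegral _ _ _ lam _ (fun=> 0)).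
  by rewrite Rintegral_cst// mul0r.
by move=> t; rewrite inE/= in_itv/= => tp; rewrite -[LHS]/(long_slope u d t) H// mulr0.
Qed.

(** w is the primitive of the slopes of gaps of length at least d, stopped at x0 and y0. The
    discarded slopes tend to 0 in L2 as d decreases, which bounds the error uniformly by
    Cauchy-Schwarz. Hypotheses are confined to [x0, y0] so that [sc] is an admissible u as well. *)
Lemma step_truncation u x0 y0 (e : R) : E x0 -> E y0 -> x0 <= y0 -> 0 < e ->
  sqi lam `[x0, y0] (slope u) ->
  (forall x, E x -> x0 <= x <= y0 -> u x - u x0 = Rintegral lam `[x0, x] (slope u)) ->
  exists w, [/\ flat E E w, forall x, E x -> x0 <= x <= y0 -> `|w x - u x| <= e,
    forall x, x <= x0 -> w x = u x0, forall x, y0 <= x -> w x = w y0 &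
    forall t, slope w t = 0 \/ x0 < t < y0 /\ slope w t = slope u t].
Proof.
move=> Ex0 Ey0 xy0 e0 su pu.
have mxy := mitvcc x0 y0.
have sk d : sqi lam `[x0, y0] (long_slope u d).
  apply: le_sqi su => //; first exact: measurable_long_slope.
  by move=> t _; exact: long_slope_le.
have [d d0 rd] : exists2 d : R, 0 < d & rip lam `[x0, y0] (fun t => long_slope u d t - slope u t)
    (fun t => long_slope u d t - slope u t) * (y0 - x0) <= e ^+ 2.
  have c0 : 0 < y0 - x0 + 1 by rewrite ltr_wpDl// subr_ge0.
  have [||||n rn] := @rip_vanish R lam `[x0, y0]
     (fun n t => long_slope u n.+1%:R^-1 t - slope u t) (slope u) (e ^+ 2 / (y0 - x0 + 1)) mxy _ su.
  - by move=> n; apply: measurable_funB; [exact: measurable_long_slope|exact: measurable_slope].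
  - move=> n t _; case: (long_slope_cases u n.+1%:R^-1 t) => ->; rewrite ?subrr ?normr0//.
    by rewrite sub0r normrN.
  - move=> t txy; have [[Ot nEt]|no] := pselect (OI t /\ ~ E t); last first.
      by exists 0%N => n _; rewrite /long_slope /slope (gapof_out no) !subrr !mul0r subrr.
    have [[p12 _] _] := gapofP EK Ot nEt; rewrite -subr_gt0 in p12.
    have iP : 0 < ((gapof E t).2 - (gapof E t).1)^-1 by rewrite invr_gt0.
    exists (Num.bound ((gapof E t).2 - (gapof E t).1)^-1) => n Nn.
    rewrite /long_slope ifT ?mulr1 ?subrr// invf_ple ?posrE//.
    apply: ltW; apply: lt_le_trans (archi_boundP (ltW iP)) _.
    by rewrite ler_nat (leq_trans Nn).
  - by rewrite divr_gt0// exprn_gt0.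
  exists n.+1%:R^-1 => //.
  apply: (@le_trans _ _ (e ^+ 2 / (y0 - x0 + 1) * (y0 - x0 + 1))).
    apply: ler_pM; [exact: rip_ge0|by rewrite subr_ge0|exact: ltW|].
    by rewrite lerDl.
  by rewrite divfK// gt_eqF.
pose cl := clamp x0 y0.
have Ecl x : E x -> E (cl x) by rewrite /cl; case: (clamp_cases xy0 x) => -[_ ->].
have cl01 x : x0 <= cl x <= y0 by exact: clamp_itv.
have cl_le x y : x <= y -> cl x <= cl y by exact: clamp_le.
have clB x y : x <= y -> cl y - cl x <= y - x by exact: clamp_sub.
pose w x := u x0 + Rintegral lam `[x0, cl x] (long_slope u d).
have ik x y : x0 <= x -> y <= y0 -> lam.-integrable `[x, y] (EFin \o long_slope u d).
  by move=> h1 h2; apply: integrable_itvS h1 h2 (sqi_integrable_itv (sk d)).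
have wB x y : x <= y -> w y - w x = Rintegral lam `[cl x, cl y] (long_slope u d).
  move=> xy; have /andP[h1 h2] := cl01 x; have /andP[h3 h4] := cl01 y.
  by rewrite /w (Rintegral_itv_split h1 (cl_le _ _ xy) (ik _ _ (lexx _) h4)); ring.
exists w; split.
(* Two points of E within d/2 of a common point are less than d apart, so no long gap fits between
   them. *)
- exists (d / 2); first by rewrite divr_gt0.
  move=> a x y _; wlog xy : x y / x <= y => [H Ex Ey h1 h2|].
    by have [h|/ltW h] := leP x y; [exact: H|symmetry; exact: H].
  move=> Ex Ey; rewrite !ltr_norml => /andP[h1 h2] /andP[h3 h4].
  apply/esym/eqP; rewrite -subr_eq0 (wB x y)// long_slope_short//; try exact: Ecl.
  by apply: le_lt_trans (clB _ _ xy) _; lra.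
- move=> x Ex /andP[x0x xy].
  have clx : cl x = x by exact: clamp_id.
  have -> : w x - u x = Rintegral lam `[x0, x] (fun t => long_slope u d t - slope u t).
    have iu : lam.-integrable `[x0, x] (EFin \o slope u).
      by apply: integrable_itvS (lexx _) xy (sqi_integrable_itv su).
    rewrite (RintegralB (mitvcc x0 x) (ik _ _ (lexx _) xy) iu).
    by rewrite -pu// ?x0x// /w clx; ring.
  have sd : sqi lam `[x0, y0] (fun t => long_slope u d t - slope u t) by exact: sqiB.
  have sub : `[x0, x] `<=` `[x0, y0].
    by move=> t /=; rewrite !in_itv/= => /andP[-> h]; rewrite (le_trans h).
  have sdx : sqi lam `[x0, x] (fun t => long_slope u d t - slope u t).
    split; first by case: sd.
    case: sd => md; apply: le_lt_trans; apply: ge0_subset_integral => //.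
    - by apply/measurable_EFinP; apply: measurable_funS (measurable_funX 2 md).
    - by move=> t _; rewrite lee_fin sqr_ge0.
  rewrite -(@ler_pXn2r _ 2)// ?nnegrE ?(ltW e0)// real_normK ?num_real//.
  apply: le_trans (sqi_itv_cs x0x sdx) _; apply: le_trans rd; rewrite mulrC.
  apply: ler_pM; rewrite ?rip_ge0 ?subr_ge0 ?lerB//.
  rewrite -lee_fin -!integral_sqr_rip//.
  apply: ge0_subset_integral => //.
  - by apply/measurable_EFinP; apply: measurable_funS (measurable_funX 2 sd.1).
  - by move=> t _; rewrite lee_fin sqr_ge0.
- move=> x xx0; have clx : cl x = x0 by exact: clamp_left.
  by rewrite /w clx long_slope_short ?addr0// subrr.
- move=> x yx; rewrite /w (_ : cl x = cl y0)//.
  by rewrite /cl !clamp_right.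
- move=> t; have [[Ot nEt]|n] := pselect (OI t /\ ~ E t); last first.
    by left; rewrite /slope (gapof_out n) !subrr mul0r.
  have [gp tp] := gapofP EK Ot nEt; move: (gapof E t) gp tp => p gp tp.
  have [p12 [E1 [E2 _]]] := gp; rewrite !(slope_gap _ gp tp) (wB _ _ (ltW p12)).
  have z s : Rintegral lam `[s, s] (long_slope u d) = 0.
    rewrite /Rintegral set_itv1 integral_set1//.
  have [h|h] := gap_notin gp Ex0; last first.
    have e2 : cl p.2 = x0 by exact: clamp_left.
    have e1 : cl p.1 = x0 by apply: (clamp_left xy0); exact: le_trans (ltW p12) h.
    by left; rewrite e1 e2 z mul0r.
  have [h2|h2] := gap_notin gp Ey0.
    have e1 : cl p.1 = y0 by exact: clamp_right.
    have e2 : cl p.2 = y0 by apply: (clamp_right xy0); exact: le_trans h2 (ltW p12).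
    by left; rewrite e1 e2 z mul0r.
  have e1 : cl p.1 = p.1 by apply: clamp_id => //; exact: le_trans (ltW p12) h2.
  have e2 : cl p.2 = p.2 by apply: clamp_id => //; exact: le_trans h (ltW p12).
  rewrite e1 e2.
  rewrite long_slope_gap//; case: ifP => _; last by left; rewrite mul0r.
  right; split=> //; case/andP: tp => h3 h4.
  by rewrite (le_lt_trans h h3) (lt_le_trans h4 h2).
Qed.

End StepTruncation.

(** * Cutoff functions of small energy *)

Section StepDensity.
Variables (R : realType) (E : set R)
  (mu : {measure set (measurableTypeR R) -> \bar R}).
Hypothesis EK : inK E.
Hypothesis muE : radon_full E mu.
Notation lam := (leb R).
Notation OI := (openI E).
Notation en := (en E mu).
Notation nrm2 := (nrm2 mu).
Notation L2 := (L2 mu).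
Notation slope := (slope E).
Notation sc := (sc E).
Implicit Types (f g h u v w chi : R -> R) (x y z t a b c d : R).

Let mOI := measurable_openI E.

Lemma ripZ (m : {measure set (measurableTypeR R) -> \bar R}) D (a : R) f :
  measurable D -> sqi m D f ->
  rip m D (fun x => a * f x) (fun x => a * f x) = a ^+ 2 * rip m D f f.
Proof.
move=> mD sf; have := ripZD mD a 0 sf sf.
rewrite (_ : (fun x => _ + _) = (fun x => a * f x)); last by apply/funext => x; ring.
by move=> ->; ring.
Qed.

Lemma slope_sc t : Iset E t -> slope sc t = gap_density E t.
Proof.
move=> It; have [Et|nEt] := pselect (E t); first by rewrite slope_E// gap_densityE.
have [p gp tp] := Iset_gap EK It nEt; have [p12 [_ [_ nE]]] := gp.
rewrite (slope_gap _ gp tp) gap_densityNE// (sc_incr EK (ltW p12)).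
rewrite -Rintegral_itv_oo; last exact: measurable_gap_density.
rewrite /Rintegral (eq_integral (fun=> 1%:E)).
  by rewrite (gap_measure 1 gp)/= mul1r mulfV// subr_eq0 gt_eqF.
by move=> s; rewrite inE/= in_itv/= => sp; rewrite gap_densityNE//; exact: nE.
Qed.

Lemma rip_indic_gap_density a b : a <= b ->
  sqi lam OI (fun t => \1_(`[a, b]%classic) t * gap_density E t) /\
  rip lam OI (fun t => \1_(`[a, b]%classic) t * gap_density E t)
    (fun t => \1_(`[a, b]%classic) t * gap_density E t) <= sc b - sc a.
Proof.
move=> ab; have mg := measurable_gap_density EK; set h := fun t => _ * _.
have mh : measurable_fun setT h by exact: measurable_funM.
have le : (\int[lam]_(t in OI) (h t ^+ 2)%:E <= (sc b - sc a)%:E)%E.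
  apply: (@le_trans _ _ (\int[lam]_t (h t ^+ 2)%:E)%E).
    apply: ge0_subset_integral => //.
      by apply/measurable_EFinP; exact: measurable_funX.
    by move=> t _; rewrite lee_fin sqr_ge0.
  rewrite (sc_incr EK ab) /Rintegral fineK; last first.
    apply: integrable_fin_num; first exact: mitvcc.
    exact: sqi_integrable_itv (sqi_gap_density EK a b).
  rewrite [leRHS]integral_mkcond le_eqVlt; apply/orP; left; apply/eqP.
  apply: eq_integral => t _; rewrite patchE /h indicE.
  case: (_ \in _); rewrite ?mul0r ?expr0n// mul1r.
  by case: (gap_density01 E t) => ->; rewrite ?expr0n ?expr1n.
have sh : sqi lam OI h by split=> //; exact: le_lt_trans le (ltry _).
by split=> //; rewrite -lee_fin -integral_sqr_rip.
Qed.

Lemma slope_affine w (k c : R) t : slope (fun x => k * (w x - c)) t = k * slope w t.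
Proof. by rewrite /slope; ring. Qed.

Lemma slope_cst c : slope (fun=> c) = fun=> 0.
Proof. by apply/funext => t; rewrite /slope subrr mul0r. Qed.

Lemma flat_cst c : flat E E (fun=> c).
Proof. by exists 1. Qed.

(* If sc increases by S between a and b, then a multiple of the truncation of
   sc rises from 0 to 1 with energy of order 1 / S: where sc is unbounded,
   functions can be cut off at arbitrarily small cost. *)
Lemma rise a b : E a -> E b -> sc a < sc b -> exists chi,
  [/\ flat E E chi, forall x, 0 <= chi x <= 1,
      (forall x, x <= a -> chi x = 0) /\ (forall x, b <= x -> chi x = 1),
      sqi lam OI (slope chi) & rip lam OI (slope chi) (slope chi) <= 4 / (sc b - sc a)].
Proof.
move=> Ea Eb sab; pose S := sc b - sc a; have S0 : 0 < S by rewrite subr_gt0.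
have ab : a <= b by rewrite leNgt; apply/negP => /ltW/(sc_le EK); rewrite leNgt sab.
have mg := measurable_gap_density EK.
have eqs x y : E x -> E y -> forall t, x <= t <= y -> slope sc t = gap_density E t.
  move=> Ex Ey t /andP[xt ty]; apply: slope_sc.
  exact: Iset_convex (E_Iset Ex) (E_Iset Ey) xt ty.
have [||| w [fw wu wl wr ws]] := @step_truncation R E EK sc a b (S / 4) Ea Eb ab.
- by rewrite divr_gt0.
- apply: (eq_sqi_ae (mitvcc a b) (measurable_slope EK _) _ (sqi_gap_density EK a b)).
  by apply: ae_all => t; rewrite /= in_itv/= => tab; rewrite (eqs a b).
- move=> x Ex /andP[ax xb]; rewrite (sc_incr EK ax); apply: eq_Rintegral => t.
  by rewrite inE/= in_itv/= => tx; apply/esym/(eqs a x).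
(* The truncation loses at most S/4 of the rise, so T >= S/2, and dividing by T leaves energy at
   most T^-2 * S <= 4 / S. *)
pose T := w b - sc a.
have T2 : S / 2 <= T.
  have := wu b Eb; rewrite lexx ab => /(_ isT); rewrite ler_norml /T => /andP[h1 h2].
  by move: h1 h2 S0; rewrite /S; lra.
have T0 : 0 < T by apply: lt_le_trans T2; rewrite divr_gt0.
have [sh rh] := rip_indic_gap_density ab; set h := fun t => _ * _ in sh rh.
exists (clip (fun x => T^-1 * (w x - sc a))).
have le t : OI t -> `|slope (clip (fun x => T^-1 * (w x - sc a))) t| <= `|T^-1 * h t|.
  move=> Ot; apply: le_trans (@slope_lip R E (fun s => Num.min (Num.max s 0) 1)
    (fun x => T^-1 * (w x - sc a)) t (@clip_lip R)) _.
  rewrite (slope_affine w T^-1 (sc a) t) !(normrM T^-1); apply: ler_wpM2l => //.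
  case: (ws t) => [->|[tab ->]].
    by rewrite normr0.
  rewrite slope_sc; last by left.
  rewrite /h indicE mem_set ?mul1r//= in_itv/=.
  by case/andP: tab => /ltW -> /ltW ->.
have sT : sqi lam OI (fun t => T^-1 * h t) by exact: sqiZ.
split.
- exact: (flat_comp (fun s => Num.min (Num.max (T^-1 * (s - sc a)) 0) 1)).
- by move=> x; rewrite /clip; case: (clip_cases (T^-1 * (w x - sc a))) => -[h1 ->]//;
    rewrite ?lexx ?ler01.
- split=> x hx; rewrite /clip.
    by rewrite wl// subrr mulr0 maxxx min_l.
  by rewrite wr// mulVf ?gt_eqF// max_l// minxx.
- by apply: le_sqi sT => //; exact: measurable_slope.
- apply: le_trans (le_rip mOI (measurable_slope EK _) le sT) _.
  rewrite ripZ//; apply: (@le_trans _ _ (T^-1 ^+ 2 * S)).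
    by rewrite ler_wpM2l// sqr_ge0.
  rewrite -/S exprVn mulrC ler_pdivrMr ?exprn_gt0// mulrAC ler_pdivlMr//.
  by nra.
Qed.

(** Three ways in which the left end is harmless: E has a least point; [sc] is bounded below and
    [bcl] makes u small; or [sc] is unbounded below and [rise] supplies a cheap cutoff. Only the
    last one uses a nonconstant chi. *)
Lemma cut_left u xs (e e' : R) : E xs -> 0 < e -> 0 < e' -> bcl E u -> exists x0 chi,
  [/\ E x0, x0 <= xs, flat E E chi, forall x, 0 <= chi x <= 1 &
   [/\ forall x, xs <= x -> chi x = 1, sqi lam OI (slope chi),
     rip lam OI (slope chi) (slope chi) <= e &
     [\/ forall x, E x -> x0 <= x, forall x, x <= x0 -> chi x = 0 | `|u x0| <= e']]].
Proof.
move=> Exs e0 e'0 bu.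
have one : [/\ forall x, xs <= x -> (fun=> 1 : R) x = 1, sqi lam OI (slope (fun=> 1)) &
    rip lam OI (slope (fun=> 1)) (slope (fun=> 1)) <= e].
  split=> //; rewrite slope_cst; first exact: sqi_cst0.
  by rewrite /rip (@eq_Rintegral _ _ _ lam _ (fun=> 0)) ?Rintegral_cst ?mul0r ?ltW// => t _; rewrite mul0r.
have [[m Em mE]|nomin'] := pselect (exists2 m, E m & forall x, E x -> m <= x).
  exists m, (fun=> 1); split=> //; [exact: mE|exact: flat_cst|by move=> x; rewrite ler01 lexx|].
  by case: one; split=> //; apply: Or31.
have nomin x : E x -> exists2 y, E y & y < x.
  move=> Ex; apply: contrapT => n; apply: nomin'; exists x => // y Ey.
  by rewrite leNgt; apply/negP => yx; apply: n; exists y.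
have [bd|nbd] := pselect (exists c, forall x, E x -> c <= sc x).
  have [x1 Ex1 H] := bu nomin bd e' e'0.
  have [x0 [Ex0 x01 x02]] : exists y, [/\ E y, y <= x1 & y <= xs].
    by have [h|/ltW h] := leP x1 xs; [exists x1|exists xs].
  exists x0, (fun=> 1); split=> //; [exact: flat_cst|by move=> x; rewrite ler01 lexx|].
  by case: one; split=> //; apply: Or33; exact: H.
(* A rise of [sc] larger than 4 / e makes the energy 4 / (rise) of the cutoff at most e. *)
have [x1 Ex1 hx1] : exists2 x1, E x1 & sc x1 < sc xs - 4 / e.
  apply: contrapT => n; apply: nbd; exists (sc xs - 4 / e) => x Ex.
  by rewrite leNgt; apply/negP => h; apply: n; exists x.
have p4 : 0 < 4 / e by rewrite divr_gt0.
have s1 : sc x1 < sc xs by lra.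
have [chi [fc c01 [cl cr] sc_ rc]] := rise Ex1 Exs s1.
exists x1, chi; split=> //.
  by rewrite leNgt; apply/negP => /ltW/(sc_le EK); rewrite leNgt s1.
split=> //; last exact: Or32.
by apply: le_trans rc _; rewrite ler_pdivrMr ?subr_gt0// mulrC -ler_pdivrMr//; lra.
Qed.

Lemma cut_right u xs (e e' : R) : E xs -> 0 < e -> 0 < e' -> bcr E u -> exists x0 chi,
  [/\ E x0, xs <= x0, flat E E chi, forall x, 0 <= chi x <= 1 &
   [/\ forall x, x <= xs -> chi x = 1, sqi lam OI (slope chi),
     rip lam OI (slope chi) (slope chi) <= e &
     [\/ forall x, E x -> x <= x0, forall x, x0 <= x -> chi x = 0 | `|u x0| <= e']]].
Proof.
move=> Exs e0 e'0 bu.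
have one : [/\ forall x, x <= xs -> (fun=> 1 : R) x = 1, sqi lam OI (slope (fun=> 1)) &
    rip lam OI (slope (fun=> 1)) (slope (fun=> 1)) <= e].
  split=> //; rewrite slope_cst; first exact: sqi_cst0.
  by rewrite /rip (@eq_Rintegral _ _ _ lam _ (fun=> 0)) ?Rintegral_cst ?mul0r ?ltW// => t _; rewrite mul0r.
have [[m Em mE]|nomax'] := pselect (exists2 m, E m & forall x, E x -> x <= m).
  exists m, (fun=> 1); split=> //; [exact: mE|exact: flat_cst|by move=> x; rewrite ler01 lexx|].
  by case: one; split=> //; apply: Or31.
have nomax x : E x -> exists2 y, E y & x < y.
  move=> Ex; apply: contrapT => n; apply: nomax'; exists x => // y Ey.
  by rewrite leNgt; apply/negP => yx; apply: n; exists y.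
have [bd|nbd] := pselect (exists c, forall x, E x -> sc x <= c).
  have [x1 Ex1 H] := bu nomax bd e' e'0.
  have [x0 [Ex0 x01 x02]] : exists y, [/\ E y, x1 <= y & xs <= y].
    by have [h|/ltW h] := leP xs x1; [exists x1|exists xs].
  exists x0, (fun=> 1); split=> //; [exact: flat_cst|by move=> x; rewrite ler01 lexx|].
  by case: one; split=> //; apply: Or33; exact: H.
have [x1 Ex1 hx1] : exists2 x1, E x1 & sc xs + 4 / e < sc x1.
  apply: contrapT => n; apply: nbd; exists (sc xs + 4 / e) => x Ex.
  by rewrite leNgt; apply/negP => h; apply: n; exists x.
have p4 : 0 < 4 / e by rewrite divr_gt0.
have s1 : sc xs < sc x1 by lra.
have [chi [fc c01 [cl cr] sc_ rc]] := rise Exs Ex1 s1.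
have sE t : slope (fun x => 1 - chi x) t = -1 * slope chi t by rewrite /slope; ring.
exists x1, (fun x => 1 - chi x); split=> //.
- by rewrite leNgt; apply/negP => /ltW/(sc_le EK); rewrite leNgt s1.
- exact: (flat_comp (fun s => 1 - s)).
- by move=> x; have /andP[h1 h2] := c01 x; apply/andP; split; lra.
split=> //.
- by move=> x hx; rewrite cl// subr0.
- by rewrite (funext sE); exact: sqiZ.
- rewrite (funext sE) ripZ// sqrrN expr1n mul1r; apply: le_trans rc _.
  by rewrite ler_pdivrMr ?subr_gt0// mulrC -ler_pdivrMr//; lra.
- by apply: Or32 => x hx; rewrite cr// subrr.
Qed.

End StepDensity.

Section ClampShrink.
Variable R : realType.
Implicit Types a b c d e k s t : R.

(** Soft thresholding at level e: a 1-Lipschitz map that sends [-e, e] to 0 and moves every value by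
    at most e. *)
Definition shrink e s := s - clamp (- e) e s.

Let opp_le c : 0 <= c -> - c <= c. Proof. by move=> c0; rewrite ge0_cp. Qed.

Lemma shrink_cases e s : 0 <= e -> [\/ e <= s /\ shrink e s = s - e,
  - e <= s <= e /\ shrink e s = 0 | s <= - e /\ shrink e s = s + e].
Proof.
move=> e0; rewrite /shrink; case: (clamp_cases (opp_le e0) s) => -[h ->].
- by apply: Or33; rewrite opprK.
- by apply: Or32; rewrite subrr.
- by apply: Or31.
Qed.

Lemma norm_bounds s t : s - t <= `|s - t| /\ t - s <= `|s - t|.
Proof. by rewrite ler_norm -opprB -normrN ler_norm. Qed.

Lemma norm_le s k : s <= k -> - s <= k -> `|s| <= k.
Proof. by move=> h1 h2; rewrite ler_norml lerNl h2. Qed.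

Lemma shrink_lip e s t : 0 <= e -> `|shrink e s - shrink e t| <= `|s - t|.
Proof.
move=> e0; have [] := norm_bounds s t; move: `|s - t| => d h1 h2.
case: (shrink_cases s e0) => -[hs ->]; case: (shrink_cases t e0) => -[ht ->];
by apply: norm_le; lra.
Qed.

Lemma shrink_le e k s : 0 <= e -> 0 <= k -> `|s| <= k + e -> `|shrink e s| <= k.
Proof.
move=> e0 k0; rewrite ler_norml => /andP[h1 h2].
by case: (shrink_cases s e0) => -[hs ->]; apply: norm_le; lra.
Qed.

Lemma shrink_dist e s : 0 <= e -> `|shrink e s - s| <= e.
Proof. by move=> e0; case: (shrink_cases s e0) => -[hs ->]; apply: norm_le; lra. Qed.

Lemma clamp_lip c d s t : 0 <= c -> 0 <= d ->
  `|clamp (- c) c s - clamp (- d) d t| <= `|s - t| + `|c - d|.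
Proof.
move=> c0 d0; have [] := norm_bounds s t; have [] := norm_bounds c d.
move: `|s - t| `|c - d| => p q h1 h2 h3 h4.
case: (clamp_cases (opp_le c0) s) => -[hs ->]; case: (clamp_cases (opp_le d0) t) => -[ht ->];
by apply: norm_le; lra.
Qed.

Lemma clamp_norm c s : 0 <= c -> `|clamp (- c) c s| <= `|s|.
Proof.
move=> c0; have := clamp_lip s 0 c0 c0; rewrite subrr normr0 addr0 subr0.
by rewrite [clamp _ _ 0]clamp_id ?subr0// oppr_le0.
Qed.

Lemma min_lip a b c d : `|Num.min a b - Num.min c d| <= `|a - c| + `|b - d|.
Proof.
have [] := norm_bounds a c; have [] := norm_bounds b d.
move: `|a - c| `|b - d| => p q h1 h2 h3 h4.
by case: (lerP a b) => h; case: (lerP c d) => h'; apply: norm_le; lra.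
Qed.

End ClampShrink.

Section StepApproximation.
Variables (R : realType) (E : set R)
  (mu : {measure set (measurableTypeR R) -> \bar R}).
Hypothesis EK : inK E.
Hypothesis muE : radon_full E mu.
Notation lam := (leb R).
Notation OI := (openI E).
Notation en := (en E mu).
Notation nrm2 := (nrm2 mu).
Notation L2 := (L2 mu).
Notation slope := (slope E).
Notation sc := (sc E).
Implicit Types (f g h u v w chi : R -> R) (x y z t a b c d : R).

Let mOI := measurable_openI E.

Lemma flat_cont_on u : flat E E u -> cont_on E u.
Proof.
move=> [d d0 H] x Ex e e0; exists d => // y Ey xy.
by rewrite (H x x y) ?subrr ?normr0//; rewrite distrC.
Qed.

Lemma slope_le_incr u v w (k : R) t : (forall x y, E x -> E y ->
    `|v y - v x| <= `|u y - u x| + k * `|w y - w x|) ->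
  `|slope v t| <= `|slope u t| + k * `|slope w t|.
Proof.
move=> H; have [[Ot nEt]|n] := pselect (OI t /\ ~ E t); last first.
  by rewrite /slope (gapof_out n) !subrr !mul0r !normr0 mulr0 addr0.
have [[p12 [E1 [E2 _]]] _] := gapofP EK Ot nEt.
by rewrite /slope !normrM mulrA -mulrDl ler_wpM2r// H.
Qed.

Lemma sqi_norm D (m : {measure set (measurableTypeR R) -> \bar R}) f : measurable D ->
  sqi m D f -> sqi m D (fun x => `|f x|) /\
  rip m D (fun x => `|f x|) (fun x => `|f x|) <= rip m D f f.
Proof.
move=> mD sf; have mf : measurable_fun setT (fun x => `|f x|).
  by apply: measurableT_comp; case: sf.
have le x : D x -> `|(`|f x|)| <= `|f x| by rewrite normr_id.
by split; [exact: le_sqi le sf|exact: le_rip].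
Qed.

Lemma rip_le_sum f g h (k : R) : measurable_fun setT f ->
  (forall x, OI x -> `|f x| <= `|g x| + k * `|h x|) -> sqi lam OI g -> sqi lam OI h ->
  sqi lam OI f /\ rip lam OI f f <= 2 * rip lam OI g g + 2 * (k ^+ 2 * rip lam OI h h).
Proof.
move=> mf H sg sh; have [sg' rg] := sqi_norm mOI sg; have [sh' rh] := sqi_norm mOI sh.
have skh := sqiZ mOI k sh'; have sD := sqiD mOI sg' skh.
have le x : OI x -> `|f x| <= `|(`|g x| + k * `|h x|)|.
  by move=> Ox; apply: le_trans (H x Ox) (ler_norm _).
split; first exact: le_sqi le sD.
apply: le_trans (le_rip mOI mf le sD) _; apply: le_trans (ripD_le mOI sg' skh) _.
rewrite ripZ//; apply: lerD; first by rewrite ler_pM2l.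
by rewrite ler_pM2l// ler_wpM2l// sqr_ge0.
Qed.

(* The truncation w of u to long gaps is clamped by M times a cutoff function
   of energy at most M^-2 and then shrunk by 2 e, which makes it vanish outside
   a compact set and keeps it below |u|. *)
Lemma step_approx u a b (M e : R) : steprep E u -> E a -> E b -> a <= b -> 0 < M -> 0 < e ->
  exists v, [/\ step_core E mu v,
    rip lam OI (slope v) (slope v) <= 2 * rip lam OI (slope u) (slope u) + 8,
    forall x, E x -> `|v x| <= `|u x| &
    forall x, E x -> a <= x <= b -> `|u x| + e <= M -> `|v x - u x| <= 3 * e].
Proof.
move=> su Ea Eb ab M0 e0; have [ssu pu bl br] := su.
have e_0 : 0 < (M ^+ 2)^-1 by rewrite invr_gt0 exprn_gt0.
have [x0 [cL [Ex0 x0a fL L01 [L1 sL rL Lx]]]] := cut_left EK Ea e_0 e0 bl.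
have [y0 [cR [Ey0 by0 fR R01 [R1 sR rR Rx]]]] := cut_right EK Eb e_0 e0 br.
have xy0 : x0 <= y0 by apply: le_trans (le_trans x0a ab) by0.
have [||w [fw wu wl wr ws]] := @step_truncation R E EK u x0 y0 e Ex0 Ey0 xy0 e0.
- exact: sqi_OI_itv (E_Iset Ex0) (E_Iset Ey0) ssu.
- by move=> x Ex /andP[x0x _]; exact: pu.
pose chi x := Num.min (cL x) (cR x).
have chi01 x : 0 <= chi x <= 1.
  by rewrite /chi /Num.min; case: ifP.
(* Clamping by [M * chi], where a product with chi would require a bound on u, adds only M times the
   slope of chi to the slope. *)
pose c x := M * chi x.
have c0 x : 0 <= c x by rewrite mulr_ge0 ?(ltW M0)//; case/andP: (chi01 x).
have fc : flat E E chi by apply: flat_comp2.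
(* Where a cut relies on [bcl] or [bcr], |u| <= e at the cut point and w is within e of it and
   constant beyond, so the threshold 2 e annihilates w there. As |w| <= |u| + e between the cuts,
   the result also stays below |u|. *)
pose v0 x := shrink (2 * e) (clamp (- c x) (c x) (w x)).
have e2 : 0 <= 2 * e by rewrite mulr_ge0// ltW.
have fv0 : flat E E v0.
  exact: (flat_comp2 (fun s t => shrink (2 * e) (clamp (- (M * s)) (M * s) t)) fc fw).
pose v := v0 \_ E; have vE x : E x -> v x = v0 x by move=> Ex; rewrite /v patchE mem_set.
have fv : flat E E v.
  have [d d0 H] := fv0; exists d => // z x y Ez Ex Ey h1 h2.
  by rewrite !vE//; exact: (H z).
have v_small x : `|w x| <= 2 * e \/ c x = 0 -> v0 x = 0.
  move=> H; apply/eqP; rewrite -normr_le0; apply: shrink_le => //; rewrite add0r.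
  case: H => [|->]; first exact: le_trans (clamp_norm _ (c0 x)).
  by rewrite oppr0 clamp_const normr0.
have v_left x : E x -> x < x0 -> v0 x = 0.
  move=> Ex xx0; apply: v_small; case: Lx => [/(_ x Ex)|H|H]; first by rewrite leNgt xx0.
    right; rewrite /c /chi H ?ltW// min_l ?mulr0//; by case/andP: (R01 x).
  by left; rewrite wl ?ltW//; move: H e0; lra.
have v_right x : E x -> y0 < x -> v0 x = 0.
  move=> Ex xy; apply: v_small; case: Rx => [/(_ x Ex)|H|H]; first by rewrite leNgt xy.
    right; rewrite /c /chi H ?ltW// min_r ?mulr0//; by case/andP: (L01 x).
  left; rewrite (wr _ (ltW xy)); have := wu y0 Ey0; rewrite xy0 lexx => /(_ isT).
  have := ler_normD (w y0 - u y0) (u y0); rewrite subrK; move: H; clear; lra.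
have Cv : Cc E v.
  apply/CcP; split; first exact: flat_cont_on.
  exists (E `&` `[x0, y0]); split; [exact: E_compact|by move=> ? []|].
  move=> x Ex n; rewrite vE//; have [/(v_left x Ex)//|h1] := ltP x x0.
  have [/(v_right x Ex)//|h2] := ltP y0 x.
  by case: n; split=> //=; rewrite in_itv/= h1.
have mv : measurable_fun setT v by apply: cont_on_measurable => //; exact: flat_cont_on.
have [schi rchi] : sqi lam OI (slope chi) /\ rip lam OI (slope chi) (slope chi) <=
    2 * (M ^+ 2)^-1 + 2 * (1 ^+ 2 * (M ^+ 2)^-1).
  have [||s r] := @rip_le_sum (slope chi) (slope cL) (slope cR) 1 _ _ sL sR.
  - exact: measurable_slope.
  - by move=> t _; apply: slope_le_incr => x y _ _; rewrite mul1r; exact: min_lip.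
  by split=> //; apply: le_trans r _; apply: lerD; rewrite ler_pM2l// !expr1n !mul1r.
have [sv rv] : sqi lam OI (slope v) /\ rip lam OI (slope v) (slope v) <=
    2 * rip lam OI (slope u) (slope u) + 2 * (M ^+ 2 * rip lam OI (slope chi) (slope chi)).
  apply: rip_le_sum => // [|t _]; first exact: measurable_slope.
  apply: (@le_trans _ _ (`|slope w t| + M * `|slope chi t|)).
    apply: slope_le_incr => x y Ex Ey; rewrite !vE//.
    apply: le_trans (shrink_lip _ _ e2) _; apply: le_trans (clamp_lip _ _ (c0 y) (c0 x)) _.
    by rewrite lerD2l /c -mulrBr normrM (gtr0_norm M0).
  by rewrite lerD2r; case: (ws t) => [->|[_ ->]]; rewrite ?normr0.
exists v; split.
- by split; [exact: (Cc_L2 EK muE Cv mv)|exact: Cv|exact: fv|exact: sv].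
- apply: le_trans rv _; rewrite lerD2l.
  have M2 : 0 < M ^+ 2 by rewrite exprn_gt0.
  apply: (@le_trans _ _ (2 * (M ^+ 2 * (2 * (M ^+ 2)^-1 + 2 * (1 ^+ 2 * (M ^+ 2)^-1))))).
    by rewrite ler_pM2l// ler_pM2l.
  have V : M ^+ 2 * (M ^+ 2)^-1 = 1 by rewrite mulfV// gt_eqF.
  rewrite (_ : 2 * _ = 8 * (M ^+ 2 * (M ^+ 2)^-1)); first by rewrite V mulr1.
  by ring.
- move=> x Ex; rewrite vE//; have [/(v_left x Ex)->|h1] := ltP x x0; first by rewrite normr0.
  have [/(v_right x Ex)->|h2] := ltP y0 x; first by rewrite normr0.
  have := wu x Ex; rewrite h1 h2 => /(_ isT) wux.
  apply: shrink_le => //; apply: le_trans (clamp_norm _ (c0 x)) _.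
  by have := ler_normD (w x - u x) (u x); rewrite subrK; move: wux e0; clear; lra.
- move=> x Ex /andP[ax xb] uM; rewrite vE//.
  have := wu x Ex; rewrite (le_trans x0a ax) (le_trans xb by0) => /(_ isT) wux.
  have : `|w x| <= M.
    by have := ler_normD (w x - u x) (u x); rewrite subrK; move: wux uM; clear; lra.
  have cM : c x = M by rewrite /c /chi L1// R1// minxx mulr1.
  rewrite /v0 cM ler_norml => /andP[h1 h2]; rewrite clamp_id//.
  have := shrink_dist (w x) e2; have := ler_normD (shrink (2 * e) (w x) - w x) (w x - u x).
  by rewrite addrA subrK; move: wux; clear; lra.
Qed.

(** The approximants of [step_approx], for M = n + 2 and e = 1 / (n + 1), are dominated by |u| and
    converge pointwise on E, hence in L2. Their energies are merely bounded, which is what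
    [closure_of_bounded] asks for. *)
Lemma step_domain_closure : step_domain E mu `<=` form_closure E mu (step_domain E mu) (step_core E mu).
Proof.
move=> f Sf; have [Lf [u su fu]] := Sf.
have FFd := step_domain_Fdom EK muE; have Fae := @step_domain_ae R E mu.
have VF := step_core_sub (mu := mu) EK.
have E0 : E !=set0 by have [x [_ [Ex _ _]]] := exists_lt EK; exists x.
have [c [Ec cE]] := exhaust_left E0; have [d [Ed dE]] := exhaust_right E0.
have /choice[v Hv] : forall n, exists v, [/\ step_core E mu v,
    rip lam OI (slope v) (slope v) <= 2 * rip lam OI (slope u) (slope u) + 8,
    forall x, E x -> `|v x| <= `|u x| &
    forall x, E x -> c n <= x <= d n -> `|u x| + n.+1%:R^-1 <= n.+2%:R -> `|v x - u x| <= 3 * n.+1%:R^-1].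
  (* The exhausting sequences are chosen independently, so [c n <= d n] may fail for a given n. *)
  move=> n; have Ea : E (Num.min (c n) (d n)) by rewrite /Num.min; case: ifP.
  have Eb : E (Num.max (c n) (d n)) by rewrite /Num.max; case: ifP.
  have [|||v [h1 h2 h3 h4]] := @step_approx u _ _ n.+2%:R n.+1%:R^-1 su Ea Eb => //.
    by rewrite ge_min le_max lexx.
  exists v; split=> // x Ex /andP[cx xd]; apply: h4 => //.
  by rewrite ge_min cx le_max xd orbT.
pose ru := u \_ E; have ruE x : E x -> ru x = u x by move=> Ex; rewrite /ru patchE mem_set.
have mru : measurable_fun setT ru.
  by apply: cont_on_measurable => //; exact: steprep_cont_on.
have fru : aeeq mu f ru.
  by apply: aeeq_trans fu _; apply: (aeeq_on EK muE) => x Ex; rewrite ruE.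
have Lru : L2 ru by apply: (eq_sqi_ae measurableT mru _ Lf); apply: ae_imp fru => x ->.
have [|||_ H] := @L2_dominated R E mu EK muE v ru ru _ mru Lru.
- by move=> n; have [[Lv _ _ _] _ _ _] := Hv n; case: Lv.
- by move=> n x Ex; have [_ _ h _] := Hv n; rewrite ruE// h.
- move=> x Ex e e0; have [N1 H1] := cE x Ex; have [N2 H2] := dE x Ex.
  pose N3 := Num.bound `|u x|; have [N4 N4e] : exists N4 : nat, 3 / e <= N4%:R.
    exists (Num.bound (3 / e)); apply: ltW; apply: archi_boundP.
    by rewrite divr_ge0// ltW.
  exists (maxn (maxn N1 N2) (maxn N3 N4)) => n.
  rewrite !geq_max => /andP[/andP[/H1 cn /H2 dn] /andP[n3 n4]].
  have n1 : n.+1%:R^-1 <= 1 :> R by rewrite invf_le1 ?ler1n.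
  have [_ _ _ h] := Hv n; rewrite ruE//; apply: le_trans (h x Ex _ _) _.
  + by rewrite cn.
  + rewrite -[n.+2]addn1 natrD lerD// -natr1.
    apply: (@le_trans _ _ n%:R); last by rewrite lerDl.
    apply: ltW; apply: (@lt_le_trans _ _ N3%:R); last by rewrite ler_nat.
    exact: archi_boundP.
  + rewrite ler_pdivrMr// mulrC -ler_pdivrMr//; apply: le_trans N4e _.
    by rewrite ler_nat leqW.
have [|cl _] := @closure_of_bounded R E mu EK muE _ _ FFd Fae
  (step_complete EK muE) VF (@step_core_lin R E mu) ru
  (2^-1 * (2 * rip lam OI (slope u) (slope u) + 8)) Lru.
  move=> e e0; have [N HN] := H e e0; have [cv rv _ _] := Hv N.
  exists (v N); split=> //; last by apply: ltW; exact: HN.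
  rewrite -(ler_pM2l (ltr0n _ 2)) mulrA mulfV// mul1r.
  by rewrite -(en_step EK muE (step_core_steprep EK cv) (ae_all _ (fun=> erefl))).
by apply: (form_closure_ae FFd Fae VF cl); [case: Lf|exact: aeeq_sym].
Qed.

Lemma step_domain_fukushima : nowhere E -> fukushima E mu (step_domain E mu).
Proof.
move=> nE; rewrite (_ : step_domain E mu = form_closure E mu (step_domain E mu) (step_core E mu)).
  apply: form_closure_fukushima => //.
  - exact: step_domain_Fdom.
  - exact: step_domain_lin.
  - exact: step_domain_ae.
  - exact: step_complete.
  - exact: step_core_sub.
  - exact: step_core_lin.
  - by move=> v [].
  - by move=> v; exact: step_core_clip.
  - exact: step_core_sep.
by apply/seteqP; split; [exact: step_domain_closure|move=> f []].
Qed.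

End StepApproximation.

(** * The step domain lies in every Fukushima subspace *)

Section StepMinimum.
Variables (R : realType) (E : set R)
  (mu : {measure set (measurableTypeR R) -> \bar R}).
Hypothesis EK : inK E.
Hypothesis muE : radon_full E mu.
Notation q1 := (q1 E mu).
Implicit Types (f g h u v w : R -> R) (x y z t a b c d : R) (s : seq R).
Variable F : set (R -> R).
Hypothesis Ffuk : fukushima E mu F.

Lemma seq_min s : s != [::] -> exists2 c, c \in s & forall t, t \in s -> c <= t.
Proof.
elim: s => // a s IH _; have [->|s0] := eqVneq s [::].
  by exists a; rewrite ?mem_head// => t; rewrite inE => /eqP ->.
have [c cs H] := IH s0; have [ac|/ltW ca] := leP a c.
  exists a; rewrite ?mem_head// => t; rewrite inE => /predU1P[->//|/H]; exact: le_trans.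
exists c; first by rewrite inE cs orbT.
by move=> t; rewrite inE => /predU1P[->//|/H].
Qed.

(* Subtracting the least positive value c amounts to subtracting c times an
   indicator, which is a function of any uniform approximation up to c / 3. *)
Lemma fuk_finite_range_ge0 s v : Cc E v ->
  (forall x, E x -> v x = 0 \/ v x \in s) -> (forall t, t \in s -> 0 < t) ->
  exists2 g, F g & forall x, E x -> g x = v x.
Proof.
move: {2}(size s) (leqnn (size s)) => n; elim: n s v => [|n IH] s v sn Cv vs s0.
  exists (cst 0); first by case: Ffuk => _ [_ [_ []]].
  move=> x /vs[->//|]; by move: sn; rewrite leqn0 => /nilP ->.
have [e|sne] := eqVneq s [::].
  by apply: (IH [::]) => // x /vs; rewrite e.
have [c cs cmin] := seq_min sne; have c0 := s0 c cs.
have c3 : 0 < c / 3 by rewrite divr_gt0.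
pose th r := Num.max (r - c) 0.
have thE r : (r <= c /\ th r = 0) \/ (c <= r /\ th r = r - c).
  rewrite /th; have [h|/ltW h] := leP r c; [left|right]; split=> //.
    by rewrite max_r// subr_le0.
  by rewrite max_l// subr_ge0.
have [||||g1 Fg1 g1E] := IH [seq t - c | t <- s & c < t] (fun x => th (v x)).
- rewrite size_map -ltnS (leq_trans _ sn)// size_filter ltn_neqAle count_size andbT -all_count.
  by apply/negP => /allP/(_ c cs); rewrite ltxx.
- apply: (@Cc_lip R E th) => //.
    move=> r r'; case: (thE r) => -[h ->]; case: (thE r') => -[h' ->];
    by rewrite ler_norml; case: (lerP 0 (r - r')) => h2;
      [rewrite (ger0_norm h2)|rewrite (ltr0_norm h2)]; lra.
  by case: (thE 0) => -[h ->]//; lra.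
- move=> x Ex; case: (thE (v x)) => -[h e]; first by left.
  have [vc|vc] := eqVneq (v x) c; first by left; rewrite e vc subrr.
  right; rewrite e; apply/mapP; exists (v x) => //.
  rewrite mem_filter lt_neqAle eq_sym vc h/=.
  by case: (vs x Ex) => // v0; move: h; rewrite v0 leNgt c0.
- by move=> t /mapP[r]; rewrite mem_filter => /andP[cr _] ->; rewrite subr_gt0.
(* The values of v are 0 or at least c, so g0 is below c/3 or above 2c/3, and the ramp between these
   thresholds is exactly the indicator of v > 0. *)
have [g0 [Fg0 _ g0E]] := fuk_uniform EK muE Ffuk Cv c3.
exists (fun x => c * rampf (c / 3) (c * 2 / 3) (g0 x) + g1 x).
  apply: (fuk_lin Ffuk) => //; apply: rampf_closed => //.
  - exact: fuk_lin Ffuk.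
  - by move=> h Fh; case: (fuk_clip Ffuk Fh).
  - lra.
move=> x Ex; rewrite g1E//; have := g0E x Ex; rewrite ltr_norml => /andP[h1 h2].
case: (vs x Ex) => [v0|/cmin cv].
  rewrite rampf0; [|lra|lra].
  by case: (thE (v x)) => -[h ->]; lra.
rewrite rampf1; [|lra|lra].
by case: (thE (v x)) => -[h ->]; lra.
Qed.

(** Each point of the support has a neighbourhood on which v takes a single value; compactness
    leaves finitely many. *)
Lemma finite_range v : flat E E v -> Cc E v ->
  exists s, forall x, E x -> v x = 0 \/ v x \in s.
Proof.
move=> [d d0 fl] /CcP[_ [K [cK KE K0]]].
have [s sP] : exists s, forall x, K x -> E x -> v x \in s.
  apply: (compact_ind (P := fun S => exists s, forall x, S x -> E x -> v x \in s)) => //.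
  - by exists [::].
  - by move=> A B AB [s H]; exists s => x /AB; exact: H.
  - move=> A B [s H] [s' H']; exists (s ++ s') => x [/H|/H'] h Ex; rewrite mem_cat h ?orbT//.
  - move=> x /KE Ex; exists d => //; exists [:: v x] => y xy Ey.
    rewrite inE; apply/eqP; apply: (fl x) => //; first by rewrite distrC.
    by rewrite subrr normr0.
exists s => x Ex; have [Kx|nKx] := pselect (K x); first by right; exact: sP.
by left; exact: K0.
Qed.

(** Positive and negative parts are treated separately, since the indicator argument needs
    nonnegative values. Agreement on E is enough because F is closed under a.e. equality. *)
Lemma step_core_fuk : step_core E mu `<=` F.
Proof.
move=> v [Lv Cv fv _].
have pos w : Cc E w -> flat E E w -> exists2 g, F g & forall x, E x -> g x = Num.max (w x) 0.
  move=> Cw fw; have [s sP] := finite_range fw Cw.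
  apply: (@fuk_finite_range_ge0 [seq t <- s | 0 < t]).
  - exact: Cc_pos.
  - move=> x Ex; have [h|h] := leP (w x) 0; first by left.
    right; rewrite mem_filter h/=.
    by case: (sP x Ex) => // w0; move: h; rewrite w0 ltxx.
  - by move=> t; rewrite mem_filter => /andP[].
have Cn : Cc E (fun x => -1 * v x + 0).
  apply: (@Cc_lip R E (fun r => -1 * r + 0) v) => //; last by rewrite mulr0 addr0.
  by move=> r t; rewrite !addr0 -mulrBr mulN1r normrN.
have [g1 Fg1 g1E] := pos v Cv fv.
have [g2 Fg2 g2E] := pos _ Cn (flat_comp (fun r => -1 * r + 0) fv).
apply: (fuk_ae Ffuk (f := fun x => -1 * g2 x + g1 x)).
- exact: (fuk_lin Ffuk).
- by case: Lv.
- apply: (aeeq_on EK muE) => x Ex; rewrite g1E// g2E// addr0 !mulN1r.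
  by case: (lerP (v x) 0) => h; case: (lerP (- v x) 0) => h'; lra.
Qed.

(** Core elements approximating f form a Cauchy sequence inside the complete class F, and its form
    limit there coincides with f a.e. *)
Lemma step_domain_fuk : step_domain E mu `<=` F.
Proof.
move=> f Sf; have FFd := fuk_Fd Ffuk.
have Ff := step_domain_Fdom EK muE Sf.
have [_ H] := step_domain_closure EK muE Sf.
have /choice[v Hv] : forall n : nat, exists v, F v /\ q1 (fun x => f x - v x) < n.+1%:R^-1.
  move=> n; have [|v cv qv] := H n.+1%:R^-1; first by rewrite invr_gt0.
  by exists v; split=> //; exact: step_core_fuk.
have Fv n := (Hv n).1; have qv n := (Hv n).2; have Fdv n := FFd _ (Fv n).
have small (e : R) : 0 < e -> exists N, forall n, (N <= n)%N -> q1 (fun x => f x - v n x) < e.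
  move=> e0; exists (Num.bound e^-1) => n Nn; apply: lt_trans (qv n) _.
  rewrite invf_plt ?posrE//; apply: lt_le_trans (archi_boundP _) _.
    by rewrite invr_ge0 ltW.
  by rewrite ler_nat leqW.
have [e e0|f' [Ff' H']] := fuk_complete Ffuk (u := v) Fv.
  have [|N HN] := small (e / 4); first by rewrite divr_gt0.
  exists N => m n Nm Nn; apply: le_lt_trans (q1_tri3 EK muE (Fdv n) (Fdv m) Ff) _.
  have := HN m Nm; have := HN n Nn.
  rewrite (q1_sub_sym EK muE Ff (Fdv n)) (q1_sub_sym EK muE Ff (Fdv m)); lra.
have Fdf' := FFd _ Ff'; have Fdd := FdomB Fdf' Ff.
apply: (fuk_ae Ffuk Ff'); first by case: Sf => -[].
apply: (nrm2_eq0_aeeq (Fdom_L2 Fdf') (Fdom_L2 Ff)); apply/ler_addgt0Pr => e e0.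
rewrite add0r; apply: le_trans (q1_nrm2_le EK muE Fdd) _.
have [|N HN] := small (e / 4); first by rewrite divr_gt0.
have [|N' HN'] := H' (e / 4); first by rewrite divr_gt0.
have := HN _ (leq_maxl N N'); have := HN' _ (leq_maxr N N'); set n := maxn N N'.
rewrite (q1_sub_sym EK muE (Fdv n) Fdf') => h1 h2.
apply: le_trans (q1_tri3 EK muE Fdf' Ff (Fdv n)) _; lra.
Qed.

End StepMinimum.

(** * Representation by the scale function *)

Section ChangeOfVariables.
Variables (R : realType) (E : set R).
Hypothesis EK : inK E.
Hypothesis nE : nowhere E.
Notation lam := (leb R).
Notation sc := (sc E).
Notation gd := (gap_density E).
Implicit Types (f g h u v w : R -> R) (x y z t a b c d : R).

Let mE := measurable_E EK.

(** Between x and y some interval avoids E, and [sc] has slope 1 on it. *)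
Lemma sc_lt x y : x < y -> sc x < sc y.
Proof.
move=> xy; have [c [d [xc cd dy nEcd]]] := nE xy.
have [xd cy] : x <= d /\ c <= y by split; lra.
have : 0 < sc d - sc c; last first.
  have := sc_le EK (ltW xc); have := sc_le EK (ltW dy); lra.
rewrite (sc_incr EK (ltW cd)) (@eq_Rintegral _ _ _ lam _ (fun=> 1)).
  rewrite Rintegral_cst; last exact: mitvcc.
  by rewrite leb_itvcc ?ltW//= mul1r subr_gt0.
by move=> t; rewrite inE/= in_itv/= => /nEcd; exact: gap_densityNE.
Qed.

Lemma sc_le_mono : {mono sc : x y / x <= y}.
Proof. by apply: le_mono => x y; exact: sc_lt. Qed.

Lemma sc_inj : injective sc. Proof. exact: inc_inj sc_le_mono. Qed.

Lemma sc_continuous : continuous sc.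
Proof.
move=> x; apply/cvgrPdist_lt => e e0; near=> t.
have : `|x - t| < e by near: t; exact: cvgr_dist_lt.
apply: le_lt_trans; have [xt|/ltW tx] := leP x t.
  rewrite distrC [leRHS]distrC !ger0_norm ?subr_ge0 ?sc_le_mono//.
  exact: sc_lip.
rewrite !ger0_norm ?subr_ge0 ?sc_le_mono//; exact: sc_lip.
Unshelve. all: by end_near. Qed.

Lemma measurable_sc : measurable_fun setT (sc : measurableTypeR R -> R).
Proof. by apply: continuous_measurable_fun; exact: sc_continuous. Qed.

Lemma sc_ivt x y s : x <= y -> sc x <= s <= sc y -> exists2 z, x <= z <= y & sc z = s.
Proof.
move=> xy ss; have [||z zxy zs] := @IVT R sc x y s xy.
- by apply: continuous_subspaceT; exact: sc_continuous.
- by rewrite min_l ?max_r// sc_le_mono.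
- by exists z.
Qed.

Lemma lam_itvD_E x y : x <= y -> lam (`[x, y] `\` E) = (sc y - sc x)%:E.
Proof.
move=> xy; have := @integral_indic _ (measurableTypeR R) R lam _ (mitvcc x y) _ (measurableC mE).
rewrite setIC -setDE => <-; rewrite (sc_incr EK xy) /Rintegral fineK; last first.
  apply: integrable_fin_num; first exact: mitvcc.
  exact: sqi_integrable_itv (sqi_gap_density EK x y).
by apply: eq_integral => t _; rewrite /gap_density !indicE in_setC; case: (t \in E); rewrite ?subrr ?subr0.
Qed.

Lemma lam_itvocD_E x y : x <= y -> lam (`]x, y] `\` E) = (sc y - sc x)%:E.
Proof.
move=> xy; rewrite -(lam_itvD_E xy).
have mI (b : bool) : @measurable _ (measurableTypeR R) [set` Interval (BSide b x) (BRight y)].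
  exact: measurable_itv.
have H (b : bool) := @integral_indic _ (measurableTypeR R) R lam _ (mI b) _ (measurableC mE).
rewrite !setDE setIC -(H false) setIC -(H true); apply: integral_itv_obnd_cbnd.
by apply/measurable_EFinP; apply: measurable_indic; exact: measurableC.
Qed.

(* sc maps the gaps isometrically and E to a null set, so it carries Lebesgue
   measure off E to Lebesgue measure. *)
Lemma lam_sc x y A : x <= y -> @measurable _ (measurableTypeR R) A ->
  lam (A `&` `[sc x, sc y]) = lam (sc @^-1` A `&` (`[x, y] `\` E)).
Proof.
move=> xy; set D := `[sc x, sc y]%classic; set K := _ `\` E.
have mD : @measurable _ (measurableTypeR R) D by exact: mitvcc.
have mK : @measurable _ (measurableTypeR R) K.
  by apply: measurableD => //; exact: mitvcc.
have sxy : sc x <= sc y by rewrite sc_le_mono.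
have lD : lam D = (sc y - sc x)%:E by exact: leb_itvcc.
have lK : lam K = (sc y - sc x)%:E by exact: lam_itvD_E.
have mp (B : set R) : @measurable _ (measurableTypeR R) B ->
    @measurable _ (measurableTypeR R) (sc @^-1` B).
  by move=> mB; rewrite -[X in measurable X]setTI; exact: measurable_sc.
move: A; apply: (@borel_ind R (fun A => lam (A `&` D) = lam (sc @^-1` A `&` K))).
- by rewrite preimage_setT !setTI lD lK.
- move=> t; have [tx|xt] := ltP t (sc x).
    rewrite !setIidr ?lD ?lK//.
      move=> s [/= + _]; rewrite !in_itv/= andbT => /andP[xs _].
      by apply: lt_le_trans tx _; rewrite sc_le_mono.
    by move=> s; rewrite /D/= !in_itv/= andbT => /andP[xs _]; exact: lt_le_trans xs.
  have [yt|ty] := leP (sc y) t.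
    have -> : sc @^-1` `]t, +oo[%classic `&` K = set0.
      apply/seteqP; split=> // s [/= + [+ _]]; rewrite !in_itv/= andbT => ts /andP[_].
      by rewrite bnd_simp -sc_le_mono leNgt (le_lt_trans yt ts).
    have -> : `]t, +oo[%classic `&` D = set0.
      apply/seteqP; split=> // s [/= + +]; rewrite !in_itv/= andbT => ts /andP[_].
      by rewrite bnd_simp leNgt (le_lt_trans yt ts).
    by rewrite !measure0.
  have [||z /andP[xz zy] zt] := @sc_ivt x y t => //; first by rewrite xt ltW.
  have -> : sc @^-1` `]t, +oo[%classic `&` K = `]z, y] `\` E.
    apply/seteqP; split=> s; rewrite /K/= !in_itv/= ?andbT -zt (leW_mono sc_le_mono).
      by move=> [zs [/andP[_ ->] nEs]]; rewrite zs.
    by move=> [/andP[zs sy] nEs]; rewrite zs sy (le_trans xz (ltW zs)).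
  have -> : `]t, +oo[%classic `&` D = `]sc z, sc y]%classic.
    apply/seteqP; split=> s; rewrite /D/= !in_itv/= ?andbT -zt.
      by move=> [-> /andP[_ ->]].
    move=> /andP[zs ->]; rewrite zs andbT; split=> //.
    by apply: le_trans (ltW zs); rewrite sc_le_mono.
  rewrite lam_itvocD_E// [LHS]lebesgue_measure_itv/= lte_fin.
  have := zy; rewrite le_eqVlt => /predU1P[->|h]; first by rewrite ltxx subrr.
  by rewrite sc_lt// -EFinB.
- move=> S mS HS; have mS' := mp S mS.
  have fD : (lam D < +oo)%E by rewrite lD ltry.
  have fK : (lam K < +oo)%E by rewrite lK ltry.
  have eD := measureD mD mS fD; have eK := measureD mK mS' fK.
  have -> : ~` S `&` D = D `\` S by rewrite setIC setDE.
  have -> : sc @^-1` (~` S) `&` K = K `\` sc @^-1` S by rewrite setIC setDE preimage_setC.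
  transitivity (lam D - lam (D `&` S))%E; first exact: eD.
  transitivity (lam K - lam (K `&` sc @^-1` S))%E; last exact: esym eK.
  congr (_ - _)%E; first exact: etrans lD (esym lK).
  by rewrite [D `&` S]setIC [K `&` _]setIC.
- move=> F mF tF HF; rewrite preimage_bigcup !setI_bigcupl !measure_bigcup//.
  + by apply: eq_eseriesr => n _; exact: HF.
  + by move=> n _; apply: measurableI => //; exact: mp.
  + apply: trivIset_setIr; move=> i j _ _ [s [Fi Fj]]; apply: tF => //.
    by exists (sc s).
  + by move=> n _; apply: measurableI.
  + exact: trivIset_setIr.
Qed.

(** Replacing the domain K by a restricted measure on the whole line puts the change of variables in
    the form of a push-forward under [sc]. *)
Lemma ge0_integral_mrestr (K : set (measurableTypeR R)) (mK : measurable K)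
    (f : measurableTypeR R -> \bar R) : measurable_fun setT f -> (forall x, 0 <= f x)%E ->
  (\int[mrestr lam mK]_x f x = \int[lam]_(x in K) f x)%E.
Proof.
move=> mf f0; have mKc := measurableC mK.
rewrite (@ge0_negligible_integral _ _ _ (mrestr lam mK) setT (~` K))//; last first.
  by rewrite /= /mrestr setICl measure0.
rewrite setDE setTI setCK; apply: eq_measure_integral => A mA AK.
by rewrite /= /mrestr setIidl.
Qed.

Lemma ge0_integral_sc (f : measurableTypeR R -> \bar R) x y : x <= y ->
  measurable_fun setT f -> (forall x, 0 <= f x)%E ->
  (\int[lam]_(s in `[sc x, sc y]) f s = \int[lam]_(t in `[x, y] `\` E) f (sc t))%E.
Proof.
move=> xy mf f0; have mD := mitvcc (sc x) (sc y).
have mK : @measurable _ (measurableTypeR R) (`[x, y] `\` E).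
  by apply: measurableD => //; exact: mitvcc.
rewrite -(ge0_integral_mrestr mD)// -(ge0_integral_mrestr mK (f := fun t => f (sc t)))//; last first.
  exact: measurableT_comp mf measurable_sc.
have msc : @measurable_fun _ _ (measurableTypeR R) (measurableTypeR R) setT sc.
  exact: measurable_sc.
pose phi : {mfun measurableTypeR R >-> measurableTypeR R} :=
  @mfun_Sub _ _ (measurableTypeR R) (measurableTypeR R) sc (mem_set msc).
have := @ge0_integral_pushforward _ _ _ _ R phi measurable_sc (mrestr lam mK) setT f measurableT mf
  (fun y _ => f0 y).
rewrite preimage_setT => <-; apply: eq_measure_integral => A mA _.
exact: lam_sc.
Qed.

Lemma integral_vanish_E h x y : (forall t, E t -> h t = 0) ->
  (\int[lam]_(t in `[x, y] `\` E) (h t)%:E = \int[lam]_(t in `[x, y]) (h t)%:E)%E.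
Proof.
move=> h0; rewrite integral_mkcond [RHS]integral_mkcond; apply: eq_integral => t _.
rewrite !patchE; have [Et|nEt] := pselect (E t).
  by rewrite h0// memNset ?if_same//; case.
congr (if _ then _ else _); apply/idP/idP => /set_mem; last by move=> H; rewrite mem_set.
by move=> [H _]; rewrite mem_set.
Qed.

Lemma integral_sc f x y : x <= y -> measurable_fun setT f ->
  (\int[lam]_(s in `[sc x, sc y]) (f s)%:E = \int[lam]_(t in `[x, y]) (f (sc t) * gd t)%:E)%E.
Proof.
move=> xy mf; have mf' : measurable_fun setT (EFin \o f : measurableTypeR R -> \bar R).
  by apply/measurable_EFinP.
rewrite -(@integral_vanish_E (fun t => f (sc t) * gd t)); last by move=> t Et; rewrite (gap_densityE Et) mulr0.
rewrite [RHS](eq_integral (fun t : measurableTypeR R => ((EFin \o f) \o sc) t)); last first.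
  by move=> t /set_mem[_ nEt]; rewrite gap_densityNE// mulr1.
rewrite [LHS]integralE [RHS]integralE (funepos_comp (EFin \o f) sc)
  (funeneg_comp (EFin \o f) sc); congr (_ - _)%E.
  by apply: ge0_integral_sc => //; exact: measurable_funepos.
by apply: ge0_integral_sc => //; exact: measurable_funeneg.
Qed.

Lemma integrable_sc f x y : x <= y -> measurable_fun setT f ->
  (lam.-integrable `[sc x, sc y] (EFin \o f) <->
   lam.-integrable `[x, y] (EFin \o (fun t => f (sc t) * gd t))).
Proof.
move=> xy mf.
have mh : measurable_fun setT (fun t : measurableTypeR R => f (sc t) * gd t).
  apply: measurable_funM; last exact: measurable_gap_density.
  exact: measurableT_comp mf measurable_sc.
have mn : measurable_fun setT (fun t => `|f t|) by exact: measurableT_comp.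
have e : (\int[lam]_(s in `[sc x, sc y]) `|(f s)%:E| =
    \int[lam]_(t in `[x, y]) `|(f (sc t) * gd t)%:E|)%E.
  rewrite [LHS](integral_sc xy mn); apply: eq_integral => t _.
  by rewrite /= normrM [`|gd t|]ger0_norm// gap_density_ge0.
have m1 : measurable_fun `[sc x, sc y]%classic (EFin \o f).
  by apply/measurable_EFinP; exact: measurable_funS mf.
have m2 : measurable_fun `[x, y]%classic (EFin \o (fun t : measurableTypeR R => f (sc t) * gd t)).
  by apply/measurable_EFinP; exact: measurable_funS mh.
by split=> /integrableP[_ h]; apply/integrableP; split=> //; move: h; rewrite /= e.
Qed.

Lemma scale_sc : scale E sc gd.
Proof.
split; first by move=> x y _ _; exact: sc_lt.
split; first split.
- exact: measurable_gap_density.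
- move=> x y _ _ xy; split; last exact: sc_incr.
  exact: sqi_integrable_itv (sqi_gap_density EK x y).
split; first by move=> x; exact: gap_density01.
by apply: ae_all => x _; exact: gap_densityNE.
Qed.

End ChangeOfVariables.

(** * Step representatives in the scale variable *)

Section ScaleRepresentation.
Variables (R : realType) (E : set R).
Hypothesis EK : inK E.
Hypothesis nE : nowhere E.
Notation OI := (openI E).
Notation sc := (sc E).
Notation gd := (gap_density E).
Notation slope := (slope E).
Implicit Types (f g h u v w G Gd : R -> R) (x y z t a b c d : R).

Lemma Iset_ge x : Iset E x -> exists2 y, E y & y <= x.
Proof.
case=> [/(openIP E)[y [z [Ey _ yx _]]]|Ex]; last by exists x.
by exists y => //; exact: ltW.
Qed.

Lemma Iset_le x : Iset E x -> exists2 y, E y & x <= y.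
Proof.
case=> [/(openIP E)[y [z [_ Ez _ xz]]]|Ex]; last by exists x.
by exists z => //; exact: ltW.
Qed.

(** The boundary condition of [adm_s] concerns the limit at c = inf sc(E). Having no least point, E
    approaches c without attaining it, so points far enough to the left fall where G is small. *)
Lemma adm_s_left G Gd (e : R) : adm_s E sc gd G Gd -> (forall x, E x -> exists2 y, E y & y < x) ->
  (exists c, forall x, E x -> c <= sc x) -> 0 < e ->
  exists2 x0, E x0 & forall x, Iset E x -> x <= x0 -> `|G (sc x)| <= e.
Proof.
move=> [_ [_ [H _]]] nomin [b bE] e0; pose A := sc @` E; pose c := inf A.
have hA : has_inf A.
  split; last by exists b => _ [x Ex <-]; exact: bE.
  by have [x [_ [Ex _ _]]] := exists_lt EK; exists (sc x), x.
have cE x : E x -> c <= sc x by move=> Ex; apply: ge_inf; [case: hA|exists x].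
have cI x : Iset E x -> c < sc x.
  move=> /Iset_ge[y Ey yx]; have [z Ez zy] := nomin y Ey.
  by apply: le_lt_trans (cE z Ez) _; apply: sc_lt => //; exact: lt_le_trans zy yx.
have cA d : 0 < d -> exists2 x, E x & sc x < c + d.
  by move=> d0; have [_ [x Ex <-] xd] := inf_adherent d0 hA; exists x.
have cA' d : 0 < d -> exists x, Iset E x /\ sc x < c + d.
  by move=> /cA[x Ex h]; exists x; split=> //; exact: E_Iset.
have /cvgrPdist_le/(_ e e0)[d /= d0 Hd] := H c cI cA'.
have [x0 Ex0 x0d] := cA d d0; exists x0 => // x Ix xx0.
have := Hd (sc x) _ (cI x Ix); rewrite sub0r normrN; apply.
rewrite /ball_ /= distrC ger0_norm; last by rewrite subr_ge0 ltW// cI.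
by rewrite ltrBlDl; apply: le_lt_trans x0d; rewrite sc_le_mono.
Qed.

Lemma adm_s_right G Gd (e : R) : adm_s E sc gd G Gd -> (forall x, E x -> exists2 y, E y & x < y) ->
  (exists c, forall x, E x -> sc x <= c) -> 0 < e ->
  exists2 x0, E x0 & forall x, Iset E x -> x0 <= x -> `|G (sc x)| <= e.
Proof.
move=> [_ [_ [_ H]]] nomax [b bE] e0; pose A := sc @` E; pose c := sup A.
have hA : has_sup A.
  split; last by exists b => _ [x Ex <-]; exact: bE.
  by have [x [_ [Ex _ _]]] := exists_lt EK; exists (sc x), x.
have cE x : E x -> sc x <= c by move=> Ex; apply: ub_le_sup; [case: hA|exists x].
have cI x : Iset E x -> sc x < c.
  move=> /Iset_le[y Ey yx]; have [z Ez zy] := nomax y Ey.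
  by apply: lt_le_trans (cE z Ez); apply: sc_lt => //; exact: le_lt_trans yx zy.
have cA d : 0 < d -> exists2 x, E x & c - d < sc x.
  by move=> d0; have [_ [x Ex <-] xd] := sup_adherent d0 hA; exists x.
have cA' d : 0 < d -> exists x, Iset E x /\ c - d < sc x.
  by move=> /cA[x Ex h]; exists x; split=> //; exact: E_Iset.
have /cvgrPdist_le/(_ e e0)[d /= d0 Hd] := H c cI cA'.
have [x0 Ex0 x0d] := cA d d0; exists x0 => // x Ix xx0.
have := Hd (sc x) _ (cI x Ix); rewrite sub0r normrN; apply.
rewrite /ball_ /= ger0_norm; last by rewrite subr_ge0 ltW// cI.
by rewrite ltrBlDl -ltrBlDr; apply: lt_le_trans x0d _; rewrite sc_le_mono.
Qed.

(** A chain rule through [integral_sc]. The energies agree because [gd] takes only the values 0 and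
    1, so that it equals its square. *)
Lemma adm_s_adm G Gd : adm_s E sc gd G Gd ->
  adm E (fun x => G (sc x)) (fun t => Gd (sc t) * gd t).
Proof.
move=> A; have [[mGd HG] [fin _]] := A.
have mh : measurable_fun setT (fun t : measurableTypeR R => Gd (sc t) * gd t).
  apply: measurable_funM; last exact: measurable_gap_density.
  exact: measurableT_comp mGd (measurable_sc EK nE).
split; first (split; first exact: mh).
  move=> x y Ix Iy xy.
  have [|iG eG] := HG (sc x) (sc y) (imageP _ Ix) (imageP _ Iy); first by rewrite sc_le_mono.
  split; first exact/(integrable_sc EK nE xy mGd).
  by rewrite eG /Rintegral (integral_sc EK nE xy mGd).
split.
  rewrite (eq_integral (fun x : measurableTypeR R => (Gd (sc x) ^+ 2 * gd x)%:E))//.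
  move=> x _; rewrite exprMn; congr (_ * _)%:E.
  by case: (gap_density01 E x) => ->; rewrite ?expr0n ?expr1n.
split=> c lc nEc; apply/cvgrPdist_le => e e0.
- have [|x0 Ex0 H] := adm_s_left A (lend_nomin lc nEc) _ e0.
    by exists (sc c) => x Ex; apply: (sc_le EK); rewrite -lee_fin lc lend_le.
  have cx0 : c < x0.
    have [y Ey yx] := lend_nomin lc nEc Ex0.
    by apply: le_lt_trans yx; rewrite -lee_fin lc lend_le.
  near=> t; rewrite sub0r normrN; apply: H; last by near: t; exact: nbhs_right_le.
  left; split; first by rewrite -lc lte_fin; near: t; exact: nbhs_right_gt.
  apply: lt_le_trans (rend_ge Ex0); rewrite lte_fin; near: t; exact: nbhs_right_lt.
- have [|x0 Ex0 H] := adm_s_right A (rend_nomax lc nEc) _ e0.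
    by exists (sc c) => x Ex; apply: (sc_le EK); rewrite -lee_fin lc rend_ge.
  have cx0 : x0 < c.
    have [y Ey yx] := rend_nomax lc nEc Ex0.
    by apply: lt_le_trans yx _; rewrite -lee_fin lc rend_ge.
  near=> t; rewrite sub0r normrN; apply: H; last by near: t; exact: nbhs_left_ge.
  left; split; last by rewrite -lc lte_fin; near: t; exact: nbhs_left_lt.
  apply: le_lt_trans (lend_le Ex0) _; rewrite lte_fin; near: t; exact: nbhs_left_gt.
Unshelve. all: by end_near. Qed.

(** The density of G composed with [sc] contains the factor [gd], which is 0 on E, so [der] reduces
    to the slope. *)
Lemma adm_s_steprep G Gd : adm_s E sc gd G Gd -> steprep E (fun x => G (sc x)).
Proof.
move=> A; have ad := adm_s_adm A; split.
- by have := sqi_slope EK ad.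
- move=> x y Ex Ey xy; rewrite (adm_der_itv EK ad Ex Ey xy); congr Rintegral; apply/funext => t.
  have [Et|nEt] := pselect (E t); last by rewrite der_notE.
  by rewrite der_E//= slope_E// gap_densityE// mulr0.
- move=> nomin bd e e0; have [x0 Ex0 H] := adm_s_left A nomin bd e0.
  by exists x0 => // x Ex; apply: H; exact: E_Iset.
- move=> nomax bd e e0; have [x0 Ex0 H] := adm_s_right A nomax bd e0.
  by exists x0 => // x Ex; apply: H; exact: E_Iset.
Qed.

(* The inverse of the scale on the union of the gaps, extended by a point of E
   so that slope u composed with it vanishes elsewhere. *)
Lemma push_slope u : exists Gd, measurable_fun setT Gd /\
  forall t, Iset E t -> Gd (sc t) = slope u t.
Proof.
have [x1 [_ [Ex1 _ _]]] := exists_lt EK.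
pose U y := [set x | (OI x /\ ~ E x) /\ sc x = y].
pose sig y := xget x1 (U y); pose Gd y := slope u (sig y).
have sigU t : OI t -> ~ E t -> sig (sc t) = t.
  move=> Ot nEt; have : U (sc t) (sig (sc t)) by apply: xgetI; split; first exact: (conj Ot nEt).
  by case=> _; exact: (sc_inj EK nE).
have sigN y : ~ (exists x, U y x) -> slope u (sig y) = 0.
  by move=> n; rewrite /sig xgetPN ?slope_E// => x Ux; apply: n; exists x.
exists Gd; split; last first.
  move=> t It; rewrite /Gd; have [Et|nEt] := pselect (E t).
    rewrite (slope_E u Et); apply: sigN => -[x [[_ nEx] /(sc_inj EK nE) xt]].
    by apply: nEx; rewrite xt.
  by rewrite sigU//; case: It.
have H (Y : set R) : ~ Y 0 -> @measurable _ (measurableTypeR R) [set y | Y (Gd y)].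
  move=> nY; apply: open_measurable; rewrite openE => y /= Yy.
  have [x [[Ox nEx] xy]] : exists x, U y x.
    by apply: contrapT => n; apply: nY; rewrite -(sigN y n).
  have [gp /andP[px xp]] := gapofP EK Ox nEx; move: (gapof E x) gp px xp => p gp px xp.
  have := @near_in_itvoo _ (sc p.1) (sc p.2) y.
  rewrite in_itv/= -xy !(leW_mono (sc_le_mono EK nE)) px xp => /(_ isT); apply: filterS => s.
  rewrite in_itv/= => /andP[ps sp]; have [p12 _] := gp.
  have [|z /andP[pz zp] zs] := sc_ivt EK nE (ltW p12) (s := s); first by rewrite !ltW.
  have zp' : p.1 < z < p.2 
    by have mono := leW_mono (sc_le_mono EK nE); rewrite -(mono p.1 z) -(mono z p.2) zs ps.
  have [Oz nEz] := gap_openI gp zp'.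
  move: Yy; rewrite /Gd -xy -zs !sigU// !(slope_gap _ gp)//.
  by rewrite px.
move=> _ Y mY; rewrite setTI; have [Y0|nY0] := pselect (Y 0); last exact: H.
by rewrite -[X in measurable X]setCK; apply: measurableC; exact: (H (~` Y)).
Qed.

Lemma steprep_adm_s u : steprep E u -> exists G Gd, adm_s E sc gd G Gd /\
  forall x, E x -> G (sc x) = u x.
Proof.
move=> su; have [ssu pu bl br] := su; have [Gd [mGd GdE]] := push_slope u.
(* This is [lin u] composed with the inverse of [sc], which is injective because E is nowhere
   dense. *)
pose G y := lin E u (xget 0 [set x | Iset E x /\ sc x = y]).
have GE x : Iset E x -> G (sc x) = lin E u x.
  move=> Ix; rewrite /G; have : [set z | Iset E z /\ sc z = sc x] (xget 0 [set z | Iset E z /\ sc z = sc x]).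
    by apply: xgetI; split; first exact: Ix.
  by case=> _ /(sc_inj EK nE) ->.
have GdgE t : Iset E t -> Gd (sc t) * gd t = slope u t.
  move=> It; rewrite GdE//; have [Et|nEt] := pselect (E t).
    by rewrite slope_E// mul0r.
  by rewrite gap_densityNE// mulr1.
exists G, Gd; split; last by move=> x Ex; rewrite GE ?lin_E//; exact: E_Iset.
split.
  split=> // _ _ [x Ix <-] [y Iy <-]; rewrite sc_le_mono// => xy.
  have e : {in `[x, y]%classic, (fun t : measurableTypeR R => (Gd (sc t) * gd t)%:E) =1
      (fun t => (slope u t)%:E)}.
    move=> t; rewrite inE/= in_itv/= => /andP[xt ty]; rewrite GdgE//.
    exact: Iset_convex Ix Iy xt ty.
  have iu := sqi_integrable_itv (sqi_OI_itv Ix Iy ssu).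
  split.
    apply/(integrable_sc EK nE xy mGd); apply: eq_integrable iu; first exact: mitvcc.
    by move=> t ht /=; rewrite -(e t ht).
  by rewrite !GE// (lin_incr EK ssu pu Ix Iy xy) /Rintegral (integral_sc EK nE xy mGd);
    congr fine; apply: eq_integral => t ht; exact: esym (e t ht).
split.
  have [_] := ssu; congr (_ < _)%E; apply: eq_integral => t /set_mem Ot.
  have It : Iset E t by left.
  rewrite -(GdgE t It) exprMn; congr (_ * _)%:E.
  by case: (gap_density01 E t) => ->; rewrite ?expr0n ?expr1n.
split=> c cI cA; apply/cvgrPdist_le => e e0.
- have nomin x : E x -> exists2 y, E y & y < x.
    move=> Ex; have [|y [Iy yc]] := cA (sc x - c); first by rewrite subr_gt0 cI//; exact: E_Iset.
    have [z Ez zy] := Iset_ge Iy; exists z => //; apply: le_lt_trans zy _.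
    by rewrite -(leW_mono (sc_le_mono EK nE)); move: yc; rewrite addrC subrK.
  have [|x0 Ex0 H] := bl nomin _ e e0; first by exists c => x /E_Iset/cI/ltW.
  have cx0 := cI x0 (E_Iset Ex0).
  near=> y; rewrite sub0r normrN.
  have yx0 : y < sc x0 by near: y; exact: nbhs_right_lt.
  have cy : c < y by near: y; exact: nbhs_right_gt.
  (* A y slightly above c lies between two values of [sc], hence is itself [sc z] for some z in
     [Iset E] left of x0, where [lin u] is small. *)
  have [|x1 [Ix1 x1y]] := cA (y - c); first by rewrite subr_gt0.
  rewrite addrC subrK in x1y.
  have x10 : x1 <= x0 by rewrite -(sc_le_mono EK nE) ltW// (lt_trans x1y).
  have [|z /andP[xz zx] zy] := sc_ivt EK nE x10 (s := y); first by rewrite !ltW.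
  have Iz := Iset_convex Ix1 (E_Iset Ex0) xz zx.
  by rewrite -zy GE//; exact: (lin_small_left EK Ex0 H).
- have nomax x : E x -> exists2 y, E y & x < y.
    move=> Ex; have [|y [Iy yc]] := cA (c - sc x); first by rewrite subr_gt0 cI//; exact: E_Iset.
    have [z Ez zy] := Iset_le Iy; exists z => //; apply: lt_le_trans zy.
    by rewrite -(leW_mono (sc_le_mono EK nE)); move: yc; rewrite opprB addrC subrK.
  have [|x0 Ex0 H] := br nomax _ e e0; first by exists c => x /E_Iset/cI/ltW.
  have cx0 := cI x0 (E_Iset Ex0).
  near=> y; rewrite sub0r normrN.
  have yx0 : sc x0 < y by near: y; exact: nbhs_left_gt.
  have cy : y < c by near: y; exact: nbhs_left_lt.
  have [|x1 [Ix1 x1y]] := cA (c - y); first by rewrite subr_gt0.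
  rewrite opprB addrC subrK in x1y.
  have x10 : x0 <= x1 by rewrite -(sc_le_mono EK nE) ltW// (lt_trans yx0).
  have [|z /andP[xz zx] zy] := sc_ivt EK nE x10 (s := y); first by rewrite !ltW.
  have Iz := Iset_convex (E_Iset Ex0) Ix1 xz zx.
  by rewrite -zy GE//; exact: (lin_small_right EK Ex0 H).
Unshelve. all: by end_near. Qed.

End ScaleRepresentation.

(** * Identification of the minimal element *)

Section MinimalElement.
Variables (R : realType) (E : set R)
  (mu : {measure set (measurableTypeR R) -> \bar R}).
Hypothesis EK : inK E.
Hypothesis muE : radon_full E mu.
Hypothesis nE : nowhere E.
Notation lam := (leb R).
Notation sc := (sc E).
Notation gd := (gap_density E).
Implicit Types (f g : R -> R) (p : R * R).

Lemma step_domain_Fdom_s f : step_domain E mu f <-> Fdom_s E mu sc gd f.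
Proof.
split=> [[Lf [u su fu]]|[Lf [G [Gd [A fG]]]]]; split=> //.
  have [G [Gd [A GE]]] := steprep_adm_s EK nE su.
  exists G, Gd; split=> //; apply: aeeq_trans fu _; apply: (aeeq_on EK muE) => x Ex.
  by rewrite /= GE.
by exists (fun x => G (sc x)) => //; exact: adm_s_steprep A.
Qed.

Lemma rep_s_adm f : Fdom_s E mu sc gd f ->
  adm_s E sc gd (rep_s E mu sc gd f).1 (rep_s E mu sc gd f).2 /\
  aeeq mu f ((rep_s E mu sc gd f).1 \o sc).
Proof.
move=> [_ [G [Gd [A fG]]]].
have : [set p : (R -> R) * (R -> R) | adm_s E sc gd p.1 p.2 /\ aeeq mu f (p.1 \o sc)]
  (rep_s E mu sc gd f) by apply: (@xgetI _ _ _ (G, Gd)); split; [exact: A|exact: fG].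
by [].
Qed.

(** Makes the denominators of the jump terms the same in the scale and in the Euclidean variable. *)
Lemma sc_gap p : gaps E p -> sc p.2 - sc p.1 = p.2 - p.1.
Proof.
move=> gp; have [p12 _] := gp.
have mp : p.1 < (p.1 + p.2) / 2 < p.2 by rewrite !midf_lt.
have [Om nEm] := gap_openI gp mp; have := slope_sc EK (or_introl Om : Iset E _).
rewrite (slope_gap _ gp mp) gap_densityNE// => h.
by rewrite -[RHS]mul1r -h divfK// subr_eq0 gt_eqF.
Qed.

(** Both forms reduce to their jump parts: the density of [sc] is 0 on E, and [jump_step] removes
    the Euclidean local part. The two chosen representatives agree at gap ends because they agree
    a.e. and are continuous on E. *)
Lemma Eform_Eform_s f g : step_domain E mu f -> step_domain E mu g ->
  Eform E mu f g = Eform_s E mu sc gd f g.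
Proof.
move=> Sf Sg; rewrite (jump_step EK muE Sf Sg) /Eform_s.
rewrite (@eq_Rintegral _ _ _ lam _ (fun=> 0)); last first.
  by move=> x /set_mem[Ex _]; rewrite (gap_densityE Ex) mulr0.
rewrite Rintegral_cst ?mul0r ?mulr0 ?add0r; last first.
  by apply: measurableI; [exact: measurable_E|exact: measurable_openI].
have key k p : step_domain E mu k -> gaps E p ->
    (rep E mu k).1 p.2 - (rep E mu k).1 p.1 =
    (rep_s E mu sc gd k).1 (sc p.2) - (rep_s E mu sc gd k).1 (sc p.1).
  move=> Sk [_ [E1 [E2 _]]]; have [a1 e1] := rep_adm (step_domain_Fdom EK muE Sk).
  have [A e2] := rep_s_adm ((step_domain_Fdom_s k).1 Sk).
  have H := adm_eq_on EK muE a1 (adm_s_adm EK nE A) (aeeq_trans (aeeq_sym e1) e2).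
  by rewrite !H.
congr (_ * _); rewrite /gsum; congr (fine _ - fine _); apply: eq_esum => p gp;
by rewrite !key// sc_gap.
Qed.

Lemma step_domain_charset : charset_empty E mu (step_domain E mu).
Proof.
exists sc, gd; split; first exact: scale_sc.
split; first exact: step_domain_Fdom_s.
split; first exact: Eform_Eform_s.
rewrite (_ : _ `&` _ = set0) ?measure0//; apply/seteqP; split=> // x [Ex /=].
by rewrite gap_densityE// => /esym/eqP; rewrite oner_eq0.
Qed.

Lemma step_domain_minimal : minimal_fuk E mu (step_domain E mu).
Proof.
split; first exact: step_domain_fukushima.
move=> F FF FS; apply/seteqP; split=> //; exact: step_domain_fuk.
Qed.

(** The step domain is the least Fukushima subspace, so a minimal one contains it and must equal it;
    this is the uniqueness. *)
Lemma minimal_fuk_step_domain F : minimal_fuk E mu F -> F = step_domain E mu.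
Proof.
move=> [FF H]; symmetry; apply: H; first exact: step_domain_fukushima.
exact: step_domain_fuk.
Qed.

End MinimalElement.

Theorem theorem5p5 (R : realType) (E : set R)
  (mu : {measure set (measurableTypeR R) -> \bar R}) :
  inK E -> radon_full E mu ->
  ((exists F' : set (R -> R), minimal_fuk E mu F') <-> interior E = set0) /\
  (interior E = set0 ->
     (forall F1 F2 : set (R -> R),
        minimal_fuk E mu F1 -> minimal_fuk E mu F2 -> F1 = F2) /\
     (forall F' : set (R -> R), minimal_fuk E mu F' ->
        charset_empty E mu F' /\
        forall f g, F' f -> F' g -> Eform E mu f g = jump E mu f g)).
Proof.
move=> EK muE; split.
  split=> [[F' [FF minF]]|/(interior_nowhere EK) nE]; last first.
    by exists (step_domain E mu); exact: step_domain_minimal.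
  apply: contrapT => /eqP/set0P iE.
  have [F'' [FF'' sub neq]] := fuk_not_minimal EK muE FF iE.
  exact: neq (minF _ FF'' sub).
move=> /(interior_nowhere EK) nE; split=> [F1 F2 m1 m2|F' mF].
  by rewrite (minimal_fuk_step_domain EK muE nE m1) (minimal_fuk_step_domain EK muE nE m2).
rewrite (minimal_fuk_step_domain EK muE nE mF).
split; first exact: step_domain_charset.
by move=> f g; exact: jump_step.
Qed.
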